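(* Let $(X_t)_{t\ge0}$ be an ergodic, time-homogeneous Markov process on $\mathbb{R}^d$ with invariant probability measure $\mu$, and let $\mathcal L$ with domain $\mathscr D(\mathcal L)$ be the infinitesimal generator of its transition semigroup on $L^2(\mu)$. Assume the iterated Poincaré inequality: there exists $\lambda_{\mathrm I}>0$ such that $\|\mathcal Lf\|_{L^2(\mu)}\ge\lambda_{\mathrm I}\|f\|_{L^2(\mu)}$ for all $f\in\mathscr D(\mathcal L)$ with $\mu(f)=0$. Let $p>0$ and assume $\mu(|\cdot|^q)<\infty$ for some $q>p$. Define $\gamma_1:=\max\{\frac14,1-\frac pd\}\in(0,1)$. Then there exists $C>0$ such that for all $T\ge2$, $$\mathbb{E}^\mu\big[\mathcal{T}_p(\mu_T,\mu)\big]\le C\,T^{-\frac23\left(1-\max\{\gamma_1,\frac pq\}\right)}\Big(\mathbf 1_{\{\gamma_1q=p\}}\log T+\mathbf 1_{\{\gamma_1q\ne p\}}\Big)\Big(\mathbf 1_{\{p=\frac34d\}}\log T+\mathbf 1_{\{p\ne\frac34 d\}}\Big).$$ In particular, if $q>4p$, then $\mathbb{E}^\mu[\mathcal{T}_p(\mu_T,\mu)]\le CT^{-1/2}$ if $p>\frac34d$, $\le CT^{-1/2}\log T$ if $p=\frac34 d$, and $\le CT^{-\frac{2p}{3d}}$ if $p<\frac34d$.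
   Context: For probability measures $\nu_0,\nu_1$ on $\mathbb{R}^d$ and $p\in(0,\infty)$, $\mathcal{T}_p(\nu_0,\nu_1):=\inf_{\pi}\int|x-y|^p\,\pi(\mathrm dx,\mathrm dy)$, the infimum over all couplings $\pi$ of $\nu_0,\nu_1$. The empirical measure is $\mu_T:=\frac1T\int_0^T\delta_{X_t}\,\mathrm dt$. $\mathbb{E}^\mu$ denotes expectation when $X_0\sim\mu$. $\mu(f)=\int f\,\mathrm d\mu$ and $\mu(|\cdot|^q)=\int|x|^q\,\mu(\mathrm dx)$. $\mathbf 1_{\{\cdot\}}$ equals $1$ if the stated condition holds and $0$ otherwise. *)

(* Defs.v *)
From HB Require Import structures.
From mathcomp Require Import all_boot all_order all_algebra.
From mathcomp Require Import all_classical all_reals all_analysis.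
Set Implicit Arguments. Unset Strict Implicit. Unset Printing Implicit Defensive.
Import Order.TTheory GRing.Theory Num.Theory.
Import numFieldNormedType.Exports.
Local Open Scope classical_set_scope.
Local Open Scope ring_scope.

Definition Rd (R : realType) (d : nat) := g_sigma_algebraType (@open 'rV[R]_d).

Definition enorm (R : realType) (d : nat) (x : 'rV[R]_d) : R :=
  Num.sqrt (\sum_(i < d) x ord0 i ^+ 2).

Definition is_coupling (R : realType) (d : nat) (nu0 nu1 : set (Rd R d) -> \bar R)
  (pi : probability (Rd R d * Rd R d)%type R) : Prop :=
  (forall A : set (Rd R d), measurable A -> pi (A `*` setT) = nu0 A) /\
  (forall B : set (Rd R d), measurable B -> pi (setT `*` B) = nu1 B).

Definition Tcost (R : realType) (d : nat) (p : R) (nu0 nu1 : set (Rd R d) -> \bar R)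
  : \bar R :=
  ereal_inf [set (\int[pi]_z (enorm ((z.1 : 'rV[R]_d) - z.2) `^ p)%:E)%E
            | pi in is_coupling nu0 nu1].

Definition empirical (R : realType) (d : nat) (dO : measure_display) (O : measurableType dO)
  (X : R -> O -> Rd R d) (T : R) (w : O) : set (Rd R d) -> \bar R :=
  fun A => ((T^-1)%:E * \int[lebesgue_measure]_(t in [set t : R | (0 <= t <= T)%R])
                           (\1_A (X t w))%:E)%E.

Definition transition_op (R : realType) (d : nat)
  (k : R -> R.-pker (Rd R d) ~> (Rd R d)) (t : R) (f : Rd R d -> R) (x : Rd R d) : R :=
  fine (\int[k t x]_y (f y)%:E)%E.

(* f is in the L^2(mu)-domain of the L2_generator, with L f = g:
   f, g in L^2(mu) and (P_t f - f)/t -> g in L^2(mu) as t -> 0+ *)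
Definition L2_generator (R : realType) (d : nat) (mu : probability (Rd R d) R)
  (k : R -> R.-pker (Rd R d) ~> (Rd R d)) (f g : Rd R d -> R) : Prop :=
  measurable_fun setT f /\ measurable_fun setT g /\
  (\int[mu]_x (f x ^+ 2)%:E < +oo)%E /\ (\int[mu]_x (g x ^+ 2)%:E < +oo)%E /\
  (fun t => \int[mu]_x (((transition_op k t f x - f x) / t - g x) ^+ 2)%:E)%E
     @ 0^'+ --> (0 : \bar R).

Definition mu_invariant (R : realType) (d : nat) (mu : probability (Rd R d) R)
  (k : R -> R.-pker (Rd R d) ~> (Rd R d)) : Prop :=
  forall t : R, 0 <= t -> forall A : set (Rd R d), measurable A ->
    (\int[mu]_x k t x A)%E = mu A.

Definition kergodic (R : realType) (d : nat) (mu : probability (Rd R d) R)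
  (k : R -> R.-pker (Rd R d) ~> (Rd R d)) : Prop :=
  forall A : set (Rd R d), measurable A ->
    (forall t : R, 0 <= t -> {ae mu, forall x, k t x A = (\1_A x)%:E}) ->
    mu A = 0%E \/ mu A = 1%E.

(* X is a (jointly measurable) time-homogeneous Markov process on (O, P)
   with transition kernels k_t, t >= 0 (Markov property w.r.t. the natural
   filtration, tested on cylinder events). *)
Definition is_markov_process (R : realType) (d : nat) (dO : measure_display)
  (O : measurableType dO) (P : probability O R) (X : R -> O -> Rd R d)
  (k : R -> R.-pker (Rd R d) ~> (Rd R d)) : Prop :=
  measurable_fun [set z : R * O | 0 <= z.1] (fun z => X z.1 z.2) /\
  forall (n : nat) (r : 'I_n -> R) (A : 'I_n -> set (Rd R d)) (s t : R)
         (B : set (Rd R d)),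
    0 <= s -> 0 <= t -> (forall i, 0 <= r i <= s) ->
    (forall i, measurable (A i)) -> measurable B ->
    P [set w | (forall i, A i (X (r i) w)) /\ B (X (s + t) w)] =
    (\int[P]_(w in [set w | forall i, A i (X (r i) w)]) k t (X s w) B)%E.

(* Main.v *)
(* The empirical measure and [mu] are compared on a tree of dyadic cells: [R^d] is cut
   into the ball [|x| < 1] and the shells [2 ^ (n - 1) <= |x| < 2 ^ n], [0 < n <= N], the
   scaled shells into dyadic cubes of [L] generations, and the mass outside the shells is
   moved at the price [outer_cost].  Matching mass greedily from the finest level up
   yields a coupling whose cost is controlled by the discrepancies [|mu_T F - mu F|] of
   the cells [F].

   A discrepancy is at most [2 mu(F)] on average, and its square is at most
   [c mu(F) / T] on average.  The latter follows from the iterated Poincare inequality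
   without any regularity of the semigroup: for the future time average
   [Y = int a(s) f(X_s) ds] with a smooth enough weight [a], the function
   [h(x) = E (Y | X_0 = x)] lies in the domain of the generator and [L h] is represented
   by [- int a'(s) f(X_s) ds], so that [|h| <= |L h| / lambda] bounds the
   time-integrated correlation of [f] in terms of [|f|^2].

   With [x] the sum of the discrepancies of the cells of one level in one shell, the two
   bounds are interpolated as [x <= (bound on x)^(1 - 2 a) (bound on x^2)^a], where [a] is
   the exponent of the theorem.  As [0 < a <= 1/2], [d a < p] and [p < q (1 - a)], the
   sums over the levels and over the shells are both geometric, with a total of order
   [T^(- a)]. *)
Require Import Defs.
From HB Require Import structures.
From mathcomp Require Import all_boot all_order all_algebra.
From mathcomp Require Import all_classical all_reals all_analysis.
From mathcomp Require Import measurable_realfun ring lra.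
Import Order.TTheory GRing.Theory Num.Theory.
Import numFieldNormedType.Exports.
Local Open Scope classical_set_scope.
Local Open Scope ring_scope.
Set Implicit Arguments. Unset Strict Implicit. Unset Printing Implicit Defensive.

(** The kernels [k t] are not assumed jointly measurable in [t], so a potential [int a(s) P_[s] f
    ds] cannot be formed from them. The process itself is jointly measurable: the time average along
    a path is a bounded random variable, and its conditional expectation given [X 0] exists by
    Radon-Nikodym. What is known of that function is tested against bounded functions, never read
    pointwise. All of this happens in the class [bm], which is closed under products, Fubini and
    conditioning, and on which integrals are real numbers.

    The obvious weight, the indicator of [[0, t]], would ask for some continuity of the semigroup
    before its difference quotients converge. Its two jumps are therefore replaced by ramps of
    length 1. The derivative of the weight then has [L^1] norm at most 2 whatever [t] is, which
    keeps [|L h|] below [2 |f|], and exchanging the two weights costs another [2 |f|^2]. This is the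
    origin of the constant [2 / lam + 2]. *)

Definition bm d (T : measurableType d) (R : realType) (f : T -> R) :=
  measurable_fun setT f /\ exists M : R, forall x, `|f x| <= M.

(** * Bounded measurable functions *)

Section BoundedMeasurable.
Context d (T : measurableType d) (R : realType).
Implicit Types f g : T -> R.

Lemma bm_cst (c : R) : bm (fun _ : T => c).
Proof. by split; [exact: measurable_cst | exists `|c|]. Qed.

Lemma bmD f g : bm f -> bm g -> bm (fun x => f x + g x).
Proof.
move=> [mf [M fM]] [mg [N gN]]; split; first exact: measurable_funD.
by exists (M + N) => x; rewrite (le_trans (ler_normD _ _))// lerD.
Qed.

Lemma bmM f g : bm f -> bm g -> bm (fun x => f x * g x).
Proof.
move=> [mf [M fM]] [mg [N gN]]; split; first exact: measurable_funM.
by exists (M * N) => x; rewrite normrM ler_pM.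
Qed.

Lemma bmN f : bm f -> bm (fun x => - f x).
Proof.
move=> [mf [M fM]]; split; first exact: measurable_funN.
by exists M => x; rewrite normrN.
Qed.

Lemma bmB f g : bm f -> bm g -> bm (fun x => f x - g x).
Proof. by move=> bf bg; apply: bmD => //; exact: bmN. Qed.

Lemma bm_norm f : bm f -> bm (fun x => `|f x|).
Proof.
move=> [mf [M fM]]; split; first exact: measurableT_comp.
by exists M => x; rewrite normr_id.
Qed.

Lemma bmX f n : bm f -> bm (fun x => f x ^+ n).
Proof.
move=> [mf [M fM]]; split; first exact: measurable_funX.
by exists (M ^+ n) => x; rewrite normrX lerXn2r// nnegrE// (le_trans _ (fM x)).
Qed.

Lemma bm_indic (A : set T) : measurable A -> bm (\1_A : T -> R).
Proof.
move=> mA; split; first exact: measurable_indic.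
by exists 1 => x; rewrite indicE; case: (_ \in _); rewrite ?normr1// normr0.
Qed.

Lemma bm_comp d' (T' : measurableType d') (u : T' -> T) f :
  measurable_fun setT u -> bm f -> bm (fun x => f (u x)).
Proof.
move=> mu [mf [M fM]]; split; first exact: measurableT_comp.
by exists M => x.
Qed.

Lemma bm_sum (I : Type) (s : seq I) (F : I -> T -> R) :
  (forall i, bm (F i)) -> bm (fun x => \sum_(i <- s) F i x).
Proof.
move=> bF; elim: s => [|i s ih].
  by rewrite (_ : (fun _ => _) = fun _ => 0); [exact: bm_cst | apply/funext => x; rewrite big_nil].
rewrite (_ : (fun _ => _) = fun x => F i x + \sum_(i <- s) F i x); first exact: bmD.
by apply/funext => x; rewrite big_cons.
Qed.

(* Peeling off [c / 2] times the indicator of [c / 2 <= f] halves the range of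
   [f], so that [L f] is arbitrarily small after finitely many steps. *)
Lemma bm_ext (L : (T -> R) -> R) (C : R) : 0 <= C ->
  (forall f g, bm f -> bm g -> L (fun x => f x + g x) = L f + L g) ->
  (forall c f, bm f -> L (fun x => c * f x) = c * L f) ->
  (forall f (e : R), bm f -> (forall x, `|f x| <= e) -> `|L f| <= C * e) ->
  (forall A, measurable A -> L \1_A = 0) ->
  forall f, bm f -> L f = 0.
Proof.
move=> C0 LD LZ LC L1.
have key n : forall f (c : R), bm f -> 0 <= c -> (forall x, 0 <= f x <= c) ->
    `|L f| <= C * (c / 2 ^+ n).
  elim: n => [|n ih] f c bf c0 fc.
    rewrite expr0 divr1; apply: LC => // x.
    by have /andP[f0 fx] := fc x; rewrite ger0_norm.
  pose A := [set x | c / 2 <= f x].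
  have mA : measurable A.
    rewrite [A](_ : _ = f @^-1` `[c / 2, +oo[); last first.
      by apply/seteqP; split => x /=; rewrite in_itv/= andbT.
    by rewrite -[X in measurable X]setTI; apply: bf.1 => //; exact: measurable_itv.
  pose g := fun x => f x + (- (c / 2)) * \1_A x.
  have b1 := bm_indic mA.
  have bg : bm g by apply: bmD => //; apply: bmM => //; exact: bm_cst.
  have -> : L f = L g.
    rewrite /g LD//; last by apply: bmM => //; exact: bm_cst.
    by rewrite LZ// L1// mulr0 addr0.
  apply: le_trans (ih g (c / 2) bg _ _) _.
  - by rewrite divr_ge0.
  - move=> x; rewrite /g indicE; have /andP[f0 fx] := fc x.
    case: (boolP (x \in A)) => [/set_mem/= Ax|/negP nAx]; rewrite /= ?mulr1 ?mulr0.
      have {}Ax : c / 2 <= f x := Ax.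
      by apply/andP; split; lra.
    have : f x < c / 2 by rewrite ltNge; apply/negP => ?; apply: nAx; rewrite inE.
    by move=> ?; apply/andP; split; lra.
  - by rewrite exprS invfM (mulrA c).
have pos f (c : R) : bm f -> 0 <= c -> (forall x, 0 <= f x <= c) -> L f = 0.
  move=> bf c0 fc; apply/eqP; rewrite -normr_le0; apply/ler_addgt0Pr => e e0.
  rewrite add0r.
  have [n nP] : exists n : nat, C * c / e < n%:R.
    by exists (Num.truncn (C * c / e)).+1; rewrite truncnS_gt.
  apply: le_trans (key n f c bf c0 fc) _.
  rewrite mulrA ler_pdivrMr ?exprn_gt0//.
  have : n%:R <= 2 ^+ n :> R by rewrite -natrX ler_nat ltnW// ltn_expl.
  move: nP; rewrite ltr_pdivrMr// => nP n2.
  by rewrite (le_trans (ltW nP))// mulrC ler_wpM2l// ltW.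
move=> f bf; have [mf [M fM]] := bf.
have M0 (x : T) : 0 <= M by rewrite (le_trans _ (fM x)).
have [x0|nT] := pselect (exists x : T, True); last first.
  have /= h := LC f 0 bf; apply/eqP; rewrite -normr_le0 -[0](mulr0 C) h//.
  by move=> x; case: nT; exists x.
have {x0}M0 : 0 <= M by case: x0 => x _; exact: M0 x.
have b1 : bm (\1_setT : T -> R) by exact: bm_indic.
have := pos (fun x => f x + M * \1_setT x) (M + M).
rewrite LD//; last by apply: bmM => //; exact: bm_cst.
rewrite LZ// L1// mulr0 addr0; apply.
- by apply: bmD => //; apply: bmM => //; exact: bm_cst.
- exact: addr_ge0.
- move=> x; rewrite indicT/= mulr1; have := fM x; rewrite ler_norml => /andP[? ?].
  by apply/andP; split; lra.
Qed.

End BoundedMeasurable.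

(** * Real-valued integrals against a finite measure *)

Section FiniteIntegral.
Context d (T : measurableType d) (R : realType).
Variable m : {finite_measure set T -> \bar R}.
Implicit Types f g : T -> R.

Lemma bm_integrable f : bm f -> m.-integrable setT (EFin \o f).
Proof.
move=> [mf [M fM]]; apply: measurable_bounded_integrable => //.
  by rewrite -ge0_fin_numE// fin_num_measure.
by exists M; split; [exact: num_real | move=> K MK x _; exact: le_trans (ltW MK)].
Qed.

Lemma bm_RintegralE f : bm f -> (\int[m]_x (f x)%:E = (\int[m]_x f x)%:E)%E.
Proof. by move=> bf; rewrite fineK// integrable_fin_num//; exact: bm_integrable. Qed.

Lemma bm_RintegralD f g : bm f -> bm g ->
  \int[m]_x (f x + g x) = \int[m]_x f x + \int[m]_x g x.
Proof. by move=> bf bg; rewrite RintegralD//; exact: bm_integrable. Qed.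

Lemma bm_RintegralB f g : bm f -> bm g ->
  \int[m]_x (f x - g x) = \int[m]_x f x - \int[m]_x g x.
Proof. by move=> bf bg; rewrite RintegralB//; exact: bm_integrable. Qed.

Lemma bm_RintegralZl c f : bm f -> \int[m]_x (c * f x) = c * \int[m]_x f x.
Proof. by move=> bf; rewrite RintegralZl//; exact: bm_integrable. Qed.

Lemma bm_RintegralZr c f : bm f -> \int[m]_x (f x * c) = \int[m]_x f x * c.
Proof. by move=> bf; rewrite RintegralZr//; exact: bm_integrable. Qed.

Lemma bm_le_Rintegral f g : bm f -> bm g -> (forall x, f x <= g x) ->
  \int[m]_x f x <= \int[m]_x g x.
Proof. by move=> bf bg fg; apply: le_Rintegral => //; exact: bm_integrable. Qed.

Lemma bm_le_normr_Rintegral f : bm f -> `|\int[m]_x f x| <= \int[m]_x `|f x|.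
Proof. by move=> bf; apply: le_normr_Rintegral => //; exact: bm_integrable. Qed.

Lemma bm_integral_in f (A : set T) : bm f -> measurable A ->
  (\int[m]_(x in A) (f x)%:E = (\int[m]_x (f x * \1_A x))%:E)%E.
Proof.
move=> bf mA; rewrite integral_mkcond -(bm_RintegralE (bmM bf (bm_indic R mA))).
by apply: eq_integral => x _; rewrite /patch indicE; case: ifP => _; rewrite ?mulr1 ?mulr0.
Qed.

Lemma bm_Rintegral_sum (J : Type) (s : seq J) (F : J -> T -> R) : (forall j, bm (F j)) ->
  \int[m]_x (\sum_(j <- s) F j x) = \sum_(j <- s) \int[m]_x F j x.
Proof.
move=> bF; elim: s => [|j s ih].
  rewrite big_nil; under eq_Rintegral do rewrite big_nil.
  by rewrite Rintegral_cst// mul0r.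
rewrite big_cons; under eq_Rintegral do rewrite big_cons.
by rewrite bm_RintegralD ?ih//; exact: bm_sum.
Qed.

Lemma RintegralT_cst c : \int[m]_x c = c * fine (m setT).
Proof. by rewrite Rintegral_cst. Qed.

Lemma Rintegral_indicT (A : set T) : measurable A -> \int[m]_x \1_A x = fine (m A).
Proof. by move=> mA; rewrite /Rintegral integral_indic// setIT. Qed.

Lemma Rintegral_bound f (e : R) : bm f -> (forall x, `|f x| <= e) ->
  `|\int[m]_x f x| <= fine (m setT) * e.
Proof.
move=> bf fe; rewrite (le_trans (bm_le_normr_Rintegral bf))//.
rewrite mulrC -RintegralT_cst; apply: bm_le_Rintegral => //; last exact: bm_cst.
exact: bm_norm.
Qed.

Lemma fine_mT_ge0 : 0 <= fine (m setT).
Proof. by rewrite fine_ge0. Qed.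

Lemma integrableB_EFin f g : m.-integrable setT (EFin \o f) ->
  m.-integrable setT (EFin \o g) -> m.-integrable setT (EFin \o (fun x => f x - g x)).
Proof.
move=> mf mg; rewrite (_ : EFin \o _ = (fun x => (EFin \o f) x - (EFin \o g) x)%E); first exact: integrableB.
by apply/funext => x /=; rewrite EFinB.
Qed.

End FiniteIntegral.

Lemma prob_Rintegral_cst d (T : measurableType d) (R : realType) (P : probability T R) (c : R) :
  \int[P]_x c = c.
Proof.
have PT : fine (P setT) = 1 by rewrite probability_setT.
by rewrite RintegralT_cst [fine _]PT mulr1.
Qed.

Lemma prob_Rintegral_bound d (T : measurableType d) (R : realType) (P : probability T R)
    (f : T -> R) (e : R) : bm f -> (forall x, `|f x| <= e) -> `|\int[P]_x f x| <= e.
Proof.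
have PT : fine (P setT) = 1 by rewrite probability_setT.
by move=> bf fe; rewrite (le_trans (Rintegral_bound P bf fe))// [fine _]PT mul1r.
Qed.

(** * Fubini for bounded functions *)

Section FiniteFubini.
Context d1 d2 (T1 : measurableType d1) (T2 : measurableType d2) (R : realType).
Variables (m1 : {finite_measure set T1 -> \bar R}) (m2 : {finite_measure set T2 -> \bar R}).
Variable f : T1 * T2 -> R.
Hypothesis bf : bm f.

Lemma bm_pair1 x : bm (fun y => f (x, y)).
Proof. exact: (bm_comp (pair1_measurable x)). Qed.

Lemma bm_pair2 y : bm (fun x => f (x, y)).
Proof. exact: (bm_comp (pair2_measurable y)). Qed.

Lemma bm_prod_integrable : (m1 \x m2)%E.-integrable setT (EFin \o f).
Proof.
have [mf [M fM]] := bf.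
apply/integrable12ltyP; first exact/measurable_EFinP.
apply: (@le_lt_trans _ _ (\int[m1]_x \int[m2]_y (`|M|)%:E)%E).
  apply: ge0_le_integral => //.
  - by move=> x _; exact: integral_ge0.
  - apply: (@measurable_fun_fubini_tonelli_F _ _ _ _ _ m2 (abse \o (EFin \o f))) => //=.
    by apply: measurableT_comp => //; exact/measurable_EFinP.
  - move=> x _; apply: ge0_le_integral => //.
    + apply: measurableT_comp => //; apply/measurable_EFinP.
      exact: (bm_pair1 x).1.
    + by move=> y _ /=; rewrite lee_fin (le_trans (fM _)) ?ler_norm.
under eq_integral do rewrite (bm_RintegralE _ (bm_cst _ _)).
by rewrite (bm_RintegralE _ (bm_cst _ _)) ltry.
Qed.

Lemma bm_Fubini :
  \int[m1]_x (\int[m2]_y f (x, y)) = \int[m2]_y (\int[m1]_x f (x, y)).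
Proof.
have /= := Fubini bm_prod_integrable.
under eq_integral do rewrite (bm_RintegralE _ (bm_pair1 _)).
under [RHS]eq_integral do rewrite (bm_RintegralE _ (bm_pair2 _)).
by move=> h; congr fine.
Qed.

Lemma bm_Rintegral2 : bm (fun x => \int[m2]_y f (x, y)).
Proof.
have [mf [M fM]] := bf; split.
  apply/measurable_EFinP; rewrite (_ : EFin \o _ = fubini_F m2 (EFin \o f)).
    exact: (measurable_fubini_F bm_prod_integrable).
  by apply/funext => x /=; rewrite -bm_RintegralE//; exact: bm_pair1.
exists (fine (m2 setT) * M) => x; apply: Rintegral_bound => //; exact: bm_pair1.
Qed.

Lemma bm_Rintegral1 : bm (fun y => \int[m1]_x f (x, y)).
Proof.
have [mf [M fM]] := bf; split.
  apply/measurable_EFinP; rewrite (_ : EFin \o _ = fubini_G m1 (EFin \o f)).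
    exact: (measurable_fubini_G bm_prod_integrable).
  by apply/funext => x /=; rewrite -bm_RintegralE//; exact: bm_pair2.
exists (fine (m1 setT) * M) => x; apply: Rintegral_bound => //; exact: bm_pair2.
Qed.

End FiniteFubini.

(** Continuity is asked in the sup norm only. By [bm_ext] the values on indicators already determine
    such a functional, so identities between integrals are checked on measurable sets. *)
Definition bm_functional d (T : measurableType d) (R : realType) (L : (T -> R) -> R) :=
  [/\ forall f g, bm f -> bm g -> L (fun x => f x + g x) = L f + L g,
      forall c f, bm f -> L (fun x => c * f x) = c * L f &
      exists2 C : R, 0 <= C &
        forall f (e : R), bm f -> (forall x, `|f x| <= e) -> `|L f| <= C * e].

Section Functionals.
Context d (T : measurableType d) d' (T' : measurableType d') (R : realType).

Lemma bm_functional_ext (L1 L2 : (T -> R) -> R) :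
  bm_functional L1 -> bm_functional L2 ->
  (forall A, measurable A -> L1 \1_A = L2 \1_A) -> forall f, bm f -> L1 f = L2 f.
Proof.
move=> [D1 Z1 [C1 C10 B1]] [D2 Z2 [C2 C20 B2]] E f bf; apply/eqP.
rewrite -subr_eq0; apply/eqP.
apply: (@bm_ext _ _ _ (fun f => L1 f - L2 f) (C1 + C2)) => //.
- exact: addr_ge0.
- by move=> g h bg bh; rewrite D1// D2//; ring.
- by move=> c g bg; rewrite Z1// Z2//; ring.
- move=> g e bg ge; rewrite (le_trans (ler_normB _ _))// mulrDl.
  by rewrite lerD// ?B1// B2.
- by move=> A mA; rewrite E// subrr.
Qed.

Lemma bm_functional_int (m : {finite_measure set T' -> \bar R}) (u : T' -> T) (g : T' -> R) :
  measurable_fun setT u -> bm g -> bm_functional (fun f => \int[m]_x (f (u x) * g x)).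
Proof.
move=> mu bg; have bu (f : T -> R) : bm f -> bm (fun x => f (u x)) by exact: bm_comp.
split.
- move=> f h bf bh; under eq_Rintegral do rewrite mulrDl.
  by rewrite bm_RintegralD//; apply: bmM => //; exact: bu.
- move=> c f bf; under eq_Rintegral do rewrite -mulrA.
  by rewrite bm_RintegralZl//; apply: bmM => //; exact: bu.
- have [_ [M gM]] := bg; exists (fine (m setT) * `|M|).
    by rewrite mulr_ge0 ?normr_ge0 ?fine_mT_ge0.
  move=> f e bf fe; rewrite -mulrA; apply: Rintegral_bound.
    by apply: bmM => //; exact: bu.
  by move=> x; rewrite normrM mulrC ler_pM// (le_trans (gM _))// ler_norm.
Qed.

End Functionals.

(** * Conditional expectation given a variable of known law *)

Section ConditionalExpectation.
Context dO (O : measurableType dO) dE (E : measurableType dE) (R : realType).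
Variables (P : {finite_measure set O -> \bar R}) (mu : {finite_measure set E -> \bar R}).
Variables (U : O -> E).
Hypothesis mU : measurable_fun setT U.
Hypothesis lawU : forall A, measurable A -> P (U @^-1` A) = mu A.

Lemma bm_law (f : E -> R) : bm f -> \int[P]_w f (U w) = \int[mu]_x f x.
Proof.
move=> bf.
have /= := @bm_functional_ext _ E R (fun f => \int[P]_w (f (U w) * 1))
  (fun f => \int[mu]_x (f x * 1)) _ _ _ f bf.
under eq_Rintegral do rewrite mulr1.
under [in RHS]eq_Rintegral do rewrite mulr1.
apply; [by apply: bm_functional_int => //; exact: bm_cst |
        by apply: (@bm_functional_int _ E _ E _ mu id) => //; exact: bm_cst |].
move=> A mA; under eq_Rintegral do rewrite mulr1.
under [in RHS]eq_Rintegral do rewrite mulr1.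
have mUA : measurable (U @^-1` A) by rewrite -[X in measurable X]setTI; exact: mU.
rewrite Rintegral_indicT// -lawU// -(Rintegral_indicT P mUA).
by congr fine; apply: eq_integral => x _; rewrite preimage_indic.
Qed.

(** The Radon-Nikodym derivative [g1] of the image under [U] of the charge [Y P]. It lies in
    [[0, M]] only almost everywhere; clipping makes it bounded everywhere. *)
Lemma cond_exp_ge0 (Y : O -> R) (M : R) : 0 <= M -> bm Y -> (forall w, 0 <= Y w <= M) ->
  exists2 g : E -> R, bm g &
    forall A, measurable A -> \int[P]_w (\1_A (U w) * Y w) = \int[mu]_x (\1_A x * g x).
Proof.
move=> M0 bY YM.
pose nu0 : {charge set O -> \bar R} := induced_charge (bm_integrable P bY).
have [nu nuE] : exists nu : {charge set E -> \bar R}, forall A, nu A = nu0 (U @^-1` A).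
  by unshelve eexists [the charge _ _ of pushforward nu0 U].
have mUA A : measurable A -> measurable (U @^-1` A).
  by move=> mA; rewrite -[X in measurable X]setTI; exact: mU.
have nu0E A : measurable A -> nu A = (\int[P]_w (\1_A (U w) * Y w))%:E.
  move=> mA; rewrite nuE /nu0/= /induced_charge integral_mkcond -bm_RintegralE.
    apply: eq_integral => w _; rewrite /patch/= indicE.
    have -> : (w \in U @^-1` A) = (U w \in A) by apply/idP/idP; rewrite !inE.
    by case: ifP => _; rewrite ?mul1r ?mul0r.
  by apply: bmM => //; apply: (bm_comp mU); exact: bm_indic.
have numu : nu `<< mu.
  apply/null_content_dominatesP => A mA muA; rewrite nu0E//; congr EFin.
  have b1 : bm (\1_A : E -> R) by exact: bm_indic.
  apply/eqP; rewrite eq_le; apply/andP; split.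
    apply: (@le_trans _ _ (\int[P]_w (M * \1_A (U w)))).
      apply: bm_le_Rintegral.
      + by apply: bmM => //; exact: (bm_comp mU).
      + by apply: bmM; [exact: bm_cst|exact: (bm_comp mU)].
      + by move=> w; rewrite mulrC ler_wpM2r//; case/andP: (YM w).
    rewrite bm_RintegralZl; last exact: (bm_comp mU).
    by rewrite bm_law// Rintegral_indicT// muA mulr0.
  by apply: Rintegral_ge0 => w _; rewrite mulr_ge0//; case/andP: (YM w).
pose g0 := Radon_Nikodym nu mu; pose g1 x := fine (g0 x).
have ig0 : mu.-integrable setT g0 by exact: Radon_Nikodym_integrable.
have g0E : g0 = EFin \o g1.
  by apply/funext => x /=; rewrite fineK//; exact: Radon_Nikodym_fin_num.
have mg1 : measurable_fun setT g1.
  by apply/measurable_EFinP; rewrite -g0E; exact: measurable_int ig0.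
have ig1 : mu.-integrable setT (EFin \o g1) by rewrite -g0E.
have g1A A : measurable A -> \int[P]_w (\1_A (U w) * Y w) = \int[mu]_(x in A) g1 x.
  move=> mA; rewrite /Rintegral (eq_integral g0); last by move=> x _; rewrite g0E.
  by rewrite -Radon_Nikodym_integral// nu0E.
pose g x := Num.max 0 (Num.min (g1 x) M).
have bg : bm g.
  split.
    apply: (@measurable_maxr _ _ _ _ (cst 0) (fun x => Num.min (g1 x) M)) => //.
    exact: (@measurable_minr _ _ _ _ g1 (cst M)).
  exists `|M| => x; rewrite /g ger0_norm ?le_max ?lexx// ge_max normr_ge0/=.
  by rewrite ge_min ler_norm orbT.
exists g => // A mA.
have i1 B : measurable B -> mu.-integrable setT (EFin \o (fun x => \1_B x * g1 x)).
  move=> mB; apply: (le_integrable measurableT _ _ ig1).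
    by apply/measurable_EFinP; apply: measurable_funM => //; exact: measurable_indic.
  move=> x _ /=; rewrite lee_fin normrM -[leRHS]mul1r ler_wpM2r//.
  by rewrite indicE; case: (_ \in _); rewrite ?normr1// normr0.
have g1E B : measurable B -> \int[P]_w (\1_B (U w) * Y w) = \int[mu]_x (\1_B x * g1 x).
  move=> mB; rewrite g1A// Rintegral_mkcond; apply: eq_Rintegral => x _.
  by rewrite /patch indicE; case: ifP => _; rewrite ?mul1r ?mul0r.
have mitv (i : interval R) : measurable (g1 @^-1` [set` i]).
  by rewrite -[X in measurable X]setTI; apply: mg1 => //; exact: measurable_itv.
pose Bp := g1 @^-1` `]M, +oo[; pose Bn := g1 @^-1` `]-oo, 0[.
have mBp : measurable Bp by exact: mitv.
have mBn : measurable Bn by exact: mitv.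
have BpE x : \1_Bp x = (M < g1 x)%R%:R :> R.
  by rewrite indicE; congr (_%:R); congr nat_of_bool; apply/idP/idP; rewrite !inE /Bp/= in_itv/= andbT.
have BnE x : \1_Bn x = (g1 x < 0)%R%:R :> R.
  by rewrite indicE; congr (_%:R); congr nat_of_bool; apply/idP/idP; rewrite !inE /Bn/= in_itv/=.
have bi B : measurable B -> bm (\1_B : E -> R) by exact: bm_indic.
have bUi B : measurable B -> bm (fun w => \1_B (U w) : R).
  by move=> mB; apply: (bm_comp mU); exact: bi.
have bAg : bm (fun x => \1_A x * g x) by apply: bmM => //; exact: bi.
rewrite g1E//; apply/eqP; rewrite -subr_eq0 -RintegralB//; [|exact: i1|exact: bm_integrable].
have iM : mu.-integrable setT (EFin \o (fun x => M * \1_Bp x)).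
  by apply: bm_integrable; apply: bmM; [exact: bm_cst|exact: bi].
have iD : mu.-integrable setT (EFin \o (fun x => \1_Bp x * g1 x - M * \1_Bp x)).
  by apply: integrableB_EFin => //; exact: i1.
have iD2 : mu.-integrable setT (EFin \o (fun x => \1_Bp x * g1 x - M * \1_Bp x - \1_Bn x * g1 x)).
  by apply: integrableB_EFin => //; exact: i1.
have iAg : mu.-integrable setT (EFin \o (fun x => \1_A x * g1 x - \1_A x * g x)).
  by apply: integrableB_EFin; [exact: i1 | exact: bm_integrable].
(* Clipping alters [g1] only on [Bp] and [Bn], by [g1 - M] and [- g1]. Both integrals are expressed
   through [Y] by [g1E], and their sum is at most 0 because [0 <= Y <= M]. *)
rewrite -normr_le0 (le_trans (le_normr_Rintegral _ iAg))//.
apply: (@le_trans _ _ (\int[mu]_x (\1_Bp x * g1 x - M * \1_Bp x - \1_Bn x * g1 x))).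
  apply: le_Rintegral => //.
    by rewrite (_ : EFin \o _ = abse \o (EFin \o (fun x => \1_A x * g1 x - \1_A x * g x)))//; exact: integrable_abse.
  move=> x _; rewrite -mulrBr normrM BpE BnE.
  have a1 : `|\1_A x : R| <= 1.
    by rewrite indicE; case: (_ \in _); rewrite ?normr1// normr0.
  apply: (@le_trans _ _ `|g1 x - g x|); first by rewrite -[leRHS]mul1r ler_wpM2r.
  rewrite /g; case: (ltP (g1 x) M) => [h1|h1]; case: (ltP (g1 x) 0) => h2.
  - by rewrite ltNge (ltW h1)/= subr0 ltr0_norm//; lra.
  - by rewrite subrr normr0 ltNge (ltW h1)/=; lra.
  - by have := le_lt_trans h1 h2; rewrite ltNge M0.
  - rewrite (max_idPr M0); case: (ltP M (g1 x)) => h3.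
      by rewrite ger0_norm/=; lra.
    by rewrite (_ : g1 x - M = 0) ?normr0/=; lra.
rewrite RintegralB//; [|exact: i1].
rewrite RintegralB//; [|exact: i1].
rewrite bm_RintegralZl; last exact: bi.
rewrite -!g1E// -(@bm_law (\1_Bp)); last exact: bi.
rewrite -bm_RintegralZl; last exact: bUi.
have h1 : 0 <= \int[P]_w (\1_Bn (U w) * Y w).
  by apply: Rintegral_ge0 => w _; rewrite mulr_ge0//; case/andP: (YM w).
suff h2 : \int[P]_w (\1_Bp (U w) * Y w) <= \int[P]_w (M * \1_Bp (U w)) by lra.
apply: bm_le_Rintegral.
- by apply: bmM => //; exact: bUi.
- by apply: bmM; [exact: bm_cst | exact: bUi].
- by move=> w; rewrite mulrC ler_wpM2r//; case/andP: (YM w).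
Qed.

Lemma cond_exp (Y : O -> R) : bm Y ->
  exists2 g : E -> R, bm g &
    forall f, bm f -> \int[P]_w (f (U w) * Y w) = \int[mu]_x (f x * g x).
Proof.
move=> bY; have [mY [M YM]] := bY.
pose Y' w := Y w + `|M|.
have bY' : bm Y' by apply: bmD => //; exact: bm_cst.
have [||g bg gE] := @cond_exp_ge0 Y' (`|M| + `|M|) _ bY'.
- exact: addr_ge0.
- by move=> w; have := le_trans (YM w) (ler_norm M); rewrite ler_norml /Y' => /andP[? ?]; apply/andP; split; lra.
have bg' : bm (fun x => g x - `|M|) by apply: bmB => //; exact: bm_cst.
exists (fun x => g x - `|M|) => //.
apply: bm_functional_ext; first exact: bm_functional_int.
  by apply: (@bm_functional_int _ E _ E _ mu id).
move=> A mA; have b1 : bm (\1_A : E -> R) by exact: bm_indic.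
have bU1 : bm (fun w => \1_A (U w) : R) by exact: (bm_comp mU).
have -> : \int[P]_w (\1_A (U w) * Y w) = \int[P]_w (\1_A (U w) * Y' w) - `|M| * \int[P]_w \1_A (U w).
  rewrite -bm_RintegralZl// -bm_RintegralB//; try exact: bmM; last first.
    by apply: bmM => //; exact: bm_cst.
  by apply: eq_Rintegral => w _; rewrite /Y'; ring.
rewrite gE// bm_law// -bm_RintegralZl// -bm_RintegralB//; try exact: bmM; last first.
  by apply: bmM => //; exact: bm_cst.
by apply: eq_Rintegral => w _; ring.
Qed.

End ConditionalExpectation.

(** * Markov kernels, Markov property and stationarity *)

Section KernelMeasure.
Context d d' (T : measurableType d) (T' : measurableType d') (R : realType).
Variables (k : R.-pker T ~> T') (x : T).

(** An alias of [k x] that carries a probability structure, so that the lemmas on finite measures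
    apply to it. *)
Definition kernel_at : set T' -> \bar R := k x.

HB.instance Definition _ := Measure.on kernel_at.
HB.instance Definition _ :=
  Measure_isProbability.Build _ _ _ kernel_at (prob_kernel x).

End KernelMeasure.

Section Markov.
Context (R : realType) (d : nat) (mu : probability (Rd R d) R)
  (k : R -> R.-pker (Rd R d) ~> (Rd R d))
  (dO : measure_display) (O : measurableType dO) (P : probability O R)
  (X : R -> O -> Rd R d).
Hypothesis markovX : is_markov_process P X k.
Hypothesis lawX0 : forall A : set (Rd R d), measurable A -> P (X 0 @^-1` A) = mu A.
Hypothesis invk : mu_invariant mu k.
Local Notation E := (Rd R d).
Local Notation "P_[ t ]" := (transition_op k t) (at level 1, format "P_[ t ]").

(** The process is measurable for nonnegative times only. Clamping the time makes it total on the
    product, which Fubini needs; [path] clamps in the same way. *)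
Lemma measurable_process : measurable_fun setT (fun z : R * O => X (Num.max 0 z.1) z.2).
Proof.
have [mX _] := markovX.
pose u (z : R * O) := (Num.max 0 z.1, z.2).
rewrite (_ : (fun _ => _) = (fun z => X z.1 z.2) \o u)//.
apply: (measurable_comp _ _ mX).
- rewrite (_ : [set z : R * O | _] = fst @^-1` `[0, +oo[); last first.
    by apply/seteqP; split => z /=; rewrite in_itv/= andbT.
  by rewrite -[X in measurable X]setTI; apply: measurable_fst => //; exact: measurable_itv.
- by move=> _ [z _ <-] /=; rewrite le_max lexx.
- apply: measurable_fun_pair => //=.
  by apply: (@measurable_maxr _ _ _ _ (cst 0) fst).
Qed.

Lemma measurable_X t : 0 <= t -> measurable_fun setT (X t).
Proof.
move=> t0; rewrite (_ : X t = (fun z : R * O => X (Num.max 0 z.1) z.2) \o pair t).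
  by apply: measurableT_comp => //; exact: measurable_process.
by apply/funext => w /=; rewrite (max_idPr _).
Qed.

Lemma bm_kernel t (B : set E) : measurable B -> bm (fun x => fine (k t x B)).
Proof.
move=> mB; split.
  by apply: measurableT_comp => //; exact: measurable_kernel.
exists 1 => x; rewrite ger0_norm ?fine_ge0//.
have k1 : (k t x B <= 1)%E.
  by rewrite -(@prob_kernel _ _ _ _ _ (k t) x) le_measure ?inE.
by rewrite -lee_fin fineK// ge0_fin_numE// (le_lt_trans k1)// ltry.
Qed.

Lemma kernelE t x (B : set E) : measurable B -> k t x B = (fine (k t x B))%:E.
Proof. by move=> mB; rewrite fineK// (@fin_num_measure _ _ _ (kernel_at (k t) x)). Qed.

Lemma transition_opE t (f : E -> R) x : P_[t] f x = \int[kernel_at (k t) x]_y f y.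
Proof. by []. Qed.

Lemma transition_op_indic t (B : set E) x : measurable B ->
  P_[t] \1_B x = fine (k t x B).
Proof. by move=> mB; rewrite transition_opE Rintegral_indicT. Qed.

Lemma bm_transition_op t f : bm f -> bm (P_[t] f).
Proof.
move=> bf; have [mf [M fM]] := bf.
(* The shift by [M] makes the integrand nonnegative, as [measurable_fun_integral_kernel] asks. *)
have bfM : bm (fun x => f x + M) by apply: bmD => //; exact: bm_cst.
have PE x : P_[t] f x = fine (\int[k t x]_y (f y + M)%:E)%E - M.
  rewrite [X in X - _](_ : _ = \int[kernel_at (k t) x]_y (f y + M))//.
  rewrite bm_RintegralD//; last exact: bm_cst.
  by rewrite prob_Rintegral_cst addrK.
split.
  rewrite (_ : P_[t] f = fun x => fine (\int[k t x]_y (f y + M)%:E)%E - M); last exact/funext.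
  apply: measurable_funB => //; apply: measurableT_comp => //.
  apply: (@measurable_fun_integral_kernel _ _ _ _ _ (k t)) => //.
  - by move=> U mU; exact: measurable_kernel.
  - by move=> z; rewrite lee_fin; have := fM z; rewrite ler_norml => /andP[? ?]; lra.
  - by apply/measurable_EFinP; case: bfM.
exists M => x; rewrite transition_opE.
exact: (prob_Rintegral_bound _ bf fM).
Qed.

(** The cylinder with the single past time [r]: correlations of two factors involve no more of the
    past. *)
Lemma markov_indic r s t (A B : set E) : 0 <= r <= s -> 0 <= t ->
  measurable A -> measurable B ->
  \int[P]_w (\1_A (X r w) * \1_B (X (s + t) w)) =
  \int[P]_w (\1_A (X r w) * P_[t] \1_B (X s w)).
Proof.
move=> /andP[r0 rs] t0 mA mB.
have s0 : 0 <= s by exact: le_trans rs.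
have [_ /(_ 1%N (fun=> r) (fun=> A) s t B s0 t0)] := markovX.
have -> : [set w | (forall i : 'I_1, A (X r w)) /\ B (X (s + t) w)] =
   (X r @^-1` A) `&` (X (s + t) @^-1` B).
  by apply/seteqP; split => w /= [h ?]; split => //; exact: h ord0.
have -> : [set w | (forall i : 'I_1, A (X r w))] = X r @^-1` A.
  by apply/seteqP; split => w /= h => //; exact: h ord0.
have mrA : measurable (X r @^-1` A).
  by rewrite -[X in measurable X]setTI; exact: measurable_X.
have mstB : measurable (X (s + t) @^-1` B).
  by rewrite -[X in measurable X]setTI; apply: measurable_X => //; exact: addr_ge0.
move=> /(_ (fun=> introT andP (conj r0 rs)) (fun=> mA) mB) h.
transitivity (fine (P (X r @^-1` A `&` X (s + t) @^-1` B))).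
  rewrite -Rintegral_indicT; last exact: measurableI.
  by apply: eq_Rintegral => w _; rewrite indicI.
rewrite h integral_mkcond; congr fine; apply: eq_integral => w _.
rewrite /patch/= transition_op_indic// kernelE//.
have -> : (w \in X r @^-1` A) = (X r w \in A) by apply/idP/idP; rewrite !inE.
by rewrite indicE; case: ifP => _; rewrite ?mul1r ?mul0r.
Qed.

Lemma bm_functional_op t (g : O -> R) u : measurable_fun setT u -> bm g ->
  bm_functional (fun f => \int[P]_w (g w * P_[t] f (u w))).
Proof.
move=> mu' bg; have bPu f : bm f -> bm (fun w => P_[t] f (u w)).
  by move=> bf; apply: (bm_comp mu'); exact: bm_transition_op.
split.
- move=> f h bf bh; rewrite -bm_RintegralD//; try by apply: bmM => //; exact: bPu.
  by apply: eq_Rintegral => w _; rewrite -mulrDr !transition_opE bm_RintegralD.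
- move=> c f bf; rewrite -bm_RintegralZl//; last by apply: bmM => //; exact: bPu.
  by apply: eq_Rintegral => w _; rewrite mulrCA !transition_opE bm_RintegralZl.
- have [_ [M gM]] := bg; exists `|M| => // f e bf fe.
  apply: (@prob_Rintegral_bound _ _ _ P (fun w => g w * P_[t] f (u w))).
    by apply: bmM => //; exact: bPu.
  move=> w; rewrite normrM ler_pM// ?(le_trans (gM _)) ?ler_norm//.
  by rewrite transition_opE; exact: (prob_Rintegral_bound _ bf fe).
Qed.

Lemma markov_bm r s t (f g : E -> R) : 0 <= r <= s -> 0 <= t -> bm f -> bm g ->
  \int[P]_w (g (X r w) * f (X (s + t) w)) = \int[P]_w (g (X r w) * P_[t] f (X s w)).
Proof.
move=> rs t0 bf bg; have /andP[r0 rs'] := rs.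
have s0 : 0 <= s by exact: le_trans rs'.
have mr := measurable_X r0; have ms := measurable_X s0.
have mst := measurable_X (addr_ge0 s0 t0).
move: f bf; apply: bm_functional_ext.
- have := @bm_functional_int _ E _ O R P (X (s + t)) (fun w => g (X r w)) mst (bm_comp mr bg).
  congr bm_functional; apply/funext => f.
  by apply: eq_Rintegral => w _; rewrite mulrC.
- by apply: bm_functional_op => //; exact: (bm_comp mr).
- move=> B mB; move: g bg; apply: bm_functional_ext.
  + apply: bm_functional_int => //; apply: (bm_comp mst); exact: bm_indic.
  + apply: bm_functional_int => //; apply: (bm_comp ms).
    by apply: bm_transition_op; exact: bm_indic.
  + by move=> A mA; exact: markov_indic.
Qed.

Lemma lawX t : 0 <= t -> forall A, measurable A -> P (X t @^-1` A) = mu A.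
Proof.
move=> t0 A mA.
(* The empty cylinder at [s = 0] says that [P (X t in A)] is the mean of [k t (X 0) A]; invariance
   concludes. *)
have [_ /(_ 0%N (fun=> 0) (fun=> setT) 0 t A (lexx _) t0)] := markovX.
have -> : [set w | (forall i : 'I_0, [set: E] (X 0 w)) /\ A (X (0 + t) w)] = X t @^-1` A.
  by apply/seteqP; split => w /=; rewrite add0r; [case|move=> ?; split].
have -> : [set w | (forall i : 'I_0, [set: E] (X 0 w))] = setT.
  by apply/seteqP; split.
move=> ->; [|by case|by []|by []].
under eq_integral do rewrite kernelE//.
have bk := bm_kernel t mA.
rewrite bm_RintegralE; last exact: (bm_comp (measurable_X (lexx 0)) bk).
rewrite (bm_law (measurable_X (lexx _)) lawX0 bk) -bm_RintegralE//.
by rewrite -(invk t0 mA); apply: eq_integral => x _; rewrite -kernelE.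
Qed.

Lemma stationary_bm t (f : E -> R) : 0 <= t -> bm f ->
  \int[P]_w f (X t w) = \int[mu]_x f x.
Proof. by move=> t0 bf; apply: bm_law => //; [exact: measurable_X|exact: lawX]. Qed.

End Markov.

(** * Lebesgue measure on a time window *)

Section TimeMeasure.
Variable R : realType.
Local Notation leb := (@lebesgue_measure R).

Lemma lebesgue_itv_lty (S : R) : (leb `[0%R, S]%classic < +oo)%E.
Proof. by rewrite lebesgue_measure_itv/=; case: ifP => _; rewrite ?ltry// -EFinD ltry. Qed.

(** A finite measure on all of [R], so that time integrals fall under the same lemmas as
    expectations. *)
Definition time_measure (S : R) : set R -> \bar R :=
  mrestr leb (measurable_itv `[0, S]).

Lemma time_measure0 S : time_measure S set0 = 0%E.
Proof. by rewrite /time_measure /mrestr set0I measure0. Qed.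

Lemma time_measure_ge0 S A : (0 <= time_measure S A)%E.
Proof. exact: measure_ge0. Qed.

Lemma time_measure_sigma_additive S : semi_sigma_additive (time_measure S).
Proof.
exact: (@measure_semi_sigma_additive _ _ _
  [the {measure set (measurableTypeR R) -> \bar R} of mrestr leb (measurable_itv `[0, S])]).
Qed.

HB.instance Definition _ (S : R) := isMeasure.Build _ _ _ (time_measure S)
  (time_measure0 S) (time_measure_ge0 S) (@time_measure_sigma_additive S).

Lemma time_measure_fin (S : R) : fin_num_fun (time_measure S).
Proof.
move=> A mA; rewrite ge0_fin_numE// (le_lt_trans _ (lebesgue_itv_lty S))//.
by apply: le_measure; rewrite ?inE//; apply: measurableI => //; exact: measurable_itv.
Qed.

HB.instance Definition _ (S : R) :=
  @Measure_isFinite.Build _ _ _ (time_measure S) (time_measure_fin S).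

Lemma time_measureE S (A : set R) : time_measure S A = leb (A `&` `[0, S]%classic).
Proof. by []. Qed.

Lemma time_measureT S : 0 <= S -> fine (time_measure S setT) = S.
Proof.
move=> S0; rewrite time_measureE setTI lebesgue_measure_itv/= lte_fin.
case: ltP => [_|S0'] /=; first by rewrite oppr0 addr0.
by apply/eqP; rewrite eq_le S0 S0'.
Qed.

Lemma lebesgue_measure_shift (t : R) (A : set R) : measurable A ->
  leb ((fun s => s + t) @^-1` A) = leb A.
Proof.
move=> mA.
have mt : measurable_fun setT (fun s : measurableTypeR R => s + t : measurableTypeR R).
  by apply: measurable_funD.
have [nu nuE] : exists nu : {measure set (measurableTypeR R) -> \bar R},
    forall A, nu A = leb ((fun s => s + t) @^-1` A).
  by unshelve eexists [the {measure set (measurableTypeR R) -> \bar R} of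
    pushforward leb (fun s : measurableTypeR R => s + t : measurableTypeR R)].
rewrite -nuE; apply/esym/lebesgue_measure_unique => //= _ [[a b]] _ <-.
rewrite nuE (_ : _ @^-1` _ = `]a - t, b - t]%classic); last first.
  by apply/seteqP; split => x /=; rewrite !in_itv/= ltrBlDr lerBrDr.
by rewrite !lebesgue_measure_itv/= !lte_fin ltrD2r -!EFinB; congr (if _ then _%:E else _); ring.
Qed.

(** The window is not translation invariant: the indicators keep both [s] and [s + t] inside
    [[0, S]], where Lebesgue measure is. *)
Lemma time_shift (S t : R) (f : R -> R) : 0 <= t -> bm f ->
  \int[time_measure S]_s (f (s + t) * \1_`[0, S - t] s) =
  \int[time_measure S]_s (f s * \1_`[t, S] s).
Proof.
move=> t0; move: f; apply: bm_functional_ext.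
- apply: bm_functional_int; first exact: measurable_funD.
  by apply: bm_indic; exact: measurable_itv.
- apply: (@bm_functional_int _ R _ R _ _ id) => //.
  by apply: bm_indic; exact: measurable_itv.
- move=> A mA.
  have mAt : measurable ((fun s => s + t) @^-1` A).
    by rewrite -[X in measurable X]setTI; apply: measurable_funD.
  have mi (a b : R) : measurable `[a, b]%classic by exact: measurable_itv.
  transitivity (\int[time_measure S]_s \1_(((fun s => s + t) @^-1` A) `&` `[0, S - t]%classic) s).
    by apply: eq_Rintegral => s _; rewrite indicI.
  transitivity (\int[time_measure S]_s \1_(A `&` `[t, S]%classic) s); last first.
    by apply: eq_Rintegral => s _; rewrite indicI.
  rewrite !Rintegral_indicT; try exact: measurableI.
  have timeE (B : set R) : (time_measure S : {finite_measure set R -> \bar R}) B = leb (B `&` `[0, S]%classic) by [].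
  congr fine; rewrite !timeE.
  rewrite -[RHS](lebesgue_measure_shift t); last by apply: measurableI => //; exact: measurableI.
  congr (leb _); apply/seteqP; split => s /=; rewrite !in_itv/=.
    by move=> [[? /andP[? ?]] /andP[? ?]]; split; [split=> //|]; apply/andP; split; lra.
  by move=> [[? /andP[? ?]] /andP[? ?]]; split; [split=> //|]; apply/andP; split; lra.
Qed.

Lemma time_indic_le (S x y : R) : x <= y -> \int[time_measure S]_s \1_`[x, y] s <= y - x.
Proof.
move=> xy; have mi : measurable `[x, y]%classic by exact: measurable_itv.
rewrite Rintegral_indicT//.
have h : (time_measure S `[x, y]%classic <= (y - x)%:E)%E.
  rewrite time_measureE (@le_trans _ _ (leb `[x, y]%classic))//.
    by apply: le_measure; rewrite ?inE//; apply: measurableI => //; exact: measurable_itv.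
  rewrite lebesgue_measure_itv/= lte_fin; case: ifP => _; first by rewrite EFinB.
  by rewrite lee_fin subr_ge0.
by rewrite -lee_fin fineK// ge0_fin_numE// (le_lt_trans h)// ltry.
Qed.

End TimeMeasure.

(** * Weighted time averages of a path *)

Section Generator.
Context (R : realType) (d : nat) (mu : probability (Rd R d) R)
  (k : R -> R.-pker (Rd R d) ~> (Rd R d))
  (dO : measure_display) (O : measurableType dO) (P : probability O R)
  (X : R -> O -> Rd R d).
Hypothesis markovX : is_markov_process P X k.
Hypothesis lawX0 : forall A : set (Rd R d), measurable A -> P (X 0 @^-1` A) = mu A.
Hypothesis invk : mu_invariant mu k.
Local Notation E := (Rd R d).
Local Notation "P_[ t ]" := (transition_op k t) (at level 1, format "P_[ t ]").
Variables (f : E -> R).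
Hypothesis bf : bm f.
Variable S : R.
Local Notation tau := (time_measure S).

Definition path (s : R) (w : O) : R := f (X (Num.max 0 s) w).
Definition weighted (a : R -> R) (w : O) : R := \int[tau]_s (a s * path s w).
Let v := \int[mu]_x (f x ^+ 2).

Let max0 (s : R) : 0 <= Num.max 0 s. Proof. by rewrite le_max lexx. Qed.

Lemma bm_path2 : bm (fun z : R * O => path z.1 z.2).
Proof. exact: (bm_comp (measurable_process markovX) bf). Qed.

Lemma bm_path s : bm (path s).
Proof. exact: (bm_comp (measurable_X markovX (max0 s)) bf). Qed.

Lemma bm_path_time w : bm (path ^~ w).
Proof. exact: (bm_pair2 bm_path2). Qed.

Lemma bm_weight2 a : bm a -> bm (fun z : R * O => a z.1 * path z.1 z.2).
Proof. by move=> ba; apply: bmM; [exact: (bm_comp measurable_fst)|exact: bm_path2]. Qed.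

Lemma bm_weighted a : bm a -> bm (weighted a).
Proof. by move=> ba; exact: (bm_Rintegral1 tau P (bm_weight2 ba)). Qed.

Lemma weighted_test a (g : O -> R) : bm a -> bm g ->
  \int[P]_w (g w * weighted a w) = \int[tau]_s (a s * \int[P]_w (g w * path s w)).
Proof.
move=> ba bg.
have bG : bm (fun z : R * O => g z.2 * (a z.1 * path z.1 z.2)).
  by apply: bmM; [exact: (bm_comp measurable_snd)|exact: bm_weight2].
transitivity (\int[P]_w \int[tau]_s (g w * (a s * path s w))).
  apply: eq_Rintegral => w _; rewrite bm_RintegralZl//.
  by apply: bmM => //; exact: bm_path_time.
rewrite -(bm_Fubini tau P bG); apply: eq_Rintegral => s _.
rewrite -bm_RintegralZl; last by apply: bmM => //; exact: bm_path.
by apply: eq_Rintegral => w _; ring.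
Qed.

Lemma path_sq s : \int[P]_w (path s w ^+ 2) = v.
Proof.
exact: (stationary_bm markovX lawX0 invk (max0 s) (bmX 2 bf)).
Qed.

Lemma path_corr r s : `|\int[P]_w (path r w * path s w)| <= v.
Proof.
have br := bm_path r; have bs := bm_path s.
rewrite (le_trans (bm_le_normr_Rintegral _ (bmM br bs)))//.
apply: (@le_trans _ _ (\int[P]_w (2^-1 * path r w ^+ 2 + 2^-1 * path s w ^+ 2))).
  apply: bm_le_Rintegral.
  - by apply: bm_norm; exact: bmM.
  - by apply: bmD; apply: bmM => //; try exact: bm_cst; exact: bmX.
  - move=> w; rewrite normrM; have := sqr_ge0 (`|path r w| - `|path s w|).
    by rewrite sqrrB !real_normK ?num_real//; lra.
rewrite bm_RintegralD; try by apply: bmM; [exact: bm_cst|exact: bmX].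
rewrite !bm_RintegralZl; try exact: bmX.
by rewrite !path_sq; lra.
Qed.

Lemma weighted_corr a r : bm a ->
  `|\int[P]_w (path r w * weighted a w)| <= (\int[tau]_s `|a s|) * v.
Proof.
move=> ba; rewrite weighted_test//; last exact: bm_path.
have bc : bm (fun s => \int[P]_w (path r w * path s w)).
  have bG : bm (fun z : R * O => path r z.2 * path z.1 z.2).
    by apply: bmM; [exact: (bm_comp measurable_snd (bm_path r))|exact: bm_path2].
  exact: (bm_Rintegral2 tau P bG).
rewrite (le_trans (bm_le_normr_Rintegral _ (bmM ba bc)))//.
rewrite -bm_RintegralZr; last exact: bm_norm.
apply: bm_le_Rintegral; [by apply: bm_norm; exact: bmM | |].
  by apply: bmM; [exact: bm_norm|exact: bm_cst].
by move=> s; rewrite normrM ler_wpM2l// path_corr.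
Qed.

(** Minkowski's inequality for the [L^2] norm of [weighted a], squared: [weighted_test] opens one
    factor and [weighted_corr] bounds what remains. *)
Lemma weighted_sq a : bm a ->
  \int[P]_w (weighted a w ^+ 2) <= (\int[tau]_s `|a s|) ^+ 2 * v.
Proof.
move=> ba; under eq_Rintegral do rewrite expr2.
have bW := bm_weighted ba.
rewrite weighted_test// expr2 -mulrA -bm_RintegralZr; last exact: bm_norm.
have bc : bm (fun s => \int[P]_w (weighted a w * path s w)).
  have bG : bm (fun z : R * O => weighted a z.2 * path z.1 z.2).
    by apply: bmM; [exact: (bm_comp measurable_snd bW)|exact: bm_path2].
  exact: (bm_Rintegral2 tau P bG).
apply: bm_le_Rintegral; first exact: bmM.
  by apply: bmM; [exact: bm_norm|exact: bm_cst].
move=> s; rewrite (le_trans (ler_norm _))// normrM ler_wpM2l//.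
by under eq_Rintegral do rewrite mulrC; exact: weighted_corr.
Qed.

(** That is, [h] is a version of [x |-> E (Y | X 0 = x)], stated by duality so that nothing is
    conditioned on a point. *)
Definition represents (h : E -> R) (Y : O -> R) :=
  forall phi : E -> R, bm phi -> \int[P]_w (phi (X 0 w) * Y w) = \int[mu]_x (phi x * h x).

Let mX0 := measurable_X markovX (lexx 0).

(** Conditional Jensen, by expanding the mean square of [Y - h (X 0)]. *)
Lemma represents_sq h Y : bm h -> bm Y -> represents h Y ->
  \int[mu]_x (h x ^+ 2) <= \int[P]_w (Y w ^+ 2).
Proof.
move=> bh bY hY; have bhX := bm_comp mX0 bh.
have e1 : \int[P]_w (h (X 0 w) * Y w) = \int[mu]_x (h x ^+ 2).
  by rewrite hY//; apply: eq_Rintegral => x _; rewrite expr2.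
have e2 : \int[P]_w (h (X 0 w) ^+ 2) = \int[mu]_x (h x ^+ 2).
  exact: (stationary_bm markovX lawX0 invk (lexx 0) (bmX 2 bh)).
have : 0 <= \int[P]_w ((Y w - h (X 0 w)) ^+ 2).
  by apply: Rintegral_ge0 => w _; exact: sqr_ge0.
rewrite (_ : \int[P]_w _ = \int[P]_w (Y w ^+ 2 + h (X 0 w) ^+ 2 - 2 * (h (X 0 w) * Y w))).
  rewrite bm_RintegralB; last 2 first.
  - by apply: bmD; exact: bmX.
  - by apply: bmM; [exact: bm_cst|exact: bmM].
  rewrite bm_RintegralD; try exact: bmX.
  rewrite bm_RintegralZl; last exact: bmM.
  by rewrite e1 e2; lra.
by apply: eq_Rintegral => w _; ring.
Qed.

(** The two sides are compared at each fixed [s] and integrated over [s] afterwards, so that [P_[s]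
    f] never appears under an integral in [s]. *)
Lemma transition_represents (a : R -> R) (h : E -> R) (t : R) :
  bm a -> (forall s, s < 0 -> a s = 0) -> bm h -> 0 <= t ->
  represents h (weighted a) ->
  represents (P_[t] h) (fun w => \int[tau]_s (a s * path (s + t) w)).
Proof.
move=> ba a0 bh t0 hY phi bphi.
have mXt := measurable_X markovX t0.
have bphX := bm_comp mX0 bphi.
(* [rho] is [phi] moved by the adjoint of [P_[t]]: the conditional expectation of [phi (X 0)] given
   [X t]. It trades a correlation of [phi] over the time [s + t] for one of [rho] over the time
   [s]. *)
have [rho brho rhoE] := cond_exp mXt (lawX markovX lawX0 invk t0) bphX.
have r00 : 0 <= (0 : R) <= 0 by rewrite lexx.
have r0t : 0 <= (0 : R) <= t by rewrite lexx.
have corr s : 0 <= s ->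
    \int[P]_w (rho (X 0 w) * f (X s w)) = \int[P]_w (phi (X 0 w) * f (X (s + t) w)).
  move=> s0; have bPf : bm (P_[s] f) by exact: bm_transition_op.
  have h1 := markov_bm markovX r00 s0 bf brho; rewrite add0r in h1.
  have h2 := markov_bm markovX r0t s0 bf bphi.
  rewrite [s + t]addrC h1 h2.
  rewrite (bm_law mX0 lawX0 (f := fun x => rho x * P_[s] f x)); last exact: bmM.
  under [RHS]eq_Rintegral do rewrite mulrC.
  by rewrite rhoE//; apply: eq_Rintegral => x _; rewrite mulrC.
have bat : bm (fun z : R * O => a z.1 * path (z.1 + t) z.2).
  apply: bmM; first exact: (bm_comp measurable_fst).
  apply: (bm_comp _ bm_path2 (u := fun z : R * O => (z.1 + t, z.2))).
  by apply: measurable_fun_pair => //; exact: measurable_funD.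
transitivity (\int[tau]_s (a s * \int[P]_w (phi (X 0 w) * path (s + t) w))).
  have bG : bm (fun z : R * O => phi (X 0 z.2) * (a z.1 * path (z.1 + t) z.2)).
    by apply: bmM => //; exact: (bm_comp measurable_snd bphX).
  transitivity (\int[P]_w \int[tau]_s (phi (X 0 w) * (a s * path (s + t) w))).
    by apply: eq_Rintegral => w _; rewrite bm_RintegralZl//; exact: (bm_pair2 bat w).
  rewrite -(bm_Fubini tau P bG); apply: eq_Rintegral => s _.
  rewrite -bm_RintegralZl; last by apply: bmM => //; exact: bm_path.
  by apply: eq_Rintegral => w _; ring.
transitivity (\int[tau]_s (a s * \int[P]_w (rho (X 0 w) * path s w))).
  apply: eq_Rintegral => s _; have [s0|s0] := leP 0 s; last by rewrite a0// !mul0r.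
  rewrite /path (max_idPr s0) (max_idPr _) ?addr_ge0//; congr (_ * _).
  by rewrite -corr.
rewrite -weighted_test//; last exact: (bm_comp mX0).
rewrite hY//.
transitivity (\int[P]_w (h (X t w) * phi (X 0 w))).
  by rewrite rhoE//; apply: eq_Rintegral => x _; rewrite mulrC.
have h1 := markov_bm markovX r00 t0 bh bphi; rewrite add0r in h1.
under eq_Rintegral do rewrite mulrC.
rewrite h1 (bm_law mX0 lawX0 (f := fun x => phi x * P_[t] h x))//.
by apply: bmM => //; exact: bm_transition_op.
Qed.

End Generator.

(** * The generator on functions represented by a weighted average *)

Section GeneratorOfWeighted.
Context (R : realType) (d : nat) (mu : probability (Rd R d) R)
  (k : R -> R.-pker (Rd R d) ~> (Rd R d))
  (dO : measure_display) (O : measurableType dO) (P : probability O R)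
  (X : R -> O -> Rd R d).
Hypothesis markovX : is_markov_process P X k.
Hypothesis lawX0 : forall A : set (Rd R d), measurable A -> P (X 0 @^-1` A) = mu A.
Hypothesis invk : mu_invariant mu k.
Local Notation E := (Rd R d).
Local Notation "P_[ t ]" := (transition_op k t) (at level 1, format "P_[ t ]").
Local Notation represents := (represents mu P X).

Let mX0 := measurable_X markovX (lexx 0).

Lemma representsB h g Y Z : bm h -> bm g -> bm Y -> bm Z ->
  represents h Y -> represents g Z -> represents (fun x => h x - g x) (fun w => Y w - Z w).
Proof.
move=> bh bg bY bZ hY gZ phi bphi; have bp := bm_comp mX0 bphi.
transitivity (\int[P]_w (phi (X 0 w) * Y w) - \int[P]_w (phi (X 0 w) * Z w)).
  rewrite -bm_RintegralB; try exact: bmM.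
  by apply: eq_Rintegral => w _; rewrite mulrBr.
rewrite hY// gZ// -bm_RintegralB; try exact: bmM.
by apply: eq_Rintegral => w _; rewrite mulrBr.
Qed.

Lemma representsZ c h Y : bm h -> bm Y ->
  represents h Y -> represents (fun x => h x * c) (fun w => Y w * c).
Proof.
move=> bh bY hY phi bphi; have bp := bm_comp mX0 bphi.
under eq_Rintegral do rewrite mulrA; under [RHS]eq_Rintegral do rewrite mulrA.
by rewrite !bm_RintegralZr ?hY//; exact: bmM.
Qed.

Lemma cvg_sqr_at_right0 (c : R) : (fun t : R => ((c * t) ^+ 2)%:E) @ 0^'+ --> (0 : \bar R).
Proof.
have -> : (0 : \bar R) = ((c * 0) ^+ 2)%:E by rewrite mulr0 expr0n.
apply: cvg_EFin; first by near=> t.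
apply: cvg_at_right_filter.
have h : (fun t : R => c * t) t @[t --> (0 : R)] --> c * 0 by apply: cvgMr; exact: cvg_id.
by under eq_cvg do rewrite expr2; rewrite expr2; exact: cvgM.
Unshelve. all: by end_near. Qed.

Variables (f : E -> R).
Hypothesis bf : bm f.
Variable S : R.
Local Notation tau := (time_measure S).
Local Notation path := (path X f).
Local Notation weighted := (weighted X f S).

Variables (a a' : R -> R) (K : R).
Hypotheses (ba : bm a) (ba' : bm a').
Hypothesis a_neg : forall s, s < 0 -> a s = 0.
Hypothesis a_large : forall s, S - 1 < s -> a s = 0.
Hypothesis a_deriv : forall t, 0 < t -> t <= 1 ->
  \int[tau]_s `|(a (s - t) - a s) / t + a' s| <= K * t.

(** The weight vanishes before [0] and after [S - 1], so a shift by [t <= 1] pushes none of it out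
    of the window. *)
Lemma weighted_shift t w : 0 <= t -> t <= 1 ->
  \int[tau]_s (a s * path (s + t) w) = \int[tau]_s (a (s - t) * path s w).
Proof.
move=> t0 t1.
have ms : measurable_fun setT (fun s : R => s - t) by exact: measurable_funB.
have bphi : bm (fun s : R => a (s - t) * path s w).
  by apply: bmM; [exact: (bm_comp ms)|exact: (bm_path_time markovX bf)].
have h := time_shift S t0 bphi.
transitivity (\int[tau]_s ((a (s + t - t) * path (s + t) w) * \1_`[0, S - t] s)).
  apply: eq_Rintegral => s _; rewrite addrK indicE mem_setE in_itv/=.
  have [s0|s0] := ltP s 0; first by rewrite a_neg// !mul0r.
  have [s1|s1] := leP s (S - t); first by rewrite mulr1.
  by rewrite a_large ?mul0r//; lra.
rewrite h; apply: eq_Rintegral => s _; rewrite indicE mem_setE in_itv/=.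
have [s0|s0] := leP t s; last by rewrite a_neg ?mul0r//; lra.
have [s1|s1] := leP s S; first by rewrite mulr1.
by rewrite a_large ?mul0r//; lra.
Qed.

(** [D t] is represented by [Z t], which is at most [K |M| t] uniformly, since the difference
    quotient of the weight approaches its derivative in [L^1] at rate [t]; [represents_sq] turns
    this into an [L^2] bound on [D t]. Moving the path forward moves the weight backward, whence the
    factor [-1]. *)
Lemma generator_weighted h g : bm h -> bm g ->
  represents h (weighted a) -> represents g (fun w => weighted a' w * -1) ->
  L2_generator mu k h g.
Proof.
move=> bh bg hY gY; have [_ [M fM]] := bf.
have bW := bm_weighted markovX bf S ba; have bW' := bm_weighted markovX bf S ba'.
have bat (t : R) : bm (fun s : R => a (s - t)).
  by apply: (bm_comp _ ba); exact: measurable_funB.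
have bpt w : bm (path ^~ w) by exact: (bm_path_time markovX bf).
pose Wt t w := \int[tau]_s (a s * path (s + t) w).
pose Z t w := (Wt t w - weighted a w) * t^-1 - weighted a' w * -1.
pose D t x := (P_[t] h x - h x) * t^-1 - g x.
have bWt t : bm (Wt t).
  have b2 : bm (fun z : R * O => a z.1 * path (z.1 + t) z.2).
    apply: bmM; first exact: (bm_comp measurable_fst).
    apply: (bm_comp _ (bm_path2 markovX bf) (u := fun z : R * O => (z.1 + t, z.2))).
    by apply: measurable_fun_pair => //; exact: measurable_funD.
  exact: (bm_Rintegral1 tau P b2).
have bPt t : bm (P_[t] h) by exact: bm_transition_op.
have bZ t : bm (Z t).
  apply: bmB; apply: bmM; try exact: bm_cst; last by [].
  exact: bmB.
have bD t : bm (D t).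
  by apply: bmB => //; apply: bmM; [exact: bmB|exact: bm_cst].
have ZK t w : 0 < t -> t <= 1 -> `|Z t w| <= K * `|M| * t.
  move=> t0 t1.
  have bk : bm (fun s : R => (a (s - t) - a s) / t + a' s).
    by apply: bmD => //; apply: bmM; [exact: bmB|exact: bm_cst].
  have -> : Z t w = \int[tau]_s (((a (s - t) - a s) / t + a' s) * path s w).
    rewrite /Z /Wt (weighted_shift w (ltW t0) t1) /weighted.
    rewrite -bm_RintegralB; try by apply: bmM.
    rewrite -bm_RintegralZr; last by apply: bmB; exact: bmM.
    rewrite -bm_RintegralZr; last exact: bmM.
    rewrite -bm_RintegralB; last 2 first.
    - by apply: bmM; [apply: bmB; exact: bmM|exact: bm_cst].
    - by apply: bmM; [exact: bmM|exact: bm_cst].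
    by apply: eq_Rintegral => s _; ring.
  rewrite (le_trans (bm_le_normr_Rintegral _ (bmM bk (bpt w))))//.
  apply: (@le_trans _ _ (\int[tau]_s (`|(a (s - t) - a s) / t + a' s| * `|M|))).
    apply: bm_le_Rintegral.
    - by apply: bm_norm; exact: bmM.
    - by apply: bmM; [exact: bm_norm|exact: bm_cst].
    - by move=> s; rewrite normrM ler_wpM2l// (le_trans (fM _))// ler_norm.
  rewrite bm_RintegralZr; last exact: bm_norm.
  by rewrite mulrAC ler_wpM2r// a_deriv.
have DZ t : 0 <= t -> represents (D t) (Z t).
  move=> t0; apply: representsB => //.
  - by apply: bmM; [exact: bmB|exact: bm_cst].
  - by apply: bmM; [exact: bmB|exact: bm_cst].
  - by apply: bmM; [|exact: bm_cst].
  apply: representsZ; [exact: bmB|exact: bmB|].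
  apply: representsB => //; exact: (transition_represents markovX lawX0 invk bf).
have Dle t : 0 < t -> t <= 1 -> \int[mu]_x (D t x ^+ 2) <= (K * `|M| * t) ^+ 2.
  move=> t0 t1.
  rewrite (le_trans (represents_sq markovX lawX0 invk (bD t) (bZ t) (DZ t (ltW t0))))//.
  rewrite -[leRHS](prob_Rintegral_cst P); apply: bm_le_Rintegral; [exact: bmX|exact: bm_cst|].
  move=> w; rewrite -(real_normK (num_real (Z t w))) lerXn2r// ?nnegrE// ?ZK//.
  by rewrite (le_trans _ (ZK t w t0 t1)).
have lty (u : E -> R) : bm u -> (\int[mu]_x (u x ^+ 2)%:E < +oo)%E.
  by move=> bu; rewrite (bm_RintegralE _ (bmX 2 bu)) ltry.
split; first by case: bh.
split; first by case: bg.
split; first exact: lty.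
split; first exact: lty.
apply: (squeeze_cvge _ (cvg_cst _) (cvg_sqr_at_right0 (K * `|M|))).
near=> t.
have t0 : 0 < t by near: t; exact: nbhs_right_gt.
have t1 : t <= 1 by near: t; apply: nbhs_right_le.
rewrite integral_ge0/=; last by move=> x _; rewrite lee_fin sqr_ge0.
by rewrite (bm_RintegralE _ (bmX 2 (bD t))) lee_fin Dle.
Unshelve. all: by end_near. Qed.

End GeneratorOfWeighted.

Lemma Lnorm2_bm d (T : measurableType d) (R : realType) (m : {finite_measure set T -> \bar R})
    (f : T -> R) : bm f ->
  Lnorm m 2%:E (EFin \o f) = (Num.sqrt (\int[m]_x (f x ^+ 2)))%:E.
Proof.
move=> bf; rewrite unlock.
under eq_integral => x _.
  rewrite [(EFin \o f) x]/= abse_EFin poweR_EFin powR_mulrn// real_normK ?num_real//.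
  over.
rewrite (bm_RintegralE _ (bmX 2 bf)) poweR_EFin powR12_sqrt//.
by apply: Rintegral_ge0 => x _; exact: sqr_ge0.
Qed.

(** * Trapezoidal weights *)

Section Ramp.
Variable R : realType.

(** The primitive of the indicator of [[0, 1]]. The weight [ramp s - ramp (s - t)] is a trapezoid
    that imitates the indicator of [[0, t]]. *)
Definition ramp (s : R) : R := Num.max 0 (Num.min s 1).

Lemma measurable_ramp : measurable_fun setT ramp.
Proof.
have h1 : measurable_fun setT (fun s : R => Num.min s 1).
  exact: (@measurable_minr _ _ R setT (id : R -> R) (cst 1)).
by rewrite /ramp; exact: (@measurable_maxr _ _ R setT (cst 0) _ (measurable_cst _) h1).
Qed.

Lemma bm_ramp : bm ramp.
Proof.
split; first exact: measurable_ramp.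
exists 1 => s; rewrite /ramp ger0_norm ?le_max ?lexx//.
by rewrite ge_max ler01/= ge_min lexx orbT.
Qed.

Lemma ramp_le0 s : s <= 0 -> ramp s = 0.
Proof. by move=> s0; rewrite /ramp (min_idPl _) ?(max_idPl _)//; lra. Qed.

Lemma ramp_ge1 s : 1 <= s -> ramp s = 1.
Proof. by move=> s0; rewrite /ramp (min_idPr _) ?(max_idPr _)//; lra. Qed.

Lemma ramp_id s : 0 <= s -> s <= 1 -> ramp s = s.
Proof. by move=> s0 s1; rewrite /ramp (min_idPl _) ?(max_idPr _). Qed.

(** The quotient lies between [-1] and [0] and is exact except within [t] to the right of the two
    corners. The closed endpoints are harmless: the quotient is still [-1] at [s = 1]. *)
Lemma ramp_deriv t s : 0 < t -> t <= 1 ->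
  `|(ramp (s - t) - ramp s) / t + \1_`[0, 1] s| <= \1_`[0, 0 + t] s + \1_`[1, 1 + t] s.
Proof.
move=> t0 t1; rewrite !indicE !mem_setE !in_itv/= add0r.
set q := _ / t; have qE : q * t = ramp (s - t) - ramp s by rewrite /q divfK// gt_eqF.
have q0 : - t <= q * t <= 0 -> -1 <= q <= 0.
  move=> /andP[h1 h2]; apply/andP; split; first by rewrite -(ler_pM2r t0) mulN1r.
  by rewrite -(ler_pM2r t0) mul0r.
have [s0|s0] := ltP s 0.
  rewrite ramp_le0 ?ramp_le0 ?subrr in qE; try lra.
  have -> : q = 0 by apply: (mulIf (lt0r_neq0 t0)); rewrite qE mul0r.
  have -> : (1 <= s) = false by apply/negbTE; rewrite -ltNge; lra.
  by rewrite /= !addr0 normr0.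
have [s1|s1] := leP s t.
  rewrite ramp_le0 ?ramp_id in qE; try lra.
  have /andP[? ?] : -1 <= q <= 0 by apply: q0; lra.
  have -> : s <= 1 by lra.
  set z := (1 <= s <= 1 + t)%R; case: z; rewrite /= ?addr0 ler_norml; apply/andP; split; lra.
have [s2|s2] := ltP s 1.
  rewrite !ramp_id in qE; try lra.
  have qN1 : q = -1 by apply: (mulIf (lt0r_neq0 t0)); rewrite qE; lra.
  rewrite (ltW s2)/= qN1 addNr normr0 addr_ge0// ?ler0n//.
have [s3|s3] := leP s (1 + t).
  rewrite (ramp_id (s := s - t)) ?ramp_ge1 in qE; try lra.
  have /andP[? ?] : -1 <= q <= 0 by apply: q0; lra.
  have [s4|s4] := leP s 1.
    have s1E : s = 1 by lra.
    have qN1 : q = -1 by apply: (mulIf (lt0r_neq0 t0)); rewrite qE; lra.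
    by rewrite qN1 addNr normr0 addr_ge0// ler0n.
  by rewrite /= addr0 ler_norml; lra.
rewrite !ramp_ge1 ?subrr in qE; try lra.
have -> : q = 0 by apply: (mulIf (lt0r_neq0 t0)); rewrite qE mul0r.
have -> : (s <= 1) = false by apply/negbTE; rewrite -ltNge; lra.
by rewrite /= !addr0 normr0.
Qed.

Lemma ramp_ge0 s : 0 <= ramp s.
Proof. by rewrite /ramp le_max lexx. Qed.

Lemma ramp_le1 s : ramp s <= 1.
Proof. by rewrite /ramp ge_max ler01/= ge_min lexx orbT. Qed.

Lemma indic_itv_shift (x y t s : R) : \1_`[x, y] (s - t) = \1_`[x + t, y + t] s :> R.
Proof. by rewrite !indicE !mem_setE !in_itv/= lerBrDr lerBlDr. Qed.

(** The trapezoid and the indicator differ only on the two ramps, by at most 1 on each. *)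
Lemma ramp_window t s : 0 <= t ->
  `|\1_`[0, t] s - (ramp s - ramp (s - t))| <= \1_`[0, 1] s + \1_`[0, 1] (s - t).
Proof.
move=> t0; rewrite !indicE !mem_setE !in_itv/=.
have := ramp_ge0 s; have := ramp_le1 s; have := ramp_ge0 (s - t); have := ramp_le1 (s - t).
move=> r1 r2 r3 r4.
have [s0|s0] := ltP s 0.
  rewrite (ramp_le0 (s := s)) ?(ramp_le0 (s := s - t)); try lra.
  by rewrite /= !subr0 normr0 addr_ge0// ler0n.
have [s1|s1] := leP s t.
  rewrite (ramp_le0 (s := s - t)); last lra.
  rewrite subr0/=; have [s2|s2] := leP s 1.
    by rewrite ler_wpDr ?ler0n// ler_norml/=; lra.
  by rewrite (ramp_ge1 (ltW s2)) subrr normr0 addr_ge0// ler0n.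
rewrite /= sub0r normrN subr_ge0 (ltW s1)/=.
have [s2|s2] := leP (s - t) 1.
  by rewrite ler_wpDl ?ler0n// ler_norml/=; lra.
by rewrite !ramp_ge1 ?subrr ?normr0 ?addr_ge0 ?ler0n//; lra.
Qed.

End Ramp.

(** * Variance of the time average of a bounded centered function *)

Section Variance.
Context (R : realType) (d : nat) (mu : probability (Rd R d) R)
  (k : R -> R.-pker (Rd R d) ~> (Rd R d))
  (dO : measure_display) (O : measurableType dO) (P : probability O R)
  (X : R -> O -> Rd R d).
Hypothesis markovX : is_markov_process P X k.
Hypothesis lawX0 : forall A : set (Rd R d), measurable A -> P (X 0 @^-1` A) = mu A.
Hypothesis invk : mu_invariant mu k.
Local Notation E := (Rd R d).
Local Notation "P_[ t ]" := (transition_op k t) (at level 1, format "P_[ t ]").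
Local Notation represents := (represents mu P X).
Variable lam : R.
Hypothesis lam0 : 0 < lam.
Hypothesis poincare : forall f g : E -> R, L2_generator mu k f g ->
  (\int[mu]_x (f x)%:E = 0)%E ->
  (lam%:E * Lnorm mu 2%:E (EFin \o f) <= Lnorm mu 2%:E (EFin \o g))%E.

Variables (f : E -> R).
Hypothesis bf : bm f.
Hypothesis f_centered : \int[mu]_x f x = 0.
Variable T : R.
Hypothesis T0 : 0 <= T.
Local Notation S := (T + 2).
Local Notation tau := (time_measure S).
Local Notation path := (path X f).
Local Notation weighted := (weighted X f S).
Let v := \int[mu]_x (f x ^+ 2).
Let mX0 := measurable_X markovX (lexx 0).

Let bi (x y : R) : bm (\1_`[x, y]%classic : R -> R).
Proof. by apply: bm_indic; exact: measurable_itv. Qed.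

Let v0 : 0 <= v. Proof. by apply: Rintegral_ge0 => x _; exact: sqr_ge0. Qed.

(** The Poincare inequality gives [lam |h| <= |g|], and [|g| <= 2 |f|] by [weighted_sq]; the left
    side is the pairing of [f] with [h]. The constant [K] serves to place [h] in the domain and does
    not enter the bound. *)
Lemma poincare_weighted (a a' : R -> R) (K : R) : bm a -> bm a' ->
  (forall s, s < 0 -> a s = 0) -> (forall s, S - 1 < s -> a s = 0) ->
  (forall t, 0 < t -> t <= 1 -> \int[tau]_s `|(a (s - t) - a s) / t + a' s| <= K * t) ->
  \int[tau]_s `|a' s| <= 2 ->
  `|\int[P]_w (path 0 w * weighted a w)| <= 2 / lam * v.
Proof.
move=> ba ba' a_neg a_large a_deriv a'2.
have bW := bm_weighted markovX bf S ba; have bW' := bm_weighted markovX bf S ba'.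
have bW1 : bm (fun w => weighted a' w * -1) by apply: bmM => //; exact: bm_cst.
have [h bh hY] := cond_exp mX0 lawX0 bW.
have [g bg gY] := cond_exp mX0 lawX0 bW1.
have hg := generator_weighted markovX lawX0 invk bf ba ba' a_neg a_large a_deriv bh bg hY gY.
have h_centered : \int[mu]_x h x = 0.
  have := hY (fun=> 1) (bm_cst _ 1); under [RHS]eq_Rintegral do rewrite mul1r.
  move=> <-; rewrite (weighted_test markovX bf S ba (bm_cst _ 1)).
  under eq_Rintegral => s _.
    under eq_Rintegral do rewrite mul1r.
    rewrite (stationary_bm markovX lawX0 invk (f := f)) ?le_max ?lexx// f_centered mulr0.
    over.
  by rewrite RintegralT_cst mul0r.
have := poincare hg; rewrite (bm_RintegralE _ bh) h_centered => /(_ erefl).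
rewrite (Lnorm2_bm _ bh) (Lnorm2_bm _ bg) -EFinM lee_fin => hlg.
have g2 : \int[mu]_x (g x ^+ 2) <= 4 * v.
  rewrite (le_trans (represents_sq markovX lawX0 invk bg bW1 gY))//.
  under eq_Rintegral do rewrite exprMn sqrrN expr1n mulr1.
  rewrite (le_trans (weighted_sq markovX lawX0 invk bf S ba'))// ler_wpM2r//.
  have a'0 : 0 <= \int[tau]_s `|a' s| by apply: Rintegral_ge0.
  have -> : 4 = 2 ^+ 2 :> R by rewrite -natrX.
  by rewrite lerXn2r// nnegrE.
have h0 : 0 <= \int[mu]_x (h x ^+ 2) by apply: Rintegral_ge0 => x _; exact: sqr_ge0.
have g0 : 0 <= \int[mu]_x (g x ^+ 2) by apply: Rintegral_ge0 => x _; exact: sqr_ge0.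
have h2 : lam ^+ 2 * \int[mu]_x (h x ^+ 2) <= 4 * v.
  apply: le_trans g2; rewrite -[X in _ * X](sqr_sqrtr h0) -[leRHS](sqr_sqrtr g0) -exprMn.
  by rewrite lerXn2r// ?nnegrE ?mulr_ge0 ?sqrtr_ge0// ltW.
have -> : \int[P]_w (path 0 w * weighted a w) = \int[mu]_x (f x * h x).
  by rewrite -hY//; apply: eq_Rintegral => w _; rewrite /path max_l.
rewrite (le_trans (bm_le_normr_Rintegral _ (bmM bf bh)))//.
(* AM-GM: [2 |f h| <= (2 / lam) f^2 + (lam / 2) h^2] *)
apply: (@le_trans _ _ (\int[mu]_x (lam^-1 * f x ^+ 2 + lam / 4 * h x ^+ 2))).
  apply: bm_le_Rintegral.
  - by apply: bm_norm; exact: bmM.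
  - by apply: bmD; apply: bmM; try exact: bm_cst; exact: bmX.
  - move=> x; rewrite normrM -(real_normK (num_real (f x))) -(real_normK (num_real (h x))).
    set y := `|f x|; set z := `|h x|.
    have : 0 <= lam^-1 * (y - lam / 2 * z) ^+ 2 by rewrite mulr_ge0 ?sqr_ge0// invr_ge0 ltW.
    have -> : lam^-1 * (y - lam / 2 * z) ^+ 2 = lam^-1 * y ^+ 2 - y * z + lam / 4 * z ^+ 2.
      by field; rewrite gt_eqF.
    lra.
rewrite bm_RintegralD; try by apply: bmM; [exact: bm_cst|exact: bmX].
rewrite !bm_RintegralZl; try exact: bmX.
rewrite -/v (_ : 2 / lam * v = lam^-1 * v + lam^-1 * v); last by ring.
rewrite lerD2l -(ler_pM2l lam0) mulrA.
rewrite (_ : lam * (lam / 4) = lam ^+ 2 / 4); last by ring.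
by rewrite mulrA divff ?gt_eqF// mul1r mulrAC ler_pdivrMr// [leRHS]mulrC.
Qed.

Lemma corr_int_le t : 0 <= t -> t <= T ->
  `|\int[tau]_s (\1_`[0, t] s * \int[P]_w (path 0 w * path s w))| <= (2 / lam + 2) * v.
Proof.
move=> t0 tT.
pose a (s : R) := ramp s - ramp (s - t).
pose a' (s : R) := \1_`[0, 1] s - \1_`[0, 1] (s - t) : R.
have mst : measurable_fun setT (fun s : R => s - t) by exact: measurable_funB.
have ba : bm a by apply: bmB; [exact: bm_ramp|exact: (bm_comp mst (bm_ramp R))].
have bit (x y : R) : bm (fun s : R => \1_`[x, y] (s - t) : R) by exact: (bm_comp mst (bi x y)).
have ba' : bm a' by exact: bmB.
have int_it (x y : R) : x <= y -> \int[tau]_s \1_`[x, y] (s - t) <= y - x.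
  move=> xy; under eq_Rintegral do rewrite indic_itv_shift.
  by rewrite (le_trans (time_indic_le _ _)) ?lerD2r//; lra.
have bc : bm (fun s => \int[P]_w (path 0 w * path s w)).
  have bG : bm (fun z : R * O => path 0 z.2 * path z.1 z.2).
    by apply: bmM; [exact: (bm_comp measurable_snd (bm_path markovX bf 0))|exact: (bm_path2 markovX bf)].
  exact: (bm_Rintegral2 tau P bG).
have h1 : `|\int[P]_w (path 0 w * weighted a w)| <= 2 / lam * v.
  (* Two ramps with two corners each: the quotient errs on four intervals of length [e], hence the
     4. *)
  apply: (@poincare_weighted a a' 4) => //.
  - by move=> s s0; rewrite /a !ramp_le0 ?subrr//; lra.
  (* The second ramp ends at [t + 1 <= T + 1 = S - 1]. This fixes the horizon [S = T + 2]. *)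
  - by move=> s s0; rewrite /a !ramp_ge1 ?subrr//; lra.
  - move=> e e0 e1.
    have mse : measurable_fun setT (fun s : R => s - e) by exact: measurable_funB.
    apply: (@le_trans _ _ (\int[tau]_s ((\1_`[0, 0 + e] s + \1_`[1, 1 + e] s) +
        (\1_`[0, 0 + e] (s - t) + \1_`[1, 1 + e] (s - t))))).
      apply: bm_le_Rintegral.
      + apply: bm_norm; apply: bmD => //; apply: bmM; last exact: bm_cst.
        by apply: bmB => //; exact: (bm_comp mse ba).
      + by do 2 apply: bmD.
      + move=> s; rewrite (_ : _ + _ = ((ramp (s - e) - ramp s) / e + \1_`[0, 1] s) -
          ((ramp (s - t - e) - ramp (s - t)) / e + \1_`[0, 1] (s - t))).
          by rewrite (le_trans (ler_normB _ _))// lerD ?ramp_deriv.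
        by rewrite /a /a' (addrAC s (- t) (- e)); ring.
    rewrite !bm_RintegralD //; try by apply: bmD.
    have e0' : 0 <= 0 + e by rewrite add0r ltW.
    have e1' : 1 <= 1 + e by rewrite lerDl ltW.
    have := time_indic_le S e0'; have := time_indic_le S e1'.
    have := int_it _ _ e0'; have := int_it _ _ e1'; lra.
  - apply: (@le_trans _ _ (\int[tau]_s (\1_`[0, 1] s + \1_`[0, 1] (s - t)))).
      apply: bm_le_Rintegral; [exact: bm_norm|exact: bmD|].
      by move=> s; rewrite /a' (le_trans (ler_normB _ _))// !ger0_norm// indicE ler0n.
    rewrite bm_RintegralD//.
    have := time_indic_le S (@ler01 R); have := int_it _ _ (@ler01 R); lra.
rewrite (weighted_test markovX bf S ba (bm_path markovX bf 0)) in h1.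
have b1c : bm (fun s => \1_`[0, t] s * \int[P]_w (path 0 w * path s w)) by exact: bmM.
have bac : bm (fun s => a s * \int[P]_w (path 0 w * path s w)) by exact: bmM.
have h2 : `|\int[tau]_s (\1_`[0, t] s * \int[P]_w (path 0 w * path s w)) -
    \int[tau]_s (a s * \int[P]_w (path 0 w * path s w))| <= 2 * v.
  rewrite -bm_RintegralB// (le_trans (bm_le_normr_Rintegral _ (bmB b1c bac)))//.
  apply: (@le_trans _ _ (\int[tau]_s ((\1_`[0, 1] s + \1_`[0, 1] (s - t)) * v))).
    apply: bm_le_Rintegral; [by apply: bm_norm; exact: bmB| |].
      by apply: bmM; [exact: bmD|exact: bm_cst].
    move=> s; rewrite -mulrBl normrM ler_pM ?ramp_window//.
    exact: (path_corr markovX lawX0 invk bf).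
  rewrite bm_RintegralZr; last exact: bmD.
  rewrite ler_wpM2r// bm_RintegralD//.
  have := time_indic_le S (@ler01 R); have := int_it _ _ (@ler01 R); lra.
rewrite mulrDl -[X in `|X|](subrK (\int[tau]_s (a s * \int[P]_w (path 0 w * path s w)))).
by rewrite (le_trans (ler_normD _ _))// addrC lerD.
Qed.

Lemma corr_shift s u : 0 <= s -> 0 <= u ->
  \int[P]_w (path (u + s) w * path s w) = \int[P]_w (path 0 w * path u w).
Proof.
move=> s0 u0; have us0 : 0 <= u + s by exact: addr_ge0.
rewrite /path !max_r//.
under eq_Rintegral do rewrite mulrC addrC.
have ss : 0 <= s <= s by rewrite s0 lexx.
have r00 : 0 <= (0 : R) <= 0 by rewrite lexx.
rewrite (markov_bm markovX ss u0 bf bf).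
have := markov_bm markovX r00 u0 bf bf; rewrite add0r => ->.
have bfP : bm (fun x => f x * P_[u] f x) by apply: bmM => //; exact: bm_transition_op.
by rewrite (stationary_bm markovX lawX0 invk s0 bfP) (stationary_bm markovX lawX0 invk (lexx 0) bfP).
Qed.

Let c (r s : R) : R := \int[P]_w (path r w * path s w).

Let bc2 : bm (fun z : R * R => c z.1 z.2).
Proof.
have bp := bm_path2 markovX bf.
have bG : bm (fun z : (R * R) * O => path z.1.1 z.2 * path z.1.2 z.2).
  apply: bmM.
    apply: (bm_comp _ bp (u := fun z : (R * R) * O => (z.1.1, z.2))).
    by apply: measurable_fun_pair => //; exact: measurableT_comp.
  apply: (bm_comp _ bp (u := fun z : (R * R) * O => (z.1.2, z.2))).
  by apply: measurable_fun_pair => //; exact: measurableT_comp.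
(* Measurability in the two times is read off from Fubini for some finite measure on [R * R], here a
   Dirac mass. *)
exact: (@bm_Rintegral2 _ _ (R * R)%type O R
  [the {finite_measure set (R * R)%type -> \bar R} of @dirac _ (R * R)%type (0 : R, 0 : R) R] P _ bG).
Qed.

Let cC r s : c r s = c s r.
Proof. by apply: eq_Rintegral => w _; rewrite mulrC. Qed.

Let b (s : R) : R := \1_`[0, T]%classic s.

Let bb : bm b. Proof. exact: bi. Qed.

(** Stationarity moves the time [s] to 0 and leaves the window [[0, T - s]], to which [corr_int_le]
    applies with a bound independent of its length. *)
Lemma corr_future_int s : `|\int[tau]_r (b s * b r * c s r * (s <= r)%R%:R)| <= b s * ((2 / lam + 2) * v).
Proof.
have [s01|s01] := boolP (s \in `[0, T]); last first.
  under eq_Rintegral do rewrite /b {1}indicE mem_setE (negbTE s01) !mul0r.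
  by rewrite RintegralT_cst mul0r normr0 /b indicE mem_setE (negbTE s01) mul0r.
move: (s01); rewrite in_itv/= => /andP[s0 sT].
have bs1 : b s = 1 by rewrite /b indicE mem_setE s01.
rewrite [in leRHS]bs1 mul1r.
have bphi : bm (fun u => b u * c s u) by apply: bmM => //; exact: (bm_pair1 bc2 s).
have := time_shift S s0 bphi.
have -> : \int[tau]_r (b s * b r * c s r * (s <= r)%R%:R) =
    \int[tau]_r (b r * c s r * \1_`[s, S] r).
  apply: eq_Rintegral => r _; rewrite /b !indicE !mem_setE s01 mul1r !in_itv/=.
  have [r0|r0] := leP 0 r; have [rT|rT] := leP r T; rewrite /= ?mul0r//.
  have -> : r <= S by lra.
  by rewrite andbT.
move=> <-.
have -> : \int[tau]_r (b (r + s) * c s (r + s) * \1_`[0, S - s] r) =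
    \int[tau]_r (\1_`[0, T - s] r * \int[P]_w (path 0 w * path r w)).
  apply: eq_Rintegral => u _; rewrite /b !indicE !mem_setE !in_itv/=.
  have [u0|u0] := leP 0 u; last by rewrite andFb mulr0 andFb mul0r.
  have -> : 0 <= u + s by rewrite addr_ge0.
  rewrite -lerBrDr; have [uT|uT] := leP u (T - s); last by rewrite !mul0r.
  have -> : u <= S - s by lra.
  by rewrite mulr1 !mul1r cC /c corr_shift.
by apply: corr_int_le; lra.
Qed.

(** The mean square is the double integral of the correlations over [[0, T]^2]. By symmetry it is
    twice its part [s <= r], and the inner integral of that part is bounded by [corr_future_int]. *)
Lemma weighted_variance :
  \int[P]_w (weighted b w ^+ 2) <= 2 * T * ((2 / lam + 2) * v).
Proof.
pose F (z : R * R) := b z.1 * b z.2 * c z.1 z.2.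
pose le12 (z : R * R) : R := (z.1 <= z.2)%R%:R.
pose le21 (z : R * R) : R := (z.2 <= z.1)%R%:R.
have bF : bm F.
  by apply: bmM => //; apply: bmM; [exact: (bm_comp measurable_fst)|exact: (bm_comp measurable_snd)].
have ble (g1 g2 : R * R -> R) : measurable_fun setT g1 -> measurable_fun setT g2 ->
    bm (fun z => (g1 z <= g2 z)%R%:R : R).
  move=> m1 m2; split; last by exists 1 => z; rewrite ger0_norm ?ler0n// lern1 leq_b1.
  have mset : measurable [set z | g1 z <= g2 z].
    rewrite (_ : [set _ | _] = (fun z => g1 z <= g2 z) @^-1` [set true]); last by [].
    by rewrite -[X in measurable X]setTI; exact: measurable_fun_ler.
  rewrite (_ : (fun _ => _) = \1_[set z | g1 z <= g2 z]); first exact: measurable_indic.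
  by apply/funext => z; rewrite indicE; congr (nat_of_bool _)%:R; apply/idP/idP; rewrite inE.
have b12 : bm le12 by exact: ble.
have b21 : bm le21 by exact: ble.
have beq : bm (fun z : R * R => (z.1 == z.2)%:R : R).
  rewrite (_ : (fun _ => _) = fun z => le12 z * le21 z); first exact: bmM.
  by apply/funext => z; rewrite /le12 /le21 -natrM mulnb -eq_le.
have bF12 : bm (fun z => F z * le12 z) by exact: bmM.
have bF21 : bm (fun z => F z * le21 z) by exact: bmM.
have bFeq : bm (fun z : R * R => F z * (z.1 == z.2)%:R) by exact: bmM.
have -> : \int[P]_w (weighted b w ^+ 2) = \int[tau]_s \int[tau]_r F (s, r).
  under eq_Rintegral do rewrite expr2.
  rewrite (weighted_test markovX bf S bb (bm_weighted markovX bf S bb)).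
  apply: eq_Rintegral => s _.
  under eq_Rintegral do rewrite mulrC.
  rewrite (weighted_test markovX bf S bb (bm_path markovX bf s)).
  rewrite -bm_RintegralZl; last by apply: bmM => //; exact: (bm_pair1 bc2 s).
  by apply: eq_Rintegral => r _; rewrite /F/= -/(c s r); ring.
(* [le12] and [le21] both count the diagonal, which is negligible. *)
have Feq0 s : \int[tau]_r (F (s, r) * (s == r)%:R) = 0.
  apply/eqP; rewrite -normr_le0 (le_trans (bm_le_normr_Rintegral _ (bm_pair1 bFeq s)))//.
  apply: (@le_trans _ _ (\int[tau]_r (v * \1_`[s, s] r))).
    apply: bm_le_Rintegral; [by apply: bm_norm; exact: (bm_pair1 bFeq s)| |].
      by apply: bmM => //; exact: bm_cst.
    move=> r; rewrite /F/= indicE mem_setE in_itv/= -eq_le normrM [`|_%:R|]ger0_norm ?ler0n//.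
    rewrite ler_wpM2r ?ler0n// normrM -[leRHS]mul1r ler_pM ?path_corr//.
      by rewrite normrM /b !indicE !ger0_norm ?ler0n// -natrM lern1 mulnb leq_b1.
    exact: (path_corr markovX lawX0 invk bf).
  rewrite bm_RintegralZl//; have := time_indic_le S (lexx s); rewrite subrr => h.
  by rewrite (le_trans (ler_wpM2l v0 h))// mulr0.
have -> : \int[tau]_s \int[tau]_r F (s, r) =
    \int[tau]_s \int[tau]_r (F (s, r) * le12 (s, r)) + \int[tau]_s \int[tau]_r (F (s, r) * le21 (s, r)).
  rewrite -bm_RintegralD; [|exact: (bm_Rintegral2 tau tau bF12)|exact: (bm_Rintegral2 tau tau bF21)].
  apply: eq_Rintegral => s _.
  rewrite -bm_RintegralD; [|exact: (bm_pair1 bF12 s)|exact: (bm_pair1 bF21 s)].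
  rewrite -[LHS]addr0 -(Feq0 s) -bm_RintegralD; [|exact: (bm_pair1 bF s)|exact: (bm_pair1 bFeq s)].
  apply: eq_Rintegral => r _; rewrite /le12 /le21/= -mulrDr -[X in X + _]mulr1 -mulrDr.
  by case: (ltgtP s r) => //= _; rewrite ?addr0 ?add0r.
have -> : \int[tau]_s \int[tau]_r (F (s, r) * le21 (s, r)) =
    \int[tau]_s \int[tau]_r (F (s, r) * le12 (s, r)).
  rewrite (bm_Fubini tau tau bF21); apply: eq_Rintegral => s _; apply: eq_Rintegral => r _.
  by rewrite /F /le12 /le21/= cC [b r * _]mulrC.
have h : \int[tau]_s \int[tau]_r (F (s, r) * le12 (s, r)) <= T * ((2 / lam + 2) * v).
  apply: (@le_trans _ _ (\int[tau]_s (b s * ((2 / lam + 2) * v)))).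
    apply: bm_le_Rintegral; [exact: (bm_Rintegral2 tau tau bF12)| |].
      by apply: bmM => //; exact: bm_cst.
    by move=> s; rewrite (le_trans (ler_norm _))//; exact: corr_future_int.
  rewrite bm_RintegralZr// ler_wpM2r//.
    by rewrite mulr_ge0// addr_ge0// divr_ge0// ltW.
  by have := time_indic_le S T0; rewrite subr0.
by rewrite (_ : 2 * T * _ = T * ((2 / lam + 2) * v) + T * ((2 / lam + 2) * v)); [exact: lerD|ring].
Qed.

End Variance.

(** * Transport of finitely many masses along a tree of partitions *)

Section DiscreteTransport.
Context (R : realType) (I : finType).
Implicit Types a b : I -> R.

(** In each cell the common mass [m c], the smaller of the two, is spread proportionally as a
    product plan. One of the two residuals of the cell then vanishes and the other is the
    discrepancy. *)
Lemma match_cells (K : finType) (kap : I -> K) a b :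
  (forall i, 0 <= a i) -> (forall i, 0 <= b i) ->
  exists (q : I -> I -> R) (a' b' : I -> R),
  [/\ [/\ forall i j, 0 <= q i j, forall i, 0 <= a' i & forall i, 0 <= b' i],
      forall i, \sum_j q i j + a' i = a i,
      forall j, \sum_i q i j + b' j = b j,
      forall i j, q i j != 0 -> kap i = kap j &
      forall c, \sum_(i | kap i == c) a' i <=
                  `|\sum_(i | kap i == c) a i - \sum_(i | kap i == c) b i| /\
                \sum_(i | kap i == c) b' i <=
                  `|\sum_(i | kap i == c) a i - \sum_(i | kap i == c) b i| ].
Proof.
move=> a0 b0.
pose A c := \sum_(i | kap i == c) a i; pose B c := \sum_(i | kap i == c) b i.
have A0 c : 0 <= A c by apply: sumr_ge0.
have B0 c : 0 <= B c by apply: sumr_ge0.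
pose m c := Num.min (A c) (B c).
have m0 c : 0 <= m c by rewrite /m le_min A0 B0.
have mA c : m c <= A c by rewrite /m ge_min lexx.
have mB c : m c <= B c by rewrite /m ge_min lexx orbT.
have aA i : a i <= A (kap i) by rewrite /A (bigD1 i)//= lerDl sumr_ge0.
have bB i : b i <= B (kap i) by rewrite /B (bigD1 i)//= lerDl sumr_ge0.
(* If [A c = 0] the quotient is 0 rather than 1, but then [m c = 0] as well. *)
have mAA c : m c * (A c / A c) = m c.
  have [Ac|Ac] := eqVneq (A c) 0; last by rewrite divff ?mulr1.
  have mc : m c = 0 by apply/eqP; rewrite eq_le m0 andbT -Ac.
  by rewrite mc mul0r.
have mBB c : m c * (B c / B c) = m c.
  have [Bc|Bc] := eqVneq (B c) 0; last by rewrite divff ?mulr1.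
  have mc : m c = 0 by apply/eqP; rewrite eq_le m0 andbT -Bc.
  by rewrite mc mul0r.
pose q i j := if kap i == kap j then m (kap i) * (a i / A (kap i)) * (b j / B (kap i)) else 0.
pose a' i := a i - m (kap i) * (a i / A (kap i)).
pose b' i := b i - m (kap i) * (b i / B (kap i)).
have part (x y z : R) : 0 <= x -> x <= y -> 0 <= z -> z <= y -> z * (x / y) <= x.
  move=> x0 xy z0 zy; have [y0|y0] := eqVneq y 0.
    have x00 : x = 0 by apply/eqP; rewrite eq_le x0 andbT -y0.
    by rewrite x00 mul0r mulr0.
  have yp : 0 < y by rewrite lt_neqAle eq_sym y0 (le_trans x0).
  by rewrite mulrA ler_pdivrMr// mulrC ler_wpM2l.
exists q, a', b'; split.
- split.
  + by move=> i j; rewrite /q; case: ifP => // _; rewrite !mulr_ge0 ?invr_ge0.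
  + by move=> i; rewrite /a' subr_ge0 part.
  + by move=> i; rewrite /b' subr_ge0 part.
- move=> i; have -> : \sum_j q i j = m (kap i) * (a i / A (kap i)).
    rewrite /q -big_mkcond/= -mulr_sumr -mulr_suml.
    under eq_bigl do rewrite eq_sym.
    by rewrite -/(B _) mulrAC mBB.
  by rewrite /a' addrC subrK.
- move=> j; have -> : \sum_i q i j = m (kap j) * (b j / B (kap j)).
    transitivity (\sum_(i | kap i == kap j) m (kap j) * (a i / A (kap j)) * (b j / B (kap j))).
      by rewrite /q -big_mkcond/=; apply: eq_bigr => i /eqP ->.
    by rewrite -mulr_suml -mulr_sumr -mulr_suml -/(A _) mAA.
  by rewrite /b' addrC subrK.
- by move=> i j; rewrite /q; case: (kap i =P kap j) => [//|_]; rewrite eqxx.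
- move=> c; rewrite -/(A c) -/(B c).
  have -> : \sum_(i | kap i == c) a' i = A c - m c.
    rewrite /a' sumrB -/(A c); congr (_ - _).
    rewrite -[RHS]mAA; rewrite [in X in _ * (X / _)]/A mulr_suml mulr_sumr.
    by apply: eq_bigr => i /eqP ->.
  have -> : \sum_(i | kap i == c) b' i = B c - m c.
    rewrite /b' sumrB -/(B c); congr (_ - _).
    rewrite -[RHS]mBB; rewrite [in X in _ * (X / _)]/B mulr_suml mulr_sumr.
    by apply: eq_bigr => i /eqP ->.
  rewrite /m; case: (leP (A c) (B c)) => h.
    by rewrite subrr normr_ge0 distrC ger0_norm ?subr_ge0.
  by split; [exact: ler_norm|rewrite subrr].
Qed.

Section Levels.
Variables (K : nat -> finType) (kap : forall m, I -> K m).
Hypothesis nested : forall m i j, kap m i = kap m j -> kap m.+1 i = kap m.+1 j.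
Variables (a b : I -> R) (D : I -> I -> R) (g0 : I -> R) (G : forall m, K m -> R).
Arguments kap : clear implicits.
Arguments G : clear implicits.
Hypotheses (a0 : forall i, 0 <= a i) (b0 : forall i, 0 <= b i).
Hypotheses (g00 : forall i, 0 <= g0 i) (G0 : forall m c, 0 <= G m c).
Hypothesis D0 : forall i j, kap 0%N i = kap 0%N j -> D i j <= g0 i.
Variable top : nat.
Hypothesis DS : forall m i j, (m < top)%N -> kap m.+1 i = kap m.+1 j ->
  D i j <= G m (kap m i) + G m (kap m j).

Let diff m (c : K m) := `|\sum_(i | kap m i == c) a i - \sum_(i | kap m i == c) b i|.

(** The residuals of level [n] are matched at level [n.+1], and each matched piece is charged [G n]
    at both of its ends. The residual of a cell is at most its discrepancy on either side, whence
    the factor 2. *)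
Lemma multilevel_match n : (n <= top)%N -> exists (q : I -> I -> R) (a' b' : I -> R),
  [/\ [/\ forall i j, 0 <= q i j, forall i, 0 <= a' i & forall i, 0 <= b' i],
      forall i, \sum_j q i j + a' i = a i,
      forall j, \sum_i q i j + b' j = b j,
      forall i j, q i j != 0 -> kap n i = kap n j &
      (forall c, \sum_(i | kap n i == c) a' i <= diff c /\
                \sum_(i | kap n i == c) b' i <= diff c) /\
      \sum_i \sum_j q i j * D i j <=
        \sum_i a i * g0 i + 2 * \sum_(m < n) \sum_(c : K m) G m c * diff c].
Proof.
elim: n => [_|n ih ntop].
  have [q [a' [b' [[q0 a'0 b'0] qa qb qk res]]]] := match_cells (kap 0%N) a0 b0.
  exists q, a', b'; split => //; split=> //.
  rewrite big_ord0 mulr0 addr0; apply: ler_sum => i _.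
  apply: (@le_trans _ _ (\sum_j q i j * g0 i)).
    apply: ler_sum => j _; have [->|qn0] := eqVneq (q i j) 0; first by rewrite !mul0r.
    by rewrite (ler_wpM2l (q0 i j))// D0// (qk _ _ qn0).
  by rewrite -mulr_suml ler_wpM2r// -(qa i) lerDl.
have [q [a' [b' [[q0 a'0 b'0] qa qb qk [res cost]]]]] := ih (ltnW ntop).
have [r [a'' [b'' [[r0 a''0 b''0] ra rb rk res']]]] := match_cells (kap n.+1) a'0 b'0.
(* Mass matched so far stays inside cells of level [n], hence of level [n.+1], and cancels in the
   discrepancy. The residuals may thus be replaced by the original masses. *)
have diffE c : `|\sum_(i | kap n.+1 i == c) a' i - \sum_(i | kap n.+1 i == c) b' i| = diff c.
  rewrite /diff; congr (`|_|).
  have -> : \sum_(i | kap n.+1 i == c) a i =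
     \sum_(i | kap n.+1 i == c) a' i + \sum_(i | kap n.+1 i == c) \sum_(j | kap n.+1 j == c) q i j.
    rewrite -big_split/=; apply: eq_bigr => i /eqP ic; rewrite -(qa i) addrC; congr (_ + _).
    rewrite [RHS]big_mkcond/=; apply: eq_bigr => j _; case: ifPn => // /eqP jc.
    apply/eqP/negPn/negP => qn0; apply: jc; rewrite -ic.
    by apply/esym/nested/qk.
  have -> : \sum_(i | kap n.+1 i == c) b i =
     \sum_(i | kap n.+1 i == c) b' i + \sum_(i | kap n.+1 i == c) \sum_(j | kap n.+1 j == c) q i j.
    rewrite [X in _ = _ + X]exchange_big/= -big_split/=.
    apply: eq_bigr => j /eqP jc; rewrite -(qb j) addrC; congr (_ + _).
    rewrite [RHS]big_mkcond/=; apply: eq_bigr => i _; case: ifPn => // /eqP ic.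
    apply/eqP/negPn/negP => qn0; apply: ic; rewrite -jc.
    by apply/nested/qk.
  by ring.
exists (fun i j => q i j + r i j), a'', b''; split.
- by split=> // i j; rewrite addr_ge0.
- by move=> i; rewrite big_split/= -addrA ra qa.
- by move=> j; rewrite big_split/= -addrA rb qb.
- move=> i j; have [r00|rn0 _] := eqVneq (r i j) 0; last exact: rk.
  by rewrite r00 addr0 => qn0; apply/nested/qk.
split; first by move=> c; rewrite -diffE; exact: res'.
under eq_bigr do under eq_bigr do rewrite mulrDl.
under eq_bigr do rewrite big_split/=.
rewrite big_split/= big_ord_recr/= mulrDr addrA lerD//.
have sumG (x : I -> R) : (forall c, \sum_(i | kap n i == c) x i <= diff c) ->
    \sum_i x i * G n (kap n i) <= \sum_(c : K n) G n c * diff c.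
  move=> xd; rewrite (partition_big (kap n) xpredT)//=; apply: ler_sum => c _.
  rewrite (_ : \sum_(i | kap n i == c) x i * G n (kap n i) = G n c * \sum_(i | kap n i == c) x i).
    by rewrite ler_wpM2l.
  by rewrite mulr_sumr; apply: eq_bigr => i /eqP ->; rewrite mulrC.
apply: (@le_trans _ _ (\sum_i a' i * G n (kap n i) + \sum_j b' j * G n (kap n j))); last first.
  by rewrite mulr_natl mulr2n lerD// sumG// => c; have [] := res c.
apply: (@le_trans _ _ (\sum_i \sum_j (r i j * G n (kap n i) + r i j * G n (kap n j)))).
  apply: ler_sum => i _; apply: ler_sum => j _.
  have [->|rn0] := eqVneq (r i j) 0; first by rewrite !mul0r addr0.
  by rewrite -mulrDr (ler_wpM2l (r0 i j))// DS// (rk _ _ rn0).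
under eq_bigr do rewrite big_split/=.
rewrite big_split/= lerD//.
  by apply: ler_sum => i _; rewrite -mulr_suml ler_wpM2r// -(ra i) lerDl.
rewrite exchange_big/=.
by apply: ler_sum => i _; rewrite -mulr_suml ler_wpM2r// -(rb i) lerDl.
Qed.

(** A single cell at the top and equal total masses leave no residual. *)
Lemma tree_transport : (forall i j, kap top i = kap top j) -> \sum_i a i = \sum_i b i ->
  exists q : I -> I -> R,
  [/\ forall i j, 0 <= q i j, forall i, \sum_j q i j = a i,
      forall j, \sum_i q i j = b j &
      \sum_i \sum_j q i j * D i j <=
        \sum_i a i * g0 i + 2 * \sum_(m < top) \sum_(c : K m) G m c * diff c].
Proof.
move=> triv ab; have [q [a' [b' [[q0 a'0 b'0] qa qb qk [res cost]]]]] := multilevel_match (leqnn top).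
have z i : a' i = 0 /\ b' i = 0.
  have d0 : diff (kap top i) = 0.
    rewrite /diff; apply/eqP; rewrite normr_eq0 subr_eq0; apply/eqP.
    have e (x : I -> R) : \sum_(j | kap top j == kap top i) x j = \sum_j x j.
      by apply: eq_bigl => j; rewrite (triv j i) eqxx.
    by rewrite !e.
  have [ra rb] := res (kap top i); rewrite d0 in ra rb.
  have le (x : I -> R) : (forall j, 0 <= x j) -> \sum_(j | kap top j == kap top i) x j <= 0 -> x i = 0.
    move=> x0 h; apply/eqP; rewrite eq_le x0 andbT (le_trans _ h)//.
    by rewrite (bigD1 i)//= lerDl sumr_ge0.
  by split; exact: le.
exists q; split => //.
  by move=> i; rewrite -(qa i) (z i).1 addr0.
by move=> j; rewrite -(qb j) (z j).2 addr0.
Qed.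

End Levels.
End DiscreteTransport.

(** * Probability measures with a density, and gluing of a discrete plan *)

Section DensityMeasure.
Context d (T : measurableType d) (R : realType) (m : {measure set T -> \bar R}).
Variable rho : T -> R.
Hypothesis mrho : measurable_fun setT rho.
Hypothesis rho0 : forall x, 0 <= rho x.
Hypothesis rho1 : (\int[m]_x (rho x)%:E = 1)%E.

(** The hypotheses on [rho] are arguments, so that the term alone determines the probability
    structure attached to it. *)
Definition density_measure & measurable_fun setT rho & (forall x, 0 <= rho x)
    & (\int[m]_x (rho x)%:E = 1)%E : set T -> \bar R :=
  fun A => (\int[m]_(x in A) (rho x)%:E)%E.

Let nu := density_measure mrho rho0 rho1.

Let nu0 : nu set0 = 0%E. Proof. by rewrite /nu /density_measure integral_set0. Qed.

Let nu_ge0 A : (0 <= nu A)%E.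
Proof. by apply: integral_ge0 => x _; rewrite lee_fin. Qed.

Let nu_sigma_additive : semi_sigma_additive nu.
Proof.
apply: semi_sigma_additive_nng_induced; first exact/measurable_EFinP.
by move=> x; rewrite lee_fin.
Qed.

HB.instance Definition _ := isMeasure.Build _ _ _ (density_measure mrho rho0 rho1)
  nu0 nu_ge0 nu_sigma_additive.
HB.instance Definition _ := Measure_isProbability.Build _ _ _
  (density_measure mrho rho0 rho1) rho1.

End DensityMeasure.

Section Gluing.
Context dE (E : measurableType dE) (R : realType) (nu mu : probability E R).
Context (I : finType) (A : I -> set E) (q : I -> I -> R).
Hypothesis mA : forall i, measurable (A i).
Hypothesis cA : forall x, exists i, A i x.
Hypothesis tA : forall i j x, A i x -> A j x -> i = j.
Hypothesis q0 : forall i j, 0 <= q i j.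
Hypothesis qnu : forall i, \sum_j q i j = fine (nu (A i)).
Hypothesis qmu : forall j, \sum_i q i j = fine (mu (A j)).

Lemma sum_cells (m : probability E R) (B : set E) : measurable B ->
  \sum_i fine (m (B `&` A i)) = fine (m B).
Proof.
move=> mB.
transitivity (\int[m]_x \sum_i \1_(B `&` A i) x).
  rewrite bm_Rintegral_sum; last by move=> i; apply: bm_indic; exact: measurableI.
  by apply: eq_bigr => i _; rewrite Rintegral_indicT//; exact: measurableI.
rewrite -Rintegral_indicT//; apply: eq_Rintegral => x _.
have [i Aix] := cA x.
rewrite (bigD1 i)//= big1 ?addr0.
  rewrite !indicE in_setI; congr (nat_of_bool _)%:R.
  by rewrite (_ : (x \in A i)) ?andbT// inE.
move=> j ji; rewrite indicE in_setI (_ : (x \in A j) = false) ?andbF//.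
by apply/negbTE/negP; rewrite inE => Ajx; move/eqP: ji; apply; exact: tA Ajx Aix.
Qed.

(** The coupling has a density with respect to [nu \x mu] that is constant on each product of two
    cells. A cell of mass zero gives [r i j = 0], which is consistent since its marginal forces
    [q i j = 0]. *)
Let r i j : R := q i j / (fine (nu (A i)) * fine (mu (A j))).

Let rho (z : E * E) : R := \sum_i \sum_j r i j * \1_(A i `*` A j) z.

Let mAA i j : measurable (A i `*` A j). Proof. exact: measurableX. Qed.

Let r0 i j : 0 <= r i j.
Proof. by rewrite divr_ge0// mulr_ge0// fine_ge0. Qed.

Let brho : bm rho.
Proof.
apply: bm_sum => i; apply: bm_sum => j; apply: bmM; first exact: bm_cst.
exact: bm_indic.
Qed.

Let rho0 z : 0 <= rho z.
Proof. by apply: sumr_ge0 => i _; apply: sumr_ge0 => j _; rewrite mulr_ge0. Qed.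

Let prod : probability (E * E)%type R := [the probability _ _ of (nu \x mu)%E].

Let prodE (B C : set E) : measurable B -> measurable C -> prod (B `*` C) = (nu B * mu C)%E.
Proof. by move=> mB mC; exact: product_measure1E. Qed.

Let rho_int (B C : set E) : measurable B -> measurable C ->
  \int[prod]_z (rho z * \1_(B `*` C) z) =
  \sum_i \sum_j r i j * (fine (nu (B `&` A i)) * fine (mu (C `&` A j))).
Proof.
move=> mB mC.
have mBC : measurable (B `*` C) by exact: measurableX.
have bF i j : bm (fun z => r i j * \1_((B `&` A i) `*` (C `&` A j)) z).
  by apply: bmM; [exact: bm_cst|apply: bm_indic; apply: measurableX; exact: measurableI].
transitivity (\int[prod]_z \sum_i \sum_j (r i j * \1_((B `&` A i) `*` (C `&` A j)) z)).
  apply: eq_Rintegral => z _; rewrite /rho mulr_suml; apply: eq_bigr => i _.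
  rewrite mulr_suml; apply: eq_bigr => j _; rewrite -mulrA; congr (_ * _).
  have -> : (B `&` A i) `*` (C `&` A j) = (A i `*` A j) `&` (B `*` C).
    by apply/seteqP; split => -[x y] /= [] [? ?] [? ?].
  by rewrite indicI.
rewrite bm_Rintegral_sum; last by move=> i; exact: bm_sum.
apply: eq_bigr => i _; rewrite bm_Rintegral_sum//; apply: eq_bigr => j _.
rewrite bm_RintegralZl; last by apply: bm_indic; apply: measurableX; exact: measurableI.
rewrite Rintegral_indicT; last by apply: measurableX; exact: measurableI.
congr (_ * _); rewrite [X in fine X](_ : _ = (nu (B `&` A i) * mu (C `&` A j))%E).
  by rewrite fineM// fin_num_measure//; exact: measurableI.
by apply: prodE; exact: measurableI.
Qed.

Let abs_cont (m : probability E R) (B : set E) i : measurable B ->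
  fine (m (A i)) = 0 -> fine (m (B `&` A i)) = 0.
Proof.
move=> mB h; apply/eqP; rewrite eq_le fine_ge0// andbT -h fine_le ?fin_num_measure//.
  exact: measurableI.
by apply: le_measure; rewrite ?inE//; exact: measurableI.
Qed.

Let rho_left (B : set E) : measurable B ->
  \int[prod]_z (rho z * \1_(B `*` setT) z) = fine (nu B).
Proof.
move=> mB; rewrite rho_int// -(sum_cells nu mB); apply: eq_bigr => i _.
have [ai0|ai0] := eqVneq (fine (nu (A i))) 0.
  by rewrite (abs_cont mB ai0) big1// => j _; rewrite mul0r mulr0.
transitivity (fine (nu (B `&` A i)) / fine (nu (A i)) * \sum_j q i j).
  rewrite mulr_sumr; apply: eq_bigr => j _; rewrite setTI /r.
  have [bj0|bj0] := eqVneq (fine (mu (A j))) 0.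
    have -> : q i j = 0.
      apply/eqP; rewrite eq_le q0 andbT -bj0 -qmu (bigD1 i)//= lerDl.
      exact: sumr_ge0.
    by rewrite mul0r mul0r mulr0.
  by field; rewrite ai0 bj0.
by rewrite qnu divfK.
Qed.

Let rho_right (B : set E) : measurable B ->
  \int[prod]_z (rho z * \1_(setT `*` B) z) = fine (mu B).
Proof.
move=> mB; rewrite rho_int// -(sum_cells mu mB) exchange_big/=; apply: eq_bigr => j _.
have [bj0|bj0] := eqVneq (fine (mu (A j))) 0.
  by rewrite (abs_cont mB bj0) big1// => i _; rewrite !mulr0.
transitivity (fine (mu (B `&` A j)) / fine (mu (A j)) * \sum_i q i j).
  rewrite mulr_sumr; apply: eq_bigr => i _; rewrite setTI /r.
  have [ai0|ai0] := eqVneq (fine (nu (A i))) 0.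
    have -> : q i j = 0.
      apply/eqP; rewrite eq_le q0 andbT -ai0 -qnu (bigD1 j)//= lerDl.
      exact: sumr_ge0.
    by rewrite mul0r mul0r mulr0.
  by field; rewrite ai0 bj0.
by rewrite qmu divfK.
Qed.

Let rho_cell i j : \int[prod]_z (rho z * \1_(A i `*` A j) z) = q i j.
Proof.
rewrite rho_int// (bigD1 i)//= [X in _ + X]big1 ?addr0; last first.
  move=> i' ii'; have -> : A i `&` A i' = set0.
    by apply/seteqP; split => // x [h1 h2]; move/eqP: ii'; apply; exact: tA h2 h1.
  by rewrite measure0 big1// => j' _; rewrite mul0r mulr0.
rewrite (bigD1 j)//= [X in _ + X]big1 ?addr0; last first.
  move=> j' jj'; have -> : A j `&` A j' = set0.
    by apply/seteqP; split => // x [h1 h2]; move/eqP: jj'; apply; exact: tA h2 h1.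
  by rewrite measure0 !mulr0.
rewrite !setIid /r.
have [p0|p0] := eqVneq (fine (nu (A i)) * fine (mu (A j))) 0; last by rewrite divfK.
rewrite p0 mulr0; apply/esym/eqP; rewrite eq_le q0 andbT.
move/eqP: p0; rewrite mulf_eq0 => /orP[/eqP h|/eqP h].
  by rewrite -h -qnu (bigD1 j)//= lerDl; exact: sumr_ge0.
by rewrite -h -qmu (bigD1 i)//= lerDl; exact: sumr_ge0.
Qed.

Lemma gluing : exists pi : probability (E * E)%type R,
  [/\ forall B, measurable B -> pi (B `*` setT) = nu B,
      forall B, measurable B -> pi (setT `*` B) = mu B &
      forall i j, pi (A i `*` A j) = (q i j)%:E].
Proof.
have fin (m : probability E R) B : measurable B -> (fine (m B))%:E = m B.
  by move=> mB; rewrite fineK// fin_num_measure.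
have rho1 : (\int[prod]_z (rho z)%:E = 1)%E.
  rewrite (bm_integral_in prod brho measurableT) -[X in \1_X]setXTT rho_left// fin//.
  exact: probability_setT.
exists [the probability _ _ of density_measure brho.1 rho0 rho1]; split.
- by move=> B mB /=; rewrite /density_measure (bm_integral_in prod brho (measurableX mB measurableT)) rho_left// fin.
- by move=> B mB /=; rewrite /density_measure (bm_integral_in prod brho (measurableX measurableT mB)) rho_right// fin.
- by move=> i j /=; rewrite /density_measure (bm_integral_in prod brho (mAA i j)) rho_cell.
Qed.

End Gluing.

Lemma ge0_integral_law d (T : measurableType d) d' (T' : measurableType d') (R : realType)
    (m : {measure set T -> \bar R}) (m' : {measure set T' -> \bar R}) (u : T -> T')
    (f : T' -> \bar R) : measurable_fun setT u ->
  (forall B, measurable B -> m (u @^-1` B) = m' B) ->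
  measurable_fun setT f -> (forall x, 0 <= f x)%E ->
  (\int[m]_x f (u x) = \int[m']_x f x)%E.
Proof.
move=> mu law mf f0.
have f0' : {in setT, forall y, (0 <= f y)%E} by move=> y _; exact: f0.
have <- := @ge0_integral_pushforward _ _ _ _ _ u mu m setT f measurableT mf f0'.
by apply: eq_measure_integral => B mB _; exact: law.
Qed.

(** * From a tree of cells to a coupling of two probability measures *)

Section MultiscaleCoupling.
Context dE (E : measurableType dE) (R : realType) (nu mu : probability E R).
Context (I : finType) (key : E -> I).
Hypothesis mkey : forall i, measurable (key @^-1` [set i]).
Variables (K : nat -> finType) (kap : forall m, I -> K m).
Arguments kap : clear implicits.
Hypothesis nested : forall m i j, kap m i = kap m j -> kap m.+1 i = kap m.+1 j.
Variables (g0 : I -> R) (G : forall m, K m -> R).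
Arguments G : clear implicits.
Hypotheses (g00 : forall i, 0 <= g0 i) (G0 : forall m c, 0 <= G m c).
Variables (c : E -> E -> R) (phi : E -> R).
Hypothesis mc : measurable_fun setT (fun z : E * E => c z.1 z.2).
Hypothesis mphi : measurable_fun setT phi.
Hypothesis c0 : forall x y, 0 <= c x y.
Hypothesis phi0 : forall x, 0 <= phi x.
Hypothesis cost0 : forall x y, kap 0%N (key x) = kap 0%N (key y) ->
  c x y <= phi x + phi y + g0 (key x).
Variable n : nat.
Hypothesis costS : forall m x y, (m <= n)%N -> kap m.+1 (key x) = kap m.+1 (key y) ->
  c x y <= phi x + phi y + (G m (kap m (key x)) + G m (kap m (key y))).
Hypothesis trivial_top : forall i j, kap n.+1 i = kap n.+1 j.

Let cell m k := [set x | kap m (key x) = k].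

Lemma sum_key (m : probability E R) (Q : pred I) :
  \sum_(i | Q i) fine (m (key @^-1` [set i])) = fine (m [set x | Q (key x)]).
Proof.
transitivity (\int[m]_x \sum_(i <- [seq i <- index_enum I | Q i]) \1_(key @^-1` [set i]) x).
  rewrite bm_Rintegral_sum; last by move=> i; exact: bm_indic.
  by rewrite big_filter; apply: eq_bigr => i _; rewrite Rintegral_indicT.
have mQ : measurable [set x | Q (key x)].
  rewrite (_ : [set x | Q (key x)] = \bigcup_(i in [set i | Q i]) key @^-1` [set i]).
    by apply: fin_bigcup_measurable => [|i _]; [exact: finite_finset|exact: mkey].
  apply/seteqP; split => [x Qx|x [i Qi /= kx]]; first by exists (key x).
  by rewrite /= kx.
rewrite -Rintegral_indicT//; apply: eq_Rintegral => x _; rewrite big_filter.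
have -> : \1_[set x | Q (key x)] x = (Q (key x))%:R :> R.
  by rewrite indicE; congr (nat_of_bool _)%:R; apply/idP/idP; rewrite inE.
have e i : \1_(key @^-1` [set i]) x = (key x == i)%:R :> R.
  rewrite indicE; congr (nat_of_bool _)%:R; apply/idP/idP; rewrite inE /=; first by move/eqP.
  by move=> /eqP.
under eq_bigr do rewrite e.
have [Qx|nQx] := boolP (Q (key x)).
  rewrite (bigD1 (key x))//= eqxx big1 ?addr0// => i /andP[_ /negbTE ix].
  by rewrite eq_sym ix.
rewrite big1// => i Qi; case: eqP => // ix.
by move: nQx; rewrite ix Qi.
Qed.

(** The supremum [D i j] is the worst cost between two cells once [phi] is paid at both ends. The
    element 0 makes it nonnegative and covers empty cells; finiteness comes from the cost at the top
    of the tree. *)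
Let gaps i j := [set r : R | r = 0 \/ exists x y, [/\ key x = i, key y = j & r = c x y - phi x - phi y]].
Let D i j := sup (gaps i j).

Let S_ub i j (M : R) : 0 <= M ->
  (forall x y, key x = i -> key y = j -> c x y <= phi x + phi y + M) -> ubound (gaps i j) M.
Proof.
move=> M0 h r [->//|[x [y [xi yj ->]]]]; have := h x y xi yj; lra.
Qed.

Let D_le i j (M : R) : 0 <= M ->
  (forall x y, key x = i -> key y = j -> c x y <= phi x + phi y + M) -> D i j <= M.
Proof.
by move=> M0 h; apply: ge_sup; [exists 0; left|exact: S_ub].
Qed.

Let D_has_sup i j : has_sup (gaps i j).
Proof.
split; first by exists 0; left.
exists (G n (kap n i) + G n (kap n j)); apply: S_ub; first exact: addr_ge0.
by move=> x y <- <-; apply: (costS (leqnn n)); exact: trivial_top.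
Qed.

Let D_ge0 i j : 0 <= D i j.
Proof. by apply: ub_le_sup; [exact: (D_has_sup i j).2|left]. Qed.

Let D_cost x y : c x y <= phi x + phi y + D (key x) (key y).
Proof.
have : c x y - phi x - phi y <= D (key x) (key y).
  by apply: ub_le_sup; [exact: (D_has_sup _ _).2|right; exists x, y].
lra.
Qed.

(** The plan of [tree_transport] for the cell masses is glued into [pi]. Under [pi] the two terms in
    [phi] depend on one marginal each, and [D] of the two keys is a step function whose integral is
    the discrete cost. *)
Lemma multiscale_coupling : exists pi : probability (E * E)%type R,
  [/\ forall B, measurable B -> pi (B `*` setT) = nu B,
      forall B, measurable B -> pi (setT `*` B) = mu B &
  (\int[pi]_z (c z.1 z.2)%:E <= \int[nu]_x (phi x)%:E + \int[mu]_x (phi x)%:E +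
    (\sum_i fine (nu (key @^-1` [set i])) * g0 i +
     2 * \sum_(m < n.+1) \sum_(k : K m) G m k *
        `|fine (nu (cell k)) - fine (mu (cell k))|)%:E)%E].
Proof.
pose a i := fine (nu (key @^-1` [set i])); pose b i := fine (mu (key @^-1` [set i])).
have [|||||q [q0 qa qb qD]] := @tree_transport R I K kap nested a b D g0 G _ _ g00 G0 _ n.+1 _ trivial_top _.
- by move=> i; rewrite /a fine_ge0.
- by move=> i; rewrite /b fine_ge0.
- by move=> i j ij; apply: D_le => // x y xi yj; rewrite -xi; apply: cost0; rewrite xi yj.
- move=> m i j mn ij; apply: D_le; first exact: addr_ge0.
  by move=> x y xi yj; rewrite -xi -yj; apply: costS; rewrite ?xi ?yj.
- rewrite /a /b (sum_key nu xpredT) (sum_key mu xpredT).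
  by rewrite (_ : [set x | _] = setT) ?probability_setT//; apply/seteqP.
have [||pi [pi1 pi2 piq]] := @gluing _ E R nu mu I (fun i => key @^-1` [set i]) q mkey _ _ q0 qa qb.
- by move=> x; exists (key x).
- by move=> i j x /= <- <-.
exists pi; split => //.
pose step (z : E * E) := \sum_i \sum_j D i j * \1_((key @^-1` [set i]) `*` (key @^-1` [set j])) z.
have bstep : bm step.
  apply: bm_sum => i; apply: bm_sum => j; apply: bmM; first exact: bm_cst.
  by apply: bm_indic; exact: measurableX.
have stepE z : step z = D (key z.1) (key z.2).
  rewrite /step (bigD1 (key z.1))//= [X in _ + X]big1 ?addr0; last first.
    move=> i iz; rewrite big1// => j _; rewrite indicE (_ : _ \in _ = false) ?mulr0//.
    by apply/negbTE/negP; rewrite inE => -[/= h _]; move: iz; rewrite h eqxx.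
  rewrite (bigD1 (key z.2))//= [X in _ + X]big1 ?addr0; last first.
    move=> i iz; rewrite indicE (_ : _ \in _ = false) ?mulr0//.
    by apply/negbTE/negP; rewrite inE => -[/= _ h]; move: iz; rewrite h eqxx.
  by rewrite indicE (_ : _ \in _) ?mulr1// inE.
have mphi1 : measurable_fun setT (fun z : E * E => (phi z.1)%:E).
  by apply/measurable_EFinP; exact: measurableT_comp.
have mphi2 : measurable_fun setT (fun z : E * E => (phi z.2)%:E).
  by apply/measurable_EFinP; exact: measurableT_comp.
have mstep : measurable_fun setT (fun z : E * E => (step z)%:E).
  by apply/measurable_EFinP; case: bstep.
apply: (@le_trans _ _ (\int[pi]_z ((phi z.1)%:E + (phi z.2)%:E + (step z)%:E))%E).
  apply: ge0_le_integral => //.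
  - by move=> z _; rewrite lee_fin.
  - exact/measurable_EFinP.
  - by apply: emeasurable_funD => //; exact: emeasurable_funD.
  - by move=> z _; rewrite -!EFinD lee_fin stepE D_cost.
rewrite ge0_integralD//; last 3 first.
- by move=> z _; rewrite -EFinD lee_fin addr_ge0.
- exact: emeasurable_funD.
- by move=> z _; rewrite lee_fin stepE.
rewrite ge0_integralD//; try by move=> z _; rewrite lee_fin.
have law1 B : measurable B -> pi (fst @^-1` B) = nu B.
  by move=> mB; rewrite -pi1//; congr (pi _); apply/seteqP; split => -[x y] //= [].
have law2 B : measurable B -> pi (snd @^-1` B) = mu B.
  by move=> mB; rewrite -pi2//; congr (pi _); apply/seteqP; split => -[x y] //= [].
have mphiE : measurable_fun setT (fun x => (phi x)%:E) by exact/measurable_EFinP.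
have phiE0 x : (0 <= (phi x)%:E)%E by rewrite lee_fin.
have -> : (\int[pi]_z (phi z.1)%:E = \int[nu]_x (phi x)%:E)%E.
  exact: (ge0_integral_law measurable_fst law1 mphiE phiE0).
have -> : (\int[pi]_z (phi z.2)%:E = \int[mu]_x (phi x)%:E)%E.
  exact: (ge0_integral_law measurable_snd law2 mphiE phiE0).
rewrite leeD2l// bm_RintegralE// lee_fin.
rewrite bm_Rintegral_sum; last first.
  move=> i; apply: bm_sum => j; apply: bmM; first exact: bm_cst.
  by apply: bm_indic; exact: measurableX.
apply: le_trans (le_trans qD _).
  apply: ler_sum => i _; rewrite bm_Rintegral_sum; last first.
    by move=> j; apply: bmM; [exact: bm_cst|apply: bm_indic; exact: measurableX].
  apply: ler_sum => j _; rewrite bm_RintegralZl; last by apply: bm_indic; exact: measurableX.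
  have piE : fine (pi (key @^-1` [set i] `*` key @^-1` [set j])) = q i j by rewrite piq.
  by rewrite (Rintegral_indicT _ (measurableX (mkey i) (mkey j))) [fine _]piE mulrC.
rewrite lerD2l ler_wpM2l//; apply: ler_sum => m _; apply: ler_sum => k _.
have cellE (r : probability E R) :
    \sum_(i | kap m i == k) fine (r (key @^-1` [set i])) = fine (r (cell k)).
  rewrite (sum_key r (fun i => kap m i == k)); congr (fine (r _)).
  by apply/seteqP; split => x /= /eqP.
by rewrite -!cellE.
Qed.

End MultiscaleCoupling.

(** * Euclidean norm and dyadic shells *)

Section EuclideanNorm.
Context (R : realType) (d : nat).
Local Notation E := (Rd R d).
Implicit Types x y : 'rV[R]_d.

Lemma enorm_ge0 x : 0 <= enorm x.
Proof. exact: sqrtr_ge0. Qed.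

Lemma enorm_sqr x : enorm x ^+ 2 = \sum_(i < d) x ord0 i ^+ 2.
Proof. by rewrite sqr_sqrtr// sumr_ge0// => i _; exact: sqr_ge0. Qed.

Lemma coord_le_enorm x i : `|x ord0 i| <= enorm x.
Proof.
rewrite -(@ler_pXn2r _ 2) ?nnegrE ?enorm_ge0// real_normK ?num_real// enorm_sqr.
by rewrite (bigD1 i)//= lerDl sumr_ge0// => j _; exact: sqr_ge0.
Qed.

Lemma enorm_le_coords x (e : R) : 0 <= e -> (forall i, `|x ord0 i| <= e) ->
  enorm x <= d%:R * e.
Proof.
move=> e0 xe; rewrite -(@ler_pXn2r _ 2) ?nnegrE ?enorm_ge0 ?mulr_ge0// enorm_sqr.
apply: (@le_trans _ _ (\sum_(i < d) e ^+ 2)).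
  by apply: ler_sum => i _; rewrite -(real_normK (num_real (x ord0 i))) lerXn2r// nnegrE.
rewrite sumr_const card_ord -[leLHS]mulr_natl exprMn ler_wpM2r ?sqr_ge0//.
by rewrite -natrX ler_nat; case: d => // k; rewrite expnS expn1 leq_pmulr.
Qed.

(** Coordinatewise [(s - t)^2 <= 2 s^2 + 2 t^2], and the sum is at most four times the larger
    square. *)
Lemma enormB_le x y : enorm (x - y) <= 2 * Num.max (enorm x) (enorm y).
Proof.
have m0 : 0 <= Num.max (enorm x) (enorm y) by rewrite le_max enorm_ge0.
rewrite -(@ler_pXn2r _ 2) ?nnegrE ?enorm_ge0 ?mulr_ge0// enorm_sqr exprMn.
apply: (@le_trans _ _ (2 * enorm x ^+ 2 + 2 * enorm y ^+ 2)).
  rewrite !enorm_sqr !mulr_sumr -big_split/=; apply: ler_sum => i _; rewrite !mxE.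
  have := sqr_ge0 (x ord0 i + y ord0 i); rewrite sqrrB sqrrD; lra.
have hx : enorm x ^+ 2 <= Num.max (enorm x) (enorm y) ^+ 2.
  by rewrite lerXn2r ?nnegrE ?enorm_ge0// le_max lexx.
have hy : enorm y ^+ 2 <= Num.max (enorm x) (enorm y) ^+ 2.
  by rewrite lerXn2r ?nnegrE ?enorm_ge0// le_max lexx orbT.
rewrite (_ : 2 ^+ 2 = 4 :> R); [lra|by rewrite -natrX].
Qed.

Lemma enormB_powR_le (p : R) x y : 0 < p ->
  enorm (x - y) `^ p <= 2 `^ p * enorm x `^ p + 2 `^ p * enorm y `^ p.
Proof.
move=> p0; have := enormB_le x y; case: (leP (enorm x) (enorm y)) => h hB.
  apply: (@le_trans _ _ ((2 * enorm y) `^ p)).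
    by apply: (ge0_ler_powR (ltW p0)) => //; rewrite nnegrE ?enorm_ge0// mulr_ge0 ?enorm_ge0.
  by rewrite powRM ?enorm_ge0// lerDr mulr_ge0 ?powR_ge0.
apply: (@le_trans _ _ ((2 * enorm x) `^ p)).
  by apply: (ge0_ler_powR (ltW p0)) => //; rewrite nnegrE ?enorm_ge0// mulr_ge0 ?enorm_ge0.
by rewrite powRM ?enorm_ge0// lerDl mulr_ge0 ?powR_ge0.
Qed.

Lemma measurable_coord i : measurable_fun setT (fun x : E => (x : 'rV[R]_d) ord0 i).
Proof.
have cont : continuous (fun x : 'rV[R]_d => x ord0 i) by exact: coord_continuous.
apply: (measurability _ (RGenOpens.measurableE R)).
move=> _ [_ [a [b ->]] <-].
rewrite setTI; apply: sub_sigma_algebra.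
by apply: open_comp => // x _; exact: cont.
Qed.

Lemma measurable_sqrt : measurable_fun setT (@Num.sqrt R).
Proof. by apply: continuous_measurable_fun; exact: sqrt_continuous. Qed.

Lemma measurable_enorm_comp d' (T : measurableType d') (u : T -> 'rV[R]_d) :
  (forall i, measurable_fun setT (fun t => u t ord0 i)) ->
  measurable_fun setT (fun t => enorm (u t)).
Proof.
move=> mu; apply: (measurableT_comp measurable_sqrt).
by apply: measurable_sum => i; apply: measurable_funX.
Qed.

Lemma measurable_enorm : measurable_fun setT (fun x : E => enorm (x : 'rV[R]_d)).
Proof. by apply: measurable_enorm_comp => i; exact: measurable_coord. Qed.

Lemma measurable_enormB :
  measurable_fun setT (fun z : E * E => enorm ((z.1 : 'rV[R]_d) - z.2)).
Proof.
apply: measurable_enorm_comp => i.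
under eq_fun do rewrite !mxE.
apply: measurable_funB.
  exact: (measurableT_comp (measurable_coord i) measurable_fst).
exact: (measurableT_comp (measurable_coord i) measurable_snd).
Qed.

Lemma measurable_enorm_powR (p : R) :
  measurable_fun setT (fun x : E => enorm (x : 'rV[R]_d) `^ p).
Proof. exact: (measurableT_comp (measurable_powR p) measurable_enorm). Qed.

Lemma shell_exists x : exists n : nat, enorm x < 2 ^+ n.
Proof.
exists (Num.truncn (enorm x)).+1.
rewrite (lt_trans (truncnS_gt _))// -natrX ltr_nat.
exact: ltn_expl.
Qed.

Definition shell x : nat := ex_minn (shell_exists x).

Lemma shell_lt x : enorm x < 2 ^+ shell x.
Proof. by rewrite /shell; case: ex_minnP. Qed.

Lemma shell_le x n : (shell x <= n)%N = (enorm x < 2 ^+ n).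
Proof.
apply/idP/idP => h.
  by rewrite (lt_le_trans (shell_lt x))// ler_weXn2l// ler1n.
by rewrite /shell; case: ex_minnP => m _; apply.
Qed.

Lemma measurable_shell n : measurable [set x : E | shell x = n].
Proof.
have mle m : measurable [set x : E | (shell x <= m)%N].
  rewrite (_ : [set x : E | _] = (fun x : E => enorm (x : 'rV[R]_d)) @^-1` `]-oo, (2 ^+ m)[).
    by rewrite -[X in measurable X]setTI; apply: measurable_enorm => //; exact: measurable_itv.
  by apply/seteqP; split => x /=; rewrite in_itv/= shell_le.
case: n => [|n].
  rewrite (_ : [set x : E | _] = [set x : E | (shell x <= 0)%N])//.
  by apply/seteqP; split => x /=; rewrite leqn0 => /eqP.
rewrite (_ : [set x : E | _] = [set x : E | (shell x <= n.+1)%N] `\` [set x : E | (shell x <= n)%N]).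
  exact: measurableD.
apply/seteqP; split => x /=; first by move=> ->; split=> //; apply/negP; rewrite -ltnNge.
by move=> [h1 /negP]; rewrite -ltnNge => h2; apply/eqP; rewrite eqn_leq h1.
Qed.

End EuclideanNorm.

(** * Dyadic cells and the cost of moving between them *)

Section Cells.
Context (R : realType) (d : nat) (p : R) (N L : nat).
Hypothesis d0 : (0 < d)%N.
Hypothesis p0 : 0 < p.
Local Notation E := (Rd R d).
Implicit Types x y : 'rV[R]_d.

(* ['I_(2 ^ l.+1)] is written with an explicit successor so that [inord] applies;
   [None] stands for the region outside the shells [0], ..., [N]. *)
Local Notation cell_code l := ('I_N.+1 * {ffun 'I_d -> 'I_(2 ^ l.+1).-1.+1})%type.
Local Notation cell_index l := (option (cell_code l)).

(** The cube []-2^n, 2^n[^d] around shell [n] goes coordinatewise into [[0, 2^(L+1)[], so that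
    integer parts number the cubes of side [2^n / 2^L]. *)
Definition rescaled x (i : 'I_d) : R := 2 ^+ L * (x ord0 i / 2 ^+ shell x + 1).

Definition cell_key x : cell_index L :=
  if (shell x <= N)%N then
    Some (inord (shell x), [ffun i => inord (Num.truncn (rescaled x i))])
  else None.

(** Each generation halves the indices. At [m = L] a shell still has two indices per coordinate;
    past [L] everything, the outer region included, becomes [None], the root of the tree. *)
Definition coarsen (m : nat) (k : cell_index L) : cell_index (L - m) :=
  match k with
  | Some (n, g) => if (m <= L)%N then Some (n, [ffun i => inord (g i %/ 2 ^ m)]) else None
  | None => None
  end.

(** Mass left over at level [m] moves inside the parent cell, of side [2^n 2^(m+1) / 2^L], and [d]
    times the side bounds the diameter. For [m = L] the parent is the whole space, and the same
    formula dominates [(2 |x|)^p]. The outer region is paid for by [outer_cost]. *)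
Definition coarse_cost (m : nat) (k : cell_index (L - m)) : R :=
  if k is Some c then (d%:R * (2 ^+ c.1 * (2 ^+ m.+1 / 2 ^+ L))) `^ p else 0.

Definition fine_cost (k : cell_index L) : R :=
  if k is Some c then (d%:R * (2 ^+ c.1 * (2 ^+ 0 / 2 ^+ L))) `^ p else 0.

Definition outer_cost x : R := 2 `^ p * enorm x `^ p * (N < shell x)%N%:R.

Lemma pow2_gt0 n : 0 < 2 ^+ n :> R. Proof. exact: exprn_gt0. Qed.

Lemma size_idx l : ((2 ^ l.+1).-1.+1 = 2 ^ l.+1)%N.
Proof. by rewrite prednK// expn_gt0. Qed.

Lemma ltn_idx l (i : 'I_(2 ^ l.+1).-1.+1) : (i < 2 ^ l.+1)%N.
Proof. by have := ltn_ord i; rewrite [X in (_ < X)%N]size_idx. Qed.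

Lemma divn_idx_lt m n : (m <= L)%N -> (n < 2 ^ L.+1)%N ->
  (n %/ 2 ^ m < (2 ^ (L - m).+1).-1.+1)%N.
Proof.
by move=> mL nL; rewrite size_idx ltn_divLR ?expn_gt0// -expnD addSn subnK.
Qed.

Lemma rescaled_bounds x i : 0 <= rescaled x i < 2 ^+ L.+1.
Proof.
have p2 := pow2_gt0 (shell x).
have h : `|x ord0 i| < 2 ^+ shell x by rewrite (le_lt_trans (coord_le_enorm x i))// shell_lt.
have : `|x ord0 i / 2 ^+ shell x| < 1.
  by rewrite normrM normfV [`|2 ^+ _|]gtr0_norm// ltr_pdivrMr// mul1r.
rewrite ltr_norml => /andP[h1 h2]; rewrite /rescaled; apply/andP; split.
  by rewrite mulr_ge0 ?exprn_ge0// -lerBlDr sub0r ltW.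
by rewrite exprSr ltr_pM2l ?pow2_gt0// -[X in _ < X]/(1 + 1) ltrD2r.
Qed.

Lemma truncn_rescaled x i :
  (Num.truncn (rescaled x i))%:R <= rescaled x i < (Num.truncn (rescaled x i)).+1%:R.
Proof.
have /andP[h _] := rescaled_bounds x i.
by rewrite truncnS_gt truncn_le h.
Qed.

Lemma truncn_rescaled_lt x i : (Num.truncn (rescaled x i) < 2 ^ L.+1)%N.
Proof.
rewrite -(ltr_nat R) natrX; have /andP[_ h] := rescaled_bounds x i.
by apply: le_lt_trans h; have /andP[] := truncn_rescaled x i.
Qed.

Lemma cell_key_Some x (n : 'I_N.+1) (g : {ffun 'I_d -> 'I_(2 ^ L.+1).-1.+1}) :
  cell_key x = Some (n, g) <->
  shell x = n /\ forall i, Num.truncn (rescaled x i) = g i.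
Proof.
split.
  rewrite /cell_key; case: ifPn => // sN [<- <-]; split; first by rewrite inordK.
  by move=> i; rewrite ffunE inordK// size_idx truncn_rescaled_lt.
move=> [sx gx]; rewrite /cell_key sx -ltnS ltn_ord; congr (Some (_, _)).
  by apply: val_inj; rewrite /= inordK.
by apply/ffunP => i; rewrite ffunE gx; apply: val_inj; rewrite /= inordK.
Qed.

Lemma cell_key_None x : cell_key x = None <-> (N < shell x)%N.
Proof. by rewrite /cell_key; case: leqP. Qed.

Lemma measurable_cell_key (k : cell_index L) :
  measurable ((cell_key : E -> _) @^-1` [set k]).
Proof.
case: k => [[n g]|].
  pose u (i : 'I_d) (x : E) : R := 2 ^+ L * ((x : 'rV[R]_d) ord0 i / 2 ^+ n + 1).
  have mu i : measurable_fun setT (u i).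
    apply: measurable_funM => //; apply: measurable_funD => //.
    by apply: measurable_funM => //; exact: measurable_coord.
  rewrite (_ : _ @^-1` _ = [set x : E | shell (x : 'rV[R]_d) = n] `&`
    \bigcap_(i in setT) (u i @^-1` `[(g i)%:R, (g i).+1%:R[)).
    apply: measurableI; first exact: measurable_shell.
    apply: fin_bigcap_measurable => // i _.
    by rewrite -[X in measurable X]setTI; apply: mu => //; exact: measurable_itv.
  apply/seteqP; split => x /=.
    move=> /cell_key_Some[sx gx]; split => // i _ /=.
    have := truncn_rescaled x i; rewrite gx /rescaled sx => /andP[h1 h2].
    by rewrite in_itv/= h1.
  move=> [sx gx]; apply/cell_key_Some; split => // i.
  have := gx i Logic.I; rewrite /= in_itv/= => /andP[h1 h2].
  have /andP[h3 h4] := truncn_rescaled x i.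
  have uE : rescaled x i = u i x by rewrite /rescaled sx.
  rewrite -uE in h1 h2.
  have := le_lt_trans h1 h4; have := le_lt_trans h3 h2; rewrite !ltr_nat !ltnS => a1 a2.
  by apply/eqP; rewrite eqn_leq a1 a2.
rewrite (_ : _ @^-1` _ = ~` [set x : E | enorm (x : 'rV[R]_d) < 2 ^+ N]).
  apply: measurableC; rewrite (_ : [set _ | _] = (fun x : E => enorm (x : 'rV[R]_d)) @^-1` `]-oo, (2 ^+ N)[).
    by rewrite -[X in measurable X]setTI; apply: measurable_enorm => //; exact: measurable_itv.
  by apply/seteqP; split => x /=; rewrite in_itv.
apply/seteqP; split => x /=.
  by move=> /cell_key_None; rewrite ltnNge shell_le => /negP.
by move=> h; apply/cell_key_None; rewrite ltnNge shell_le; exact/negP.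
Qed.

Lemma coarsen_nested m (k k' : cell_index L) :
  coarsen m k = coarsen m k' -> coarsen m.+1 k = coarsen m.+1 k'.
Proof.
case: k => [[n g]|]; case: k' => [[n' g']|] //=; case: (ltnP m L) => // mL; rewrite (ltnW mL)//.
move=> [-> gg]; congr (Some (_, _)).
apply/ffunP => i; rewrite !ffunE.
have := congr1 (fun h : {ffun 'I_d -> _} => val (h i)) gg; rewrite /= !ffunE.
have small (h : {ffun 'I_d -> 'I_(2 ^ L.+1).-1.+1}) : (h i %/ 2 ^ m < (2 ^ (L - m).+1).-1.+1)%N.
  exact: divn_idx_lt (ltnW mL) (ltn_idx _).
rewrite !inordK ?small// => e.
suff -> : (g i %/ 2 ^ m.+1 = g' i %/ 2 ^ m.+1)%N by [].
by rewrite [(2 ^ m.+1)%N]expnSr !divnMA e.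
Qed.

Lemma ltn_divn_eq (a b c : nat) : (0 < c)%N -> (a %/ c = b %/ c)%N -> (a < b + c)%N.
Proof.
move=> c0 e; rewrite [X in (X < _)%N](divn_eq a c) e.
by rewrite -addnS leq_add ?leq_divM// ltn_mod.
Qed.

Lemma rescaled_dist m x y i : shell x = shell y ->
  (Num.truncn (rescaled x i) %/ 2 ^ m = Num.truncn (rescaled y i) %/ 2 ^ m)%N ->
  `|x ord0 i - y ord0 i| <= 2 ^+ shell x * (2 ^+ m / 2 ^+ L).
Proof.
move=> sxy e.
have m0 : (0 < 2 ^ m)%N by rewrite expn_gt0.
have := ltn_divn_eq m0 e; have := ltn_divn_eq m0 (esym e).
have /andP[x1 x2] := truncn_rescaled x i; have /andP[y1 y2] := truncn_rescaled y i.
rewrite -!(ler_nat R) !natrD natrX => h1 h2.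
have hs : `|rescaled x i - rescaled y i| <= 2 ^+ m.
  move: x1 x2 y1 y2 h1 h2; set u := rescaled x i; set v := rescaled y i; set w := 2 ^+ m.
  by move=> *; rewrite ler_norml; apply/andP; split; lra.
have e1 : rescaled x i - rescaled y i = (2 ^+ L / 2 ^+ shell x) * (x ord0 i - y ord0 i).
  by rewrite /rescaled sxy; ring.
have c0 : 0 < 2 ^+ L / 2 ^+ shell x :> R by rewrite divr_gt0 ?pow2_gt0.
rewrite -(ler_pM2l c0) -[X in X * `|_|]gtr0_norm// -normrM -e1 (le_trans hs)//.
have cancel (a b c : R) : 0 < a -> 0 < b -> a / b * (b * (c / a)) = c.
  by move=> /gt_eqF a0 /gt_eqF b0; field; rewrite a0 b0.
by rewrite cancel ?pow2_gt0.
Qed.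

Lemma coarsen_dist m x y : (m <= L)%N ->
  coarsen m (cell_key x) = coarsen m (cell_key y) ->
  ((N < shell x)%N /\ (N < shell y)%N) \/
  exists2 c, coarsen m (cell_key x) = Some c &
    enorm (x - y) <= d%:R * (2 ^+ c.1 * (2 ^+ m / 2 ^+ L)).
Proof.
move=> mL.
have [sx|sx] := leqP (shell x) N; have [sy|sy] := leqP (shell y) N; last by left.
- rewrite /cell_key sx sy /= mL => -[exy gxy]; right.
  eexists; first by reflexivity.
  rewrite /= in exy *.
  have sxy : shell x = shell y.
    by have := congr1 val exy; rewrite /= !inordK.
  apply: enorm_le_coords; first by rewrite !mulr_ge0 ?invr_ge0 ?exprn_ge0.
  move=> i; rewrite !mxE inordK//; apply: rescaled_dist => //.
  have := congr1 (fun h : {ffun 'I_d -> _} => val (h i)) gxy; rewrite /= !ffunE.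
  by rewrite !inordK ?divn_idx_lt ?size_idx ?truncn_rescaled_lt.
- by rewrite /cell_key sx leqNgt sy /= mL.
- by rewrite /cell_key sy leqNgt sx /= mL.
Qed.

Lemma outer_cost_ge0 x : 0 <= outer_cost x.
Proof. by rewrite /outer_cost !mulr_ge0 ?powR_ge0. Qed.

Lemma coarse_cost_ge0 m k : 0 <= @coarse_cost m k.
Proof. by rewrite /coarse_cost; case: k => // c; exact: powR_ge0. Qed.

Lemma fine_cost_ge0 k : 0 <= fine_cost k.
Proof. by rewrite /fine_cost; case: k => // c; exact: powR_ge0. Qed.

Lemma measurable_outer_cost : measurable_fun setT (outer_cost : E -> R).
Proof.
apply: measurable_funM.
  by apply: measurable_funM => //; exact: measurable_enorm_powR.
have mA : measurable [set x : E | (N < shell (x : 'rV[R]_d))%N].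
  rewrite (_ : [set _ | _] = (cell_key : E -> _) @^-1` [set None]); first exact: measurable_cell_key.
  by apply/seteqP; split => x /= /cell_key_None.
rewrite (_ : (fun _ => _) = \1_[set x : E | (N < shell (x : 'rV[R]_d))%N]); first exact: measurable_indic.
by apply/funext => x; rewrite indicE; congr (nat_of_bool _)%:R; apply/idP/idP; rewrite inE.
Qed.

Lemma cost_within m x y : (m <= L)%N ->
  coarsen m (cell_key x) = coarsen m (cell_key y) ->
  enorm (x - y) `^ p <= outer_cost x + outer_cost y +
    (if coarsen m (cell_key x) is Some c then (d%:R * (2 ^+ c.1 * (2 ^+ m / 2 ^+ L))) `^ p else 0).
Proof.
move=> mL /(coarsen_dist mL)[[sx sy]|[c -> h]].
  rewrite /outer_cost sx sy !mulr1 (le_trans (enormB_powR_le x y p0))// lerDl.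
  by case: (coarsen _ _) => // c; exact: powR_ge0.
apply: (@le_trans _ _ ((d%:R * (2 ^+ c.1 * (2 ^+ m / 2 ^+ L))) `^ p)).
  by apply: (ge0_ler_powR (ltW p0)) => //; rewrite nnegrE ?enorm_ge0.
by rewrite lerDr addr_ge0 ?outer_cost_ge0.
Qed.

(** At the root two points may lie anywhere, and each pays for its own distance to the origin: by
    [outer_cost] beyond the shells, by the top [coarse_cost] within them. *)
Lemma cost_top x : 2 `^ p * enorm x `^ p <=
  outer_cost x + coarse_cost (coarsen L (cell_key x)).
Proof.
have [sx|sx] := leqP (shell x) N; last first.
  by rewrite /outer_cost sx mulr1 lerDl coarse_cost_ge0.
rewrite ler_wpDl ?outer_cost_ge0// /cell_key sx/= leqnn/= inordK ?ltnS//.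
rewrite -powRM ?enorm_ge0//; apply: (ge0_ler_powR (ltW p0)).
- by rewrite nnegrE mulr_ge0 ?enorm_ge0.
- by rewrite nnegrE !mulr_ge0 ?invr_ge0 ?exprn_ge0.
rewrite exprSr mulrAC divff ?gt_eqF ?pow2_gt0// mul1r.
rewrite (@le_trans _ _ (2 ^+ shell x * 2))//.
  by rewrite mulrC ler_pM2r// ltW// shell_lt.
by rewrite -[leLHS]mul1r ler_wpM2r ?ler1n// mulr_ge0 ?exprn_ge0.
Qed.

Lemma cost_levels m x y : (m <= L)%N ->
  coarsen m.+1 (cell_key x) = coarsen m.+1 (cell_key y) ->
  enorm (x - y) `^ p <= outer_cost x + outer_cost y +
    (coarse_cost (coarsen m (cell_key x)) + coarse_cost (coarsen m (cell_key y))).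
Proof.
rewrite leq_eqVlt => /orP[/eqP mL _|mL].
  rewrite mL.
  have h1 := cost_top x; have h2 := cost_top y; have h3 := enormB_powR_le x y p0.
  by apply: (le_trans h3); rewrite addrACA lerD.
move=> /(cost_within mL) h; apply: (le_trans h); rewrite lerD2l.
rewrite -[leLHS]addr0 lerD ?coarse_cost_ge0//.
by case: (cell_key x) => [[n g]|] //=; rewrite mL (ltnW mL).
Qed.

Lemma cost_finest x y : coarsen 0 (cell_key x) = coarsen 0 (cell_key y) ->
  enorm (x - y) `^ p <= outer_cost x + outer_cost y + fine_cost (cell_key x).
Proof.
move=> /(cost_within (leq0n L)) h; apply: (le_trans h); rewrite lerD2l.
by case: (cell_key x) => [[n g]|].
Qed.

Definition cell m (k : cell_index (L - m)) : set E :=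
  [set x : E | coarsen m (cell_key (x : 'rV[R]_d)) = k].

(** [empirical] is a bare set function, hence the separate [nu0], which agrees with a probability on
    measurable sets. *)
Lemma Tcost_le (nu mu : probability E R) (nu0 : set E -> \bar R) :
  (forall A, measurable A -> nu0 A = nu A) ->
  (Tcost p nu0 mu <= \int[nu]_x (outer_cost (x : 'rV[R]_d))%:E +
     \int[mu]_x (outer_cost (x : 'rV[R]_d))%:E +
    (\sum_k fine (nu ((cell_key : E -> _) @^-1` [set k])) * fine_cost k +
     2 * \sum_(m < L.+1) \sum_(k : cell_index (L - m)) coarse_cost k *
        `|fine (nu (cell k)) - fine (mu (cell k))|)%:E)%E.
Proof.
move=> nu0E.
have triv (i j : cell_index L) : coarsen L.+1 i = coarsen L.+1 j.
  by case: i => [[n g]|]; case: j => [[n' g']|]; rewrite /= ?ltnn.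
have [pi [pi1 pi2 cost]] := @multiscale_coupling _ E R nu mu (cell_index L)
  (cell_key : E -> _) measurable_cell_key (fun m => cell_index (L - m)) coarsen coarsen_nested fine_cost coarse_cost
  fine_cost_ge0 coarse_cost_ge0 (fun x y : E => enorm ((x : 'rV[R]_d) - y) `^ p)
  (outer_cost : E -> R)
  (measurableT_comp (measurable_powR p) (@measurable_enormB R d)) measurable_outer_cost
  (fun x y => powR_ge0 _ _) outer_cost_ge0 cost_finest L cost_levels triv.
apply: le_trans cost; apply: ereal_inf_lbound; exists pi => //; split.
  by move=> A mA; rewrite pi1// nu0E.
by move=> A mA; rewrite pi2.
Qed.

End Cells.

(** * The empirical measure and its fluctuation on a fixed set *)

Lemma probability_of_measure d (T : measurableType d) (R : realType)
    (m : {measure set T -> \bar R}) : m setT = 1%E ->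
  exists P : probability T R, forall A, measurable A -> P A = m A.
Proof.
move=> mT; have m1 : (\int[m]_x (1 : R)%:E = 1)%E.
  by rewrite integral_cst//; rewrite [X in (_ * X)%E]mT mule1.
exists [the probability _ _ of
  density_measure (measurable_cst (1 : R)) (fun _ : T => ler01) m1] => A mA.
by transitivity (\int[m]_(x in A) (1 : R)%:E)%E; last by rewrite integral_cst// mul1e.
Qed.

Lemma time_window (R : realType) (T S : R) (h : R -> R) : T <= S -> bm h ->
  \int[time_measure S]_s (h s * \1_`[0, T] s) = \int[time_measure T]_s h s.
Proof.
move=> TS; have bi : bm (\1_`[0, T] : R -> R) by apply: bm_indic; exact: measurable_itv.
move: h; apply: bm_functional_ext.
- by apply: (@bm_functional_int _ R _ R _ _ id).
- have := @bm_functional_int _ R _ R R (time_measure T) id (fun=> 1) (@measurable_id _ _ _) (bm_cst _ 1).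
  by congr bm_functional; apply/funext => f; apply: eq_Rintegral => s _; rewrite mulr1.
move=> A mA.
transitivity (\int[time_measure S]_s \1_(A `&` `[0, T]%classic) s).
  by apply: eq_Rintegral => s _; rewrite indicI.
rewrite !Rintegral_indicT//; last by apply: measurableI => //; exact: measurable_itv.
have timeE V (B : set R) : (time_measure V : {finite_measure set R -> \bar R}) B =
  lebesgue_measure (B `&` `[0, V]%classic) by [].
rewrite !timeE -setIA (_ : `[0, T]%classic `&` `[0, S]%classic = `[0, T]%classic)//.
apply/seteqP; split => x /=; first by case.
by rewrite !in_itv/= => /andP[h1 h2]; rewrite h1 h2 (le_trans h2).
Qed.

Lemma sqr_Rintegral_norm_le d (T : measurableType d) (R : realType) (P : probability T R)
  (g : T -> R) : bm g -> (\int[P]_x `|g x|) ^+ 2 <= \int[P]_x (g x ^+ 2).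
Proof.
move=> bg; set e := \int[P]_x `|g x|; have bn := bm_norm bg.
have : 0 <= \int[P]_x ((`|g x| - e) ^+ 2) by apply: Rintegral_ge0 => x _; exact: sqr_ge0.
rewrite (_ : \int[P]_x _ = \int[P]_x (g x ^+ 2 - (2 * e) * `|g x| + e ^+ 2)); last first.
  apply: eq_Rintegral => x _; rewrite -(real_normK (num_real (g x))) sqrrB; ring.
have b2 := bmX 2 bg; have bc : bm (fun x => (2 * e) * `|g x|) by apply: bmM => //; exact: bm_cst.
rewrite bm_RintegralD; [|exact: bmB|exact: bm_cst].
rewrite bm_RintegralB// bm_RintegralZl// prob_Rintegral_cst -/e.
by rewrite -subr_ge0; congr (0 <= _); ring.
Qed.

Section Empirical.
Context (R : realType) (d : nat) (mu : probability (Rd R d) R)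
  (k : R -> R.-pker (Rd R d) ~> (Rd R d))
  (dO : measure_display) (O : measurableType dO) (P : probability O R)
  (X : R -> O -> Rd R d).
Hypothesis markovX : is_markov_process P X k.
Hypothesis lawX0 : forall A : set (Rd R d), measurable A -> P (X 0 @^-1` A) = mu A.
Hypothesis invk : mu_invariant mu k.
Local Notation E := (Rd R d).
Variable T : R.
Hypothesis T0 : 0 < T.
Local Notation tau := (time_measure T).

Let max0 (s : R) : 0 <= Num.max 0 s. Proof. by rewrite le_max lexx. Qed.

Let Tinv0 : 0 <= T^-1. Proof. by rewrite invr_ge0 ltW. Qed.

Let tauT : tau setT = T%:E.
Proof.
rewrite -[LHS]fineK ?time_measureT ?ltW//.
exact: fin_num_measure.
Qed.

Lemma measurable_trajectory w : measurable_fun setT (fun s : R => X (Num.max 0 s) w).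
Proof. exact: (measurableT_comp (measurable_process markovX) (pair2_measurable w)). Qed.

(** The image of normalized Lebesgue measure on [[0, T]] under the trajectory. *)
Lemma empirical_probability w : exists nu : probability E R,
  (forall A, measurable A -> empirical X T w A = nu A) /\
  (forall phi : E -> R, measurable_fun setT phi -> (forall x, 0 <= phi x) ->
    (\int[nu]_x (phi x)%:E = T^-1%:E * \int[tau]_s (phi (X (Num.max 0 s) w))%:E)%E).
Proof.
have mY := measurable_trajectory w.
pose m := mscale (NngNum Tinv0) tau.
have mT : m setT = 1%E.
  by rewrite /m /mscale/= tauT -EFinM mulVf// gt_eqF.
pose Y s := X (Num.max 0 s) w.
have [nu0 nu0E] : exists nu0 : {measure set E -> \bar R}, forall A, nu0 A = m (Y @^-1` A).
  by unshelve eexists [the {measure set _ -> \bar R} of pushforward m Y].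
have nu0T : nu0 setT = 1%E by rewrite nu0E preimage_setT.
have [nu nuE] := probability_of_measure nu0T.
have mYA A : measurable A -> measurable (Y @^-1` A).
  by move=> mA; rewrite -[X in measurable X]setTI; exact: mY.
exists nu; split.
  move=> A mA; rewrite nuE// nu0E /m /mscale/= /empirical; congr (_ * _)%E.
  have dE : [set t : R | (0 <= t <= T)%R] = `[0, T]%classic.
    by apply/seteqP; split => t; rewrite /= in_itv.
  rewrite dE time_measureE.
  transitivity (\int[lebesgue_measure]_(t in `[0%R, T]%classic) (\1_(Y @^-1` A) t)%:E)%E.
    apply: eq_integral => t; rewrite inE/= in_itv/= => /andP[t0 _]; congr EFin.
    by rewrite !indicE; congr (nat_of_bool _)%:R; apply/idP/idP; rewrite !inE/= /Y (max_idPr t0).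
  by rewrite integral_indic//; exact: mYA.
move=> phi mphi phi0.
transitivity (\int[m]_s (phi (Y s))%:E)%E.
  apply/esym/(ge0_integral_law (u := Y) (f := fun x => (phi x)%:E) mY).
  - by move=> B mB; exact: esym (etrans (nuE B mB) (nu0E B)).
  - exact/measurable_EFinP.
  - by move=> x; rewrite lee_fin.
rewrite ge0_integral_mscale//.
  by apply/measurable_EFinP; exact: measurableT_comp mphi mY.
by move=> s _; rewrite lee_fin.
Qed.

Definition occupation (F : set E) (w : O) : R := T^-1 * \int[tau]_s \1_F (X (Num.max 0 s) w).

Lemma bm_occupation F : measurable F -> bm (occupation F).
Proof.
move=> mF; apply: bmM; first exact: bm_cst.
have := bm_Rintegral1 tau P (bm_path2 (X := X) (f := \1_F) markovX (bm_indic R mF)).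
by apply.
Qed.

Lemma occupation_ge0 F w : 0 <= occupation F w.
Proof. by rewrite mulr_ge0//; apply: Rintegral_ge0 => s _. Qed.

Lemma occupationE w (nu : probability E R) F : measurable F ->
  (forall phi : E -> R, measurable_fun setT phi -> (forall x, 0 <= phi x) ->
    (\int[nu]_x (phi x)%:E = T^-1%:E * \int[tau]_s (phi (X (Num.max 0 s) w))%:E)%E) ->
  fine (nu F) = occupation F w.
Proof.
move=> mF nuE; rewrite -Rintegral_indicT//.
rewrite /Rintegral nuE//.
have bp := bm_path_time (X := X) (f := \1_F) markovX (bm_indic R mF) w.
by rewrite (bm_RintegralE tau bp) -EFinM.
Qed.

Lemma occupation_mean F : measurable F -> \int[P]_w occupation F w = fine (mu F).
Proof.
move=> mF; have b2 := bm_path2 (X := X) (f := \1_F) markovX (bm_indic R mF).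
rewrite /occupation bm_RintegralZl; last exact: (bm_Rintegral1 tau P b2).
rewrite -(bm_Fubini tau P b2).
under eq_Rintegral => s _.
  rewrite /= (stationary_bm markovX lawX0 invk (max0 s) (bm_indic R mF)) Rintegral_indicT//.
  over.
rewrite RintegralT_cst time_measureT ?ltW// mulrCA mulVf ?gt_eqF//.
by rewrite mulr1.
Qed.

(** The measures [nu w] are chosen one [w] at a time, so measurability in [w] has to come from the
    formula for their integrals, by Tonelli. *)
Lemma empirical_mean (nu : O -> probability E R) (phi : E -> R) :
  measurable_fun setT phi -> (forall x, 0 <= phi x) ->
  (\int[mu]_x (phi x)%:E < +oo)%E ->
  (forall w, (\int[nu w]_x (phi x)%:E = T^-1%:E * \int[tau]_s (phi (X (Num.max 0 s) w))%:E)%E) ->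
  measurable_fun setT (fun w => \int[nu w]_x (phi x)%:E)%E /\
  (\int[P]_w \int[nu w]_x (phi x)%:E = \int[mu]_x (phi x)%:E)%E.
Proof.
move=> mphi phi0 fin nuE.
pose h (z : R * O) := (phi (X (Num.max 0 z.1) z.2))%:E.
have mh : measurable_fun setT h.
  by apply/measurable_EFinP; exact: (measurableT_comp mphi (measurable_process markovX)).
have h0 z : (0 <= h z)%E by rewrite lee_fin.
have eqI : (fun w => \int[nu w]_x (phi x)%:E)%E = (fun w => T^-1%:E * \int[tau]_s h (s, w))%E.
  by apply/funext => w; rewrite nuE.
have mI : measurable_fun setT (fun w => \int[tau]_s h (s, w))%E.
  exact: (@measurable_fun_fubini_tonelli_G _ _ _ _ R tau h mh h0).
rewrite eqI; split; first exact: measurable_funeM.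
rewrite ge0_integralZl//; last first.
  by move=> w _; apply: integral_ge0 => s _.
rewrite -(@fubini_tonelli _ _ _ _ _ tau P h mh h0).
under eq_integral => s _.
  rewrite (ge0_integral_law (u := X (Num.max 0 s)) (f := fun x => (phi x)%:E)
    (measurable_X markovX (max0 s)) (lawX markovX lawX0 invk (max0 s))); first over.
  exact/measurable_EFinP.
  by move=> x; rewrite lee_fin.
have /fineK <- : (\int[mu]_x (phi x)%:E)%E \is a fin_num.
  by rewrite ge0_fin_numE//; apply: integral_ge0 => x _; rewrite lee_fin.
by rewrite integral_cst// [X in (_ * (_ * X))%E]tauT -!EFinM mulrCA mulVf ?mulr1// gt_eqF.
Qed.

Variable lam : R.
Hypothesis lam0 : 0 < lam.
Hypothesis poincare : forall f g : E -> R, L2_generator mu k f g ->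
  (\int[mu]_x (f x)%:E = 0)%E ->
  (lam%:E * Lnorm mu 2%:E (EFin \o f) <= Lnorm mu 2%:E (EFin \o g))%E.

(** The variance of the indicator is at most [mu F]. Keeping this factor makes the bounds of the
    cells of a shell add up to the mass of the shell. *)
Lemma occupation_variance F : measurable F ->
  \int[P]_w ((occupation F w - fine (mu F)) ^+ 2) <= 2 * (2 / lam + 2) * fine (mu F) / T.
Proof.
move=> mF; set m := fine (mu F).
have m0 : 0 <= m by rewrite fine_ge0.
have m1 : m <= 1.
  by rewrite -lee_fin fineK ?probability_le1// fin_num_measure.
have bF : bm (\1_F : E -> R) by exact: bm_indic.
pose f x : R := \1_F x - m.
have bf : bm f by apply: bmB => //; exact: bm_cst.
have fc : \int[mu]_x f x = 0.
  rewrite bm_RintegralB//; last exact: bm_cst.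
  by rewrite prob_Rintegral_cst Rintegral_indicT// subrr.
have vm : \int[mu]_x (f x ^+ 2) <= m.
  rewrite (_ : \int[mu]_x _ = \int[mu]_x ((1 - 2 * m) * \1_F x + m ^+ 2)); last first.
    apply: eq_Rintegral => x _; rewrite /f indicE; case: (_ \in _) => /=; ring.
  rewrite bm_RintegralD; [|by apply: bmM => //; exact: bm_cst|exact: bm_cst].
  rewrite bm_RintegralZl// prob_Rintegral_cst Rintegral_indicT// -/m.
  by rewrite (_ : _ + _ = m - m ^+ 2); [rewrite gerBl sqr_ge0|ring].
have := weighted_variance markovX lawX0 invk lam0 poincare bf fc (ltW T0).
(* The variance bound lives on the horizon [T + 2]; the indicator weight cuts it back to
   [[0, T]]. *)
have wE w : weighted X f (T + 2) (\1_`[0, T]) w = T * (occupation F w - m).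
  have bp := bm_path_time (X := X) (f := \1_F) markovX bF w.
  rewrite /weighted; under eq_Rintegral do rewrite mulrC.
  rewrite time_window ?lerDl//; last exact: (bm_path_time markovX bf).
  rewrite /path/f bm_RintegralB//; last exact: bm_cst.
  rewrite RintegralT_cst time_measureT ?ltW// /occupation mulrBr mulrA divff ?gt_eqF//.
  by rewrite mul1r [m * T]mulrC.
under eq_Rintegral do rewrite wE exprMn.
have bo : bm (fun w => (occupation F w - m) ^+ 2).
  by apply: bmX; apply: bmB; [exact: bm_occupation|exact: bm_cst].
rewrite bm_RintegralZl// => h.
rewrite -(ler_pM2l (exprn_gt0 2 T0)) (le_trans h)//.
rewrite (_ : T ^+ 2 * _ = 2 * T * ((2 / lam + 2) * m)); last by field; rewrite !gt_eqF.
have l0 : 0 <= 2 / lam + 2 by rewrite addr_ge0// divr_ge0// ltW.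
by rewrite ler_wpM2l ?mulr_ge0 ?(ltW T0)// ler_wpM2l.
Qed.

Definition occupation_error (F : set E) : R := \int[P]_w `|occupation F w - fine (mu F)|.

Lemma occupation_error_ge0 F : 0 <= occupation_error F.
Proof. by apply: Rintegral_ge0 => w _. Qed.

Lemma occupation_error_le F : measurable F -> occupation_error F <= 2 * fine (mu F).
Proof.
move=> mF; have bo := bm_occupation mF; have m0 : 0 <= fine (mu F) by rewrite fine_ge0.
apply: (@le_trans _ _ (\int[P]_w (occupation F w + fine (mu F)))).
  apply: bm_le_Rintegral.
  - by apply: bm_norm; apply: bmB => //; exact: bm_cst.
  - by apply: bmD => //; exact: bm_cst.
  - move=> w; rewrite (le_trans (ler_normB _ _))// !ger0_norm//; exact: occupation_ge0.
rewrite bm_RintegralD//; last exact: bm_cst.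
by rewrite occupation_mean// prob_Rintegral_cst mulr_natl mulr2n.
Qed.

Lemma occupation_error_sqr F : measurable F ->
  occupation_error F ^+ 2 <= 2 * (2 / lam + 2) * fine (mu F) / T.
Proof.
move=> mF; rewrite (le_trans _ (occupation_variance mF))//.
apply: sqr_Rintegral_norm_le; apply: bmB; [exact: bm_occupation|exact: bm_cst].
Qed.

End Empirical.

(** The integral of a nonnegative function is a supremum over simple functions below it, hence
    monotone without measurability. The transport cost is an infimum over couplings, and its
    measurability in [w] is not established. *)
Lemma ge0_le_integral_any d (T : measurableType d) (R : realType)
    (m : {measure set T -> \bar R}) (f g : T -> \bar R) :
  (forall x, 0 <= f x)%E -> (forall x, f x <= g x)%E ->
  (\int[m]_x f x <= \int[m]_x g x)%E.
Proof.
move=> f0 fg; have g0 x : (0 <= g x)%E := le_trans (f0 x) (fg x).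
rewrite !ge0_integralTE//; apply: ereal_sup_le => _ [h hf <-]; exists h => //.
by move=> x; exact: le_trans (hf x) (fg x).
Qed.

Lemma Tcost_ge0 (R : realType) (d : nat) (p : R) (nu0 nu1 : set (Rd R d) -> \bar R) :
  (0 <= Tcost p nu0 nu1)%E.
Proof.
apply: le_ereal_inf_tmp => _ [pi _ <-]; apply: integral_ge0 => z _.
by rewrite lee_fin powR_ge0.
Qed.

(** * Expected cost in terms of the discrepancies of the cells *)

Section ExpectedCost.
Context (R : realType) (d : nat) (mu : probability (Rd R d) R)
  (k : R -> R.-pker (Rd R d) ~> (Rd R d))
  (dO : measure_display) (O : measurableType dO) (P : probability O R)
  (X : R -> O -> Rd R d).
Hypothesis markovX : is_markov_process P X k.
Hypothesis lawX0 : forall A : set (Rd R d), measurable A -> P (X 0 @^-1` A) = mu A.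
Hypothesis invk : mu_invariant mu k.
Local Notation E := (Rd R d).
Variables (p T : R) (N L : nat).
Hypotheses (d0 : (0 < d)%N) (p0 : 0 < p) (T0 : 0 < T).
Local Notation cell_index l := (option ('I_N.+1 * {ffun 'I_d -> 'I_(2 ^ l.+1).-1.+1})).
Local Notation outer := (fun x : E => (outer_cost p N (x : 'rV[R]_d))%:E).
Local Notation key := (@cell_key R d N L : E -> _).
Hypothesis outer_fin : (\int[mu]_x outer x < +oo)%E.

Lemma measurable_cell m (c : cell_index (L - m)) : measurable (cell c : set E).
Proof.
rewrite (_ : cell c = \bigcup_(i in [set i | coarsen m i = c]) (key @^-1` [set i])).
  by apply: fin_bigcup_measurable => // i _; exact: measurable_cell_key.
apply/seteqP; split => x /=; first by exists (cell_key N L (x : 'rV[R]_d)).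
by move=> [i <- /= xi]; rewrite /cell/= xi.
Qed.

Lemma expected_cost :
  (\int[P]_w Tcost p (empirical X T w) mu <= \int[mu]_x outer x + \int[mu]_x outer x +
    (\sum_i fine (mu (key @^-1` [set i])) * fine_cost p i +
     2 * \sum_(m < L.+1) \sum_(c : cell_index (L - m))
        coarse_cost p c * occupation_error mu P X T (cell c : set E))%:E)%E.
Proof.
have [nu nuE] := choice (empirical_probability markovX T0).
have mout : measurable_fun setT (outer_cost p N : E -> R) by exact: measurable_outer_cost.
have out0 (x : E) : 0 <= outer_cost p N (x : 'rV[R]_d) by exact: outer_cost_ge0.
have [mI PI] := @empirical_mean _ _ mu k _ O P X markovX lawX0 invk T T0 nu (outer_cost p N : E -> R) mout out0 outer_fin (fun w => (nuE w).2 _ mout out0).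
have mkey i : measurable (key @^-1` [set i]) by exact: measurable_cell_key.
have mc m c : measurable (@cell R d N L m c) by exact: measurable_cell.
pose dev m (c : cell_index (L - m)) w : R :=
  `|occupation X T (cell c : set E) w - fine (mu (cell c))|.
have bdev m c : bm (@dev m c).
  by apply: bm_norm; apply: bmB; [exact: (bm_occupation markovX)|exact: bm_cst].
pose H1 w : R := \sum_i occupation X T (key @^-1` [set i]) w * fine_cost p i.
pose H2 w : R := \sum_(m < L.+1) \sum_(c : cell_index (L - m))
   coarse_cost p c * dev m c w.
have bH1 : bm H1.
  by apply: bm_sum => i; apply: bmM; [exact: (bm_occupation markovX)|exact: bm_cst].
have bH2' m : bm (fun w => \sum_(c : cell_index (L - m))
   coarse_cost p c * dev m c w).
  by apply: bm_sum => c; apply: bmM => //; exact: bm_cst.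
have bH2 : bm H2 by apply: bm_sum => m.
have bH2c : bm (fun w => 2 * H2 w) by apply: bmM => //; exact: bm_cst.
have bH : bm (fun w => H1 w + 2 * H2 w) by exact: bmD.
have H10 w : 0 <= H1 w.
  by apply: sumr_ge0 => i _; rewrite mulr_ge0 ?occupation_ge0 ?fine_cost_ge0.
have H20 w : 0 <= H2 w.
  by apply: sumr_ge0 => i _; apply: sumr_ge0 => c _; rewrite mulr_ge0 ?coarse_cost_ge0// normr_ge0.
have Jge0 w : (0 <= \int[nu w]_x outer x)%E by apply: integral_ge0 => x _; rewrite lee_fin.
have J0 : (0 <= \int[mu]_x outer x)%E by apply: integral_ge0 => x _; rewrite lee_fin.
(* The pathwise bound is measurable in [w], unlike perhaps the cost itself, and can be integrated
   term by term. *)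
apply: (@le_trans _ _ (\int[P]_w ((\int[nu w]_x outer x + \int[mu]_x outer x) + (H1 w + 2 * H2 w)%:E)))%E.
  apply: ge0_le_integral_any => w; first exact: Tcost_ge0.
  rewrite (le_trans (Tcost_le N L d0 p0 mu (nuE w).1))// leeD2l// lee_fin.
  rewrite le_eqVlt; apply/orP; left; apply/eqP; congr (_ + 2 * _).
    by apply: eq_bigr => i _; rewrite (occupationE markovX _ (nuE w).2).
  by apply: eq_bigr => m _; apply: eq_bigr => c _; rewrite (occupationE markovX _ (nuE w).2).
have s0 w : setT w -> (0 <= \int[nu w]_x outer x + \int[mu]_x outer x)%E by move=> _; exact: adde_ge0.
have ms : measurable_fun setT (fun w => \int[nu w]_x outer x + \int[mu]_x outer x)%E.
  by apply: emeasurable_funD => //; exact: measurable_cst.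
have mH : measurable_fun setT (fun w => (H1 w + 2 * H2 w)%:E) by apply/measurable_EFinP; case: bH.
have H0 w : setT w -> (0 <= (H1 w + 2 * H2 w)%:E)%E by move=> _; rewrite lee_fin addr_ge0 ?mulr_ge0.
rewrite ge0_integralD//.
rewrite ge0_integralD//.
rewrite PI (bm_RintegralE P bH) bm_RintegralD// bm_RintegralZl//.
rewrite bm_Rintegral_sum; last first.
  by move=> i; apply: bmM; [exact: (bm_occupation markovX)|exact: bm_cst].
rewrite [X in (_ + (_ + 2 * X)%:E)%E]bm_Rintegral_sum//.
apply: leeD.
  apply: leeD => //.
  have /fineK <- : (\int[mu]_x outer x)%E \is a fin_num by rewrite ge0_fin_numE.
  by rewrite integral_cst// [X in (_ * X)%E]probability_setT mule1.
rewrite lee_fin le_eqVlt; apply/orP; left; apply/eqP; congr (_ + 2 * _).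
  apply: eq_bigr => i _; rewrite bm_RintegralZr; last exact: (bm_occupation markovX).
  by rewrite (occupation_mean markovX lawX0 invk T0).
apply: eq_bigr => m _; rewrite bm_Rintegral_sum; last by move=> c; apply: bmM => //; exact: bm_cst.
by apply: eq_bigr => c _; rewrite bm_RintegralZl.
Qed.

End ExpectedCost.

Lemma sum_option (R : nmodType) (I : finType) (F : option I -> R) :
  \sum_k F k = F None + \sum_i F (Some i).
Proof.
rewrite (bigD1 None)//=; congr (_ + _).
rewrite (reindex_omap Some id)/=; last by case.
by apply: eq_bigl => i; rewrite eqxx.
Qed.

(** * Geometric sums, interpolation and exponents *)

Section RealEstimates.
Context (R : realType).
Implicit Types a c x : R.

Lemma geometric_sum_le (n : nat) c : 0 < c -> c < 1 -> \sum_(i < n) c ^+ i <= (1 - c)^-1.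
Proof.
move=> c0 c1; have := @geometric_le_lim R n 1 c ler01 c0.
rewrite gtr0_norm// div1r => /(_ c1); congr (_ <= _).
by rewrite /series/= big_mkord; apply: eq_bigr => i _; rewrite /geometric/= mul1r.
Qed.

Lemma geometric_sum_rev_le (n : nat) c : 0 < c -> c < 1 ->
  \sum_(i < n.+1) c ^+ (n - i) <= (1 - c)^-1.
Proof.
move=> c0 c1; rewrite (reindex_inj rev_ord_inj)/= (le_trans _ (geometric_sum_le n.+1 c0 c1))//.
by apply: ler_sum => i _; rewrite subSS subKn// -ltnS.
Qed.

Lemma geometric_small (b c e : R) : 0 <= c -> c < 1 -> 0 < e -> exists n : nat, b * c ^+ n <= e.
Proof.
move=> c0 c1 e0; have c1' : `|c| < 1 by rewrite ger0_norm.
have := cvg_geometric b c1' => /cvgrPdist_le /(_ e e0) [n _ /(_ n (leqnn n))] /=.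
by rewrite sub0r normrN => h; exists n; rewrite (le_trans (ler_norm _)).
Qed.

Lemma sqr_sum_le (I : finType) (F : I -> R) :
  (\sum_i F i) ^+ 2 <= #|I|%:R * \sum_i F i ^+ 2.
Proof.
have [I0|I0] := posnP #|I|.
  have e (G : I -> R) : \sum_i G i = 0.
    by apply: big1 => i _; have := card0_eq I0 i; rewrite inE.
  by rewrite !e expr0n mulr0.
set x := \sum_i F i; set n := #|I|%:R : R; set y := \sum_i F i ^+ 2.
have n0 : 0 < n by rewrite ltr0n.
have : 0 <= \sum_i (n * F i - x) ^+ 2 by apply: sumr_ge0 => i _; exact: sqr_ge0.
rewrite (_ : \sum_i _ = n * (n * y - x ^+ 2)) ?pmulr_rge0 ?subr_ge0//.
transitivity (\sum_i (n ^+ 2 * F i ^+ 2 + - (2 * n * x) * F i + x ^+ 2)).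
  by apply: eq_bigr => i _; ring.
rewrite !big_split/= -!mulr_sumr -/x -/y sumr_const -mulr_natl -/n.
by ring.
Qed.

(** Write [x] as [x^(1 - 2 a) (x^2)^a]; [a <= 1 / 2] makes the first power monotone. *)
Lemma powR_interp (x y z a : R) : 0 <= x -> x <= y -> x ^+ 2 <= z -> 0 < a -> a <= 1 / 2 ->
  x <= y `^ (1 - 2 * a) * z `^ a.
Proof.
move=> x0 xy xz a0 a2.
have [->|xn0] := eqVneq x 0; first by rewrite mulr_ge0 ?powR_ge0.
have xp : 0 < x by rewrite lt_neqAle eq_sym xn0.
have y0 := le_trans x0 xy; have z0 := le_trans (sqr_ge0 x) xz.
apply: (@le_trans _ _ (x `^ (1 - 2 * a) * (x ^+ 2) `^ a)).
  rewrite -powR_mulrn// -powRrM -powRD; last by rewrite xn0 implybT.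
  by rewrite (_ : 1 - 2 * a + 2%:R * a = 1) ?powRr1//; ring.
apply: ler_pM; rewrite ?powR_ge0//.
  by apply: ge0_ler_powR; rewrite ?nnegrE//; lra.
by apply: ge0_ler_powR; rewrite ?nnegrE//; [exact: ltW|exact: sqr_ge0].
Qed.

(** Here [D] is the dimension, [A = 2^n] the radius of the shell and [B = 2^(L - m)] the fineness of
    the level. The logarithm reduces the identity to ring arithmetic. *)
Lemma rate_identity (p q a D K Q T A B : R) : 0 < D -> 0 < K -> 0 < Q -> 0 < T -> 0 < A -> 0 < B ->
  (D * (A * (2 / B))) `^ p *
   ((2 * (Q * A `^ (- q))) `^ (1 - 2 * a) * ((2 * B) `^ D * K * (Q * A `^ (- q)) / T) `^ a) =
  (2 * D) `^ p * (2 * Q) `^ (1 - 2 * a) * (2 `^ D * K * Q) `^ a *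
   T `^ (- a) * A `^ (p - q * (1 - a)) * B `^ (D * a - p).
Proof.
move=> D0 K0 Q0 T0 A0 B0.
apply: ln_inj; rewrite ?posrE ?mulr_gt0 ?powR_gt0 ?mulr_gt0 ?powR_gt0 ?mulr_gt0 ?invr_gt0//.
rewrite !(lnM, ln_powR) ?posrE ?mulr_gt0 ?powR_gt0 ?mulr_gt0 ?powR_gt0 ?mulr_gt0 ?invr_gt0//.
by rewrite !lnV ?posrE//; ring.
Qed.

Lemma powR_expr x c (n : nat) : 0 <= x -> (x ^+ n) `^ c = (x `^ c) ^+ n.
Proof.
by move=> x0; rewrite -powR_mulrn// -(powR_mulrn n (powR_ge0 x c)) -!powRrM mulrC.
Qed.

Lemma powR2_lt1 c : c < 0 -> (2 : R) `^ c < 1.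
Proof.
move=> c0; have l2 : 0 < ln (2 : R) by rewrite ln_gt0// ltr1n.
by rewrite /powR pnatr_eq0/= -[ltRHS]expR0 ltr_expR nmulr_rlt0.
Qed.

End RealEstimates.

(** * Moment bounds for the shells and the tail *)

Section Moments.
Context (R : realType) (d : nat) (mu : probability (Rd R d) R) (p q : R).
Local Notation E := (Rd R d).
Hypotheses (p0 : 0 < p) (pq : p < q).
Hypothesis moment : (\int[mu]_x (enorm (x : 'rV[R]_d) `^ q)%:E < +oo)%E.

Let M := fine (\int[mu]_x (enorm (x : 'rV[R]_d) `^ q)%:E).

Let M0 : 0 <= M.
Proof. by apply: fine_ge0; apply: integral_ge0 => x _; rewrite lee_fin powR_ge0. Qed.

Let ME : (\int[mu]_x (enorm (x : 'rV[R]_d) `^ q)%:E)%E = M%:E.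
Proof.
by rewrite fineK// ge0_fin_numE//; apply: integral_ge0 => x _; rewrite lee_fin powR_ge0.
Qed.

Let q0 : 0 < q. Proof. exact: lt_trans pq. Qed.

(** The 1 serves shell 0; the other term is Markov's inequality on [|x| >= 2^(n - 1)], with [2^q]
    making up for the shift of the exponent. *)
Definition shell_const : R := 1 + 2 `^ q * M.

Lemma shell_const_gt0 : 0 < shell_const.
Proof. by rewrite ltr_pwDl// mulr_ge0 ?powR_ge0. Qed.

Lemma mass_shell_le n : fine (mu [set x : E | shell (x : 'rV[R]_d) = n]) <=
  shell_const * (2 ^+ n) `^ (- q).
Proof.
set S := [set x : E | _]; have mS : measurable S by exact: measurable_shell.
case: n @S mS => [|n] S mS.
  rewrite expr0 powR1 mulr1 (@le_trans _ _ 1)//; last by rewrite lerDl mulr_ge0 ?powR_ge0.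
  by rewrite -lee_fin fineK ?probability_le1// fin_num_measure.
have a0 : 0 < (2 ^+ n : R) `^ q by rewrite powR_gt0 ?exprn_gt0.
have h : (2 ^+ n) `^ q * fine (mu S) <= M.
  rewrite -Rintegral_indicT// -bm_RintegralZl; last exact: bm_indic.
  rewrite -lee_fin -bm_RintegralE; last by apply: bmM; [exact: bm_cst|exact: bm_indic].
  rewrite -ME; apply: ge0_le_integral => //.
  - by apply/measurable_EFinP; apply: measurable_funM => //; exact: measurable_indic.
  - by apply/measurable_EFinP; exact: measurable_enorm_powR.
  move=> x _; rewrite lee_fin indicE; case: (boolP (x \in S)) => [|_]; last by rewrite mulr0 powR_ge0.
  rewrite inE /S/= mulr1 => sx.
  apply: (ge0_ler_powR (ltW q0)); rewrite ?nnegrE ?exprn_ge0 ?enorm_ge0//.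
  by rewrite leNgt -shell_le sx ltnn.
have e : (2 ^+ n.+1 : R) `^ (- q) = 2 `^ (- q) / (2 ^+ n) `^ q.
  by rewrite exprS powRM ?exprn_ge0// powRN [(_ ^+ n) `^ (- q)]powRN.
rewrite e mulrA ler_pdivlMr// mulrC (le_trans h)// /shell_const mulrDl mul1r.
rewrite -mulrA [M * _]mulrC mulrA -powRD ?subrr ?powRr0 ?mul1r ?lerDr ?powR_ge0//.
by rewrite pnatr_eq0 implybT.
Qed.

(** Beyond the shells [|x| >= 2^N], so [|x|^p] is at most [|x|^q] times [(2^N)^(p - q)]. *)
Lemma outer_cost_moment N (x : E) :
  outer_cost p N (x : 'rV[R]_d) <= 2 `^ p * (2 `^ (p - q)) ^+ N * enorm (x : 'rV[R]_d) `^ q.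
Proof.
rewrite /outer_cost; have [sx|sx] := leqP (shell x) N.
  by rewrite mulr0 !mulr_ge0 ?exprn_ge0 ?powR_ge0.
rewrite mulr1 -mulrA ler_wpM2l ?powR_ge0//.
have h : 2 ^+ N <= enorm (x : 'rV[R]_d) by rewrite leNgt -shell_le -ltnNge.
have N0 : 0 < 2 ^+ N :> R by rewrite exprn_gt0.
have x0 : 0 < enorm (x : 'rV[R]_d) by exact: lt_le_trans h.
rewrite -powR_expr// -[p - q]opprB powRN mulrC ler_pdivlMr ?powR_gt0//.
rewrite [X in _ <= _ `^ X](_ : q = p + (q - p)); last by ring.
rewrite powRD; last by rewrite (gt_eqF x0) implybT.
by rewrite ler_wpM2l ?powR_ge0//; apply: ge0_ler_powR; rewrite ?nnegrE ?subr_ge0 ?enorm_ge0 ?exprn_ge0// ltW.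
Qed.

Lemma outer_integral_le N : (\int[mu]_x (outer_cost p N (x : 'rV[R]_d))%:E <=
  (2 `^ p * M * (2 `^ (p - q)) ^+ N)%:E)%E.
Proof.
apply: (@le_trans _ _ (\int[mu]_x ((2 `^ p * (2 `^ (p - q)) ^+ N)%:E *
    (enorm (x : 'rV[R]_d) `^ q)%:E))%E).
  apply: ge0_le_integral => //.
  - by move=> x _; rewrite lee_fin outer_cost_ge0.
  - by apply/measurable_EFinP; exact: measurable_outer_cost.
  - apply: measurable_funeM; apply/measurable_EFinP; exact: measurable_enorm_powR.
  - by move=> x _; rewrite -EFinM lee_fin outer_cost_moment.
rewrite ge0_integralZl//.
- by rewrite ME -EFinM mulrAC.
- by apply/measurable_EFinP; exact: measurable_enorm_powR.
- by move=> x _; rewrite lee_fin powR_ge0.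
Qed.

Local Notation cell_index N l := (option ('I_N.+1 * {ffun 'I_d -> 'I_(2 ^ l.+1).-1.+1})).

Lemma coarsen_SomeP N L m (x : E) (n : 'I_N.+1) g : (m <= L)%N ->
  coarsen m (cell_key N L (x : 'rV[R]_d)) = Some (n, g) -> shell (x : 'rV[R]_d) = n.
Proof.
case kx : (cell_key N L (x : 'rV[R]_d)) => [[n' g']|] //= mL; rewrite mL => -[<- _].
by have /cell_key_Some[] := kx.
Qed.

Lemma mass_cells_le N L m (n : 'I_N.+1) : (m <= L)%N ->
  \sum_(g : {ffun 'I_d -> 'I_(2 ^ (L - m).+1).-1.+1})
    fine (mu (cell (Some (n, g)) : set E)) <=
  fine (mu [set x : E | shell (x : 'rV[R]_d) = n]).
Proof.
move=> mL; set S := [set x : E | _]; have mS : measurable S by exact: measurable_shell.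
have mc g : measurable (@cell R d N L m (Some (n, g)) : set E) by exact: measurable_cell.
under eq_bigr do rewrite -Rintegral_indicT//.
rewrite -Rintegral_indicT// -bm_Rintegral_sum; last by move=> g; exact: bm_indic.
apply: bm_le_Rintegral; [by apply: bm_sum => g; exact: bm_indic|exact: bm_indic|].
move=> x; rewrite [leRHS]indicE; case: (boolP (x \in S)) => xS; last first.
  rewrite big1// => g _; rewrite indicE; case: (boolP (x \in _)) => //.
  by rewrite inE /cell/= => /(coarsen_SomeP mL) sx; case/negP: xS; rewrite inE.
case cx : (coarsen m (cell_key N L (x : 'rV[R]_d))) => [[n' g']|]; last first.
  rewrite big1// => g _; rewrite indicE; case: (boolP (x \in _)) => //.
  by rewrite inE /cell/= cx.
rewrite (bigD1 g')//= big1 ?addr0; first by rewrite indicE lern1 leq_b1.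
move=> g gg'; rewrite indicE; case: (boolP (x \in _)) => //.
by rewrite inE /cell/= cx => -[_ /esym/eqP]; rewrite (negbTE gg').
Qed.

Lemma fine_sum_le N L :
  \sum_i fine (mu ((cell_key N L : E -> cell_index N L) @^-1` [set i])) * fine_cost p i <=
  (d%:R * 2 ^+ N) `^ p * (2 `^ (- p)) ^+ L.
Proof.
set c := _ * _.
have c0 : 0 <= c by rewrite mulr_ge0 ?exprn_ge0 ?powR_ge0.
apply: (@le_trans _ _ (\sum_i fine (mu ((cell_key N L : E -> cell_index N L) @^-1` [set i])) * c)).
  apply: ler_sum => i _; rewrite ler_wpM2l ?fine_ge0//.
  have cE : c = (d%:R * 2 ^+ N / 2 ^+ L) `^ p.
    rewrite powRM ?mulr_ge0 ?invr_ge0 ?exprn_ge0// -[(2 ^+ L)^-1]powR_inv1 ?exprn_ge0//.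
    by rewrite -powRrM mulN1r powR_expr.
  case: i => [[n g]|]//=; rewrite cE; apply: (ge0_ler_powR (ltW p0)).
  - by rewrite nnegrE !mulr_ge0 ?invr_ge0 ?exprn_ge0.
  - by rewrite nnegrE !mulr_ge0 ?invr_ge0 ?exprn_ge0.
  rewrite expr0 mul1r mulrA ler_wpM2r ?invr_ge0 ?exprn_ge0// ler_wpM2l//.
  by rewrite ler_eXn2l ?ltr1n// -ltnS.
rewrite -mulr_suml -[leRHS]mul1r ler_wpM2r//.
have mkey i : measurable ((cell_key N L : E -> cell_index N L) @^-1` [set i]) by exact: measurable_cell_key.
have -> : \sum_i fine (mu ((cell_key N L : E -> cell_index N L) @^-1` [set i])) = fine (mu setT).
  rewrite -(@sum_cells _ E R _ (fun i => (cell_key N L : E -> cell_index N L) @^-1` [set i]) _ _ _ mu setT)//.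
  - by apply: eq_bigr => i _; rewrite setTI.
  - by move=> x; exists (cell_key N L (x : 'rV[R]_d)).
  - by move=> i j x /= -> .
by rewrite -lee_fin fineK ?probability_le1// fin_num_measure.
Qed.

End Moments.

(** * Summation over the levels and the shells *)

Section Rate.
Context (R : realType) (d : nat) (mu : probability (Rd R d) R)
  (k : R -> R.-pker (Rd R d) ~> (Rd R d))
  (dO : measure_display) (O : measurableType dO) (P : probability O R)
  (X : R -> O -> Rd R d).
Hypothesis markovX : is_markov_process P X k.
Hypothesis lawX0 : forall A : set (Rd R d), measurable A -> P (X 0 @^-1` A) = mu A.
Hypothesis invk : mu_invariant mu k.
Local Notation E := (Rd R d).
Variable lam : R.
Hypothesis lam0 : 0 < lam.
Hypothesis poincare : forall f g : E -> R, L2_generator mu k f g ->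
  (\int[mu]_x (f x)%:E = 0)%E ->
  (lam%:E * Lnorm mu 2%:E (EFin \o f) <= Lnorm mu 2%:E (EFin \o g))%E.
Variables (p q a : R).
Hypotheses (d0 : (0 < d)%N) (p0 : 0 < p) (pq : p < q).
Hypothesis moment : (\int[mu]_x (enorm (x : 'rV[R]_d) `^ q)%:E < +oo)%E.
Hypotheses (a0 : 0 < a) (a2 : a <= 1 / 2) (ad : d%:R * a < p) (aq : p < q * (1 - a)).

Let K : R := 2 * (2 / lam + 2).
Let Q : R := shell_const mu q.
Let c1 : R := 2 `^ (p - q * (1 - a)).
Let c2 : R := 2 `^ (d%:R * a - p).
Let C0 : R := (2 * d%:R) `^ p * (2 * Q) `^ (1 - 2 * a) * (2 `^ d%:R * K * Q) `^ a.

Let K0 : 0 < K.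
Proof. by rewrite mulr_gt0// addr_gt0// divr_gt0. Qed.

Let Q0 : 0 < Q. Proof. exact: shell_const_gt0. Qed.

Let C00 : 0 <= C0. Proof. by rewrite !mulr_ge0 ?powR_ge0. Qed.

Local Notation error T := (occupation_error mu P X T).

(** The first factor sums the trivial bounds. The second is Cauchy-Schwarz over the
    [(2 * 2^(L - m))^d] cubes, with squared errors adding up to [K / T] times the mass of the
    shell. *)
Lemma level_error N L T m (n : 'I_N.+1) : 0 < T -> (m <= L)%N ->
  \sum_(g : {ffun 'I_d -> 'I_(2 ^ (L - m).+1).-1.+1}) error T (cell (Some (n, g)) : set E) <=
  (2 * (Q * (2 ^+ n) `^ (- q))) `^ (1 - 2 * a) *
  ((2 * 2 ^+ (L - m)) `^ d%:R * K * (Q * (2 ^+ n) `^ (- q)) / T) `^ a.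
Proof.
move=> T0 mL.
have mc g : measurable (@cell R d N L m (Some (n, g)) : set E) by exact: measurable_cell.
have mass := le_trans (mass_cells_le mu n mL) (mass_shell_le p0 pq moment n).
rewrite -/Q in mass.
apply: powR_interp => //.
- by apply: sumr_ge0 => g _; exact: occupation_error_ge0.
- rewrite (le_trans _ (ler_wpM2l (ler0n R 2) mass))// mulr_sumr.
  by apply: ler_sum => g _; exact: (occupation_error_le markovX lawX0 invk T0).
rewrite (le_trans (sqr_sum_le _))//.
have cardE : #|{ffun 'I_d -> 'I_(2 ^ (L - m).+1).-1.+1}|%:R = (2 * 2 ^+ (L - m)) `^ d%:R :> R.
  by rewrite card_ffun !card_ord size_idx powR_mulrn ?mulr_ge0 ?exprn_ge0// -exprS natrX natrX.
rewrite cardE.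
have -> : (2 * 2 ^+ (L - m)) `^ d%:R * K * (Q * (2 ^+ n) `^ (- q)) / T =
    (2 * 2 ^+ (L - m)) `^ d%:R * (K / T * (Q * (2 ^+ n) `^ (- q))) by ring.
rewrite ler_wpM2l ?powR_ge0//.
apply: (@le_trans _ _ (\sum_(g : {ffun 'I_d -> 'I_(2 ^ (L - m).+1).-1.+1})
   K / T * fine (mu (cell (Some (n, g)) : set E)))).
  apply: ler_sum => g _.
  rewrite (le_trans (occupation_error_sqr markovX lawX0 invk T0 lam0 poincare (mc g)))//.
  by rewrite -/K mulrAC.
by rewrite -mulr_sumr ler_wpM2l// divr_ge0// ltW.
Qed.

Lemma level_cost N L T m (n : 'I_N.+1) : 0 < T -> (m <= L)%N ->
  \sum_(g : {ffun 'I_d -> 'I_(2 ^ (L - m).+1).-1.+1})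
    coarse_cost p (Some (n, g)) * error T (cell (Some (n, g)) : set E) <=
  C0 * T `^ (- a) * c1 ^+ n * c2 ^+ (L - m).
Proof.
move=> T0 mL; rewrite /coarse_cost/= -mulr_sumr.
rewrite (le_trans (ler_wpM2l (powR_ge0 _ _) (level_error n T0 mL)))//.
have e : 2 ^+ m.+1 / 2 ^+ L = 2 / 2 ^+ (L - m) :> R.
  rewrite -{1}(subnKC mL) exprD exprS; field.
  by rewrite !gt_eqF ?exprn_gt0.
rewrite e rate_identity ?ltr0n ?exprn_gt0// -/C0 /c1 /c2.
by rewrite !powR_expr.
Qed.

(** [ad] and [aq] make both ratios [c1] and [c2] smaller than 1, so the bound is uniform in [N] and
    [L]. *)
Lemma levels_cost N L T : 0 < T ->
  \sum_(m < L.+1) \sum_(c : option ('I_N.+1 * {ffun 'I_d -> 'I_(2 ^ (L - m).+1).-1.+1}))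
    coarse_cost p c * error T (cell c : set E) <=
  C0 * ((1 - c1)^-1 * (1 - c2)^-1) * T `^ (- a).
Proof.
move=> T0.
have c10 : 0 < c1 by rewrite powR_gt0.
have c20 : 0 < c2 by rewrite powR_gt0.
have c11 : c1 < 1 by rewrite powR2_lt1// subr_lt0.
have c21 : c2 < 1 by rewrite powR2_lt1// subr_lt0.
have Ta := powR_ge0 T (- a).
have C0T : 0 <= C0 * T `^ (- a) by exact: mulr_ge0.
apply: (@le_trans _ _ (\sum_(m < L.+1) \sum_(n < N.+1) C0 * T `^ (- a) * c1 ^+ n * c2 ^+ (L - m))).
  apply: ler_sum => m _; have mL : (m <= L)%N by rewrite -ltnS.
  rewrite sum_option [coarse_cost _ _]/= mul0r add0r.
  rewrite (_ : \sum_i _ = \sum_(n : 'I_N.+1) \sum_(g : {ffun 'I_d -> 'I_(2 ^ (L - m).+1).-1.+1})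
      coarse_cost p (Some (n, g)) * error T (cell (Some (n, g)) : set E)); last first.
    by rewrite pair_bigA/=; apply: eq_bigr => -[].
  by apply: ler_sum => n _; exact: level_cost.
under eq_bigr do rewrite -mulr_suml -mulr_sumr.
rewrite -mulr_sumr -mulrA [C0 * _ * T `^ _]mulrAC ler_wpM2l//.
apply: ler_pM.
- by apply: sumr_ge0 => n _; rewrite exprn_ge0// ltW.
- by apply: sumr_ge0 => n _; rewrite exprn_ge0// ltW.
- exact: geometric_sum_le.
- exact: geometric_sum_rev_le.
Qed.

Lemma transport_rate : exists2 C : R, 0 < C & forall T, 0 < T ->
  (\int[P]_w Tcost p (empirical X T w) mu <= (C * T `^ (- a))%:E)%E.
Proof.
(* The 2 covers the tail and the finest cubes, once each. *)
pose C := 2 + 2 * (C0 * ((1 - c1)^-1 * (1 - c2)^-1)).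
have C0' : 0 < C.
  have c11 : c1 < 1 by rewrite powR2_lt1// subr_lt0.
  have c21 : c2 < 1 by rewrite powR2_lt1// subr_lt0.
  have h1 : 0 <= (1 - c1)^-1 by rewrite invr_ge0 subr_ge0 ltW.
  have h2 : 0 <= (1 - c2)^-1 by rewrite invr_ge0 subr_ge0 ltW.
  by rewrite /C ltr_pwDl// mulr_ge0// mulr_ge0// mulr_ge0.
exists C => // T T0; have Ta : 0 < T `^ (- a) by rewrite powR_gt0.
have pq2 : (2 : R) `^ (p - q) < 1 by rewrite powR2_lt1// subr_lt0.
have p2 : (2 : R) `^ (- p) < 1 by rewrite powR2_lt1// oppr_lt0.
(* [N] is chosen for the tail, then [L], since the finest cubes have side up to [2^N / 2^L]. Both
   depend on [T], which [levels_cost] allows. *)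
have [N hN] := geometric_small (2 * (2 `^ p * fine (\int[mu]_x (enorm (x : 'rV[R]_d) `^ q)%:E)%E)) (powR_ge0 2 (p - q)) pq2 Ta.
have [L hL] := geometric_small ((d%:R * 2 ^+ N) `^ p) (powR_ge0 2 (- p)) p2 Ta.
have outN := outer_integral_le pq moment N.
have outfin := le_lt_trans outN (ltry _).
rewrite (le_trans (expected_cost markovX lawX0 invk L d0 p0 T0 outfin))//.
apply: (@le_trans _ _ ((T `^ (- a))%:E + (T `^ (- a) + 2 * (C0 * ((1 - c1)^-1 * (1 - c2)^-1) * T `^ (- a)))%:E)%E).
  apply: leeD.
    rewrite (le_trans (leeD outN outN))// -EFinD lee_fin (le_trans _ hN)//.
    by rewrite -[leRHS]mulrA [leRHS]mulr_natl mulr2n.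
  rewrite lee_fin lerD//; first exact: le_trans (fine_sum_le mu p0 N L) hL.
  by rewrite ler_wpM2l// levels_cost.
by rewrite -EFinD lee_fin /C le_eqVlt; apply/orP; left; apply/eqP; ring.
Qed.

End Rate.

Theorem theorem1p2 (R : realType) (d : nat) (mu : probability (Rd R d) R)
  (k : R -> R.-pker (Rd R d) ~> (Rd R d))
  (dO : measure_display) (O : measurableType dO) (P : probability O R)
  (X : R -> O -> Rd R d) (p q : R) :
  (0 < d)%N ->
  is_markov_process P X k ->
  (forall A : set (Rd R d), measurable A -> P (X 0 @^-1` A) = mu A) ->
  mu_invariant mu k -> kergodic mu k ->
  (exists lamI : R, 0 < lamI /\
     forall f g : Rd R d -> R, L2_generator mu k f g ->
       (\int[mu]_x (f x)%:E = 0)%E ->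
       (lamI%:E * Lnorm mu 2%:E (EFin \o f) <= Lnorm mu 2%:E (EFin \o g))%E) ->
  0 < p -> p < q -> (\int[mu]_x (enorm (x : 'rV[R]_d) `^ q)%:E < +oo)%E ->
  let g1 := Num.max (1 / 4) (1 - p / d%:R) in
  (exists C : R, 0 < C /\ forall T : R, 2 <= T ->
     (\int[P]_w Tcost p (empirical X T w) mu <=
      (C * T `^ (- (2 / 3) * (1 - Num.max g1 (p / q)))
         * (if g1 * q == p then ln T else 1)
         * (if p == 3 / 4 * d%:R then ln T else 1))%:E)%E) /\
  (4 * p < q ->
   exists C : R, 0 < C /\ forall T : R, 2 <= T ->
     (\int[P]_w Tcost p (empirical X T w) mu <=
      (C * (if 3 / 4 * d%:R < p then T `^ (- (1 / 2))
            else if p == 3 / 4 * d%:R then T `^ (- (1 / 2)) * ln T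
            else T `^ (- ((2 * p) / (3 * d%:R)))))%:E)%E).
Proof.
move=> d0 markovX lawX0 invk _ [lam [lam0 poincare]] p0 pq moment g1.
have D0 : 0 < d%:R :> R by rewrite ltr0n.
have q0 : 0 < q by exact: lt_trans pq.
have pd0 : 0 < p / d%:R by exact: divr_gt0.
have pq1 : p / q < 1 by rewrite ltr_pdivrMr// mul1r.
set M := Num.max g1 (p / q).
have M1 : M < 1 by rewrite !gt_max pq1 andbT; apply/andP; split; lra.
have Mg : g1 <= M by rewrite le_max lexx.
have Mpq : p / q <= M by rewrite le_max lexx orbT.
have g14 : 1 / 4 <= g1 by rewrite le_max lexx.
have g1d : 1 - p / d%:R <= g1 by rewrite le_max lexx orbT.
(* [1 - M] is at most [3 / 4], [p / d] and [1 - p / q]. The factor [2 / 3] turns [3 / 4] into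
   [1 / 2] and makes the other two bounds strict, as the geometric series require. *)
pose a := 2 / 3 * (1 - M).
have a0 : 0 < a by rewrite /a; lra.
have a2 : a <= 1 / 2 by rewrite /a; lra.
have ad : d%:R * a < p.
  have h : a < p / d%:R by rewrite /a; lra.
  by rewrite mulrC -ltr_pdivlMr.
have aq : p < q * (1 - a).
  have h : p / q < 1 - a by rewrite /a; lra.
  by rewrite mulrC -ltr_pdivrMr.
have [C C0 rate] := transport_rate markovX lawX0 invk lam0 poincare d0 p0 pq moment a0 a2 ad aq.
(* The bound [C T^(-a)] also holds in the critical cases. Each factor of the statement, 1 or [ln T],
   is at least [l], so dividing the constant by [l] once per factor suffices. *)
pose l : R := Num.min 1 (ln 2).
have l0 : 0 < l by rewrite lt_min ltr01/= ln_gt0// ltr1n.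
have l1 : l <= 1 by rewrite ge_min lexx.
have lT T : 2 <= T -> l <= ln T.
  by move=> T2; rewrite ge_min ler_ln ?posrE ?T2 ?orbT// (lt_le_trans _ T2).
have T0 (T : R) : 2 <= T -> 0 < T by exact: lt_le_trans.
split.
  exists (C / l ^+ 2); split; first by rewrite divr_gt0 ?exprn_gt0.
  move=> T T2; rewrite (le_trans (rate T (T0 T T2)))// lee_fin -/M.
  have -> : - (2 / 3) * (1 - M) = - a by rewrite /a mulNr.
  set f1 := if _ then _ else _; set f2 := if _ then _ else _.
  have h1 : l <= f1 by rewrite /f1; case: ifP => // _; exact: lT.
  have h2 : l <= f2 by rewrite /f2; case: ifP => // _; exact: lT.
  have h12 : l ^+ 2 <= f1 * f2 by rewrite expr2 ler_pM// ltW.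
  have -> : C / l ^+ 2 * T `^ (- a) * f1 * f2 = C * T `^ (- a) * (f1 * f2 / l ^+ 2).
    by ring.
  rewrite ler_peMr ?mulr_ge0 ?powR_ge0 ?(ltW C0)//.
  by rewrite ler_pdivlMr ?exprn_gt0// mul1r.
move=> q4p.
(* From [4 p < q] follows [p / q < 1 / 4 <= g1], so the moment drops out of the exponent. *)
have aE : a = 2 / 3 * (1 - g1).
  have h : p / q < 1 / 4 by rewrite ltr_pdivrMr//; lra.
  by rewrite /a /M (max_idPl _)//; lra.
exists (C / l); split; first exact: divr_gt0.
move=> T T2; rewrite (le_trans (rate T (T0 T T2)))// lee_fin.
have -> : C / l * (if 3 / 4 * d%:R < p then T `^ (- (1 / 2))
    else if p == 3 / 4 * d%:R then T `^ (- (1 / 2)) * ln T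
    else T `^ (- (2 * p / (3 * d%:R)))) =
  C * T `^ (- a) * ((if p == 3 / 4 * d%:R then ln T else 1) / l).
  (* The maximum [g1] switches at [p / d = 3 / 4]: the exponent is [2 / 3 * 3 / 4 = 1 / 2] from
     there on and [2 / 3 * p / d] below. *)
  have [h|h|h] := ltgtP (3 / 4 * d%:R) p.
  - rewrite (_ : a = 1 / 2); first by ring.
    have h' : 3 / 4 < p / d%:R by rewrite ltr_pdivlMr.
    by rewrite aE /g1 (max_idPl _); lra.
  - rewrite (_ : a = 2 * p / (3 * d%:R)); first by ring.
    have h' : p / d%:R < 3 / 4 by rewrite ltr_pdivrMr.
    rewrite aE /g1 (max_idPr _); last by lra.
    by field; rewrite gt_eqF.
  - rewrite (_ : a = 1 / 2); first by ring.
    have h' : p / d%:R = 3 / 4 by rewrite -h mulfK// gt_eqF.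
    by rewrite aE /g1 h' (max_idPl _); lra.
rewrite ler_peMr ?mulr_ge0 ?powR_ge0 ?(ltW C0)//.
by rewrite ler_pdivlMr// mul1r; case: ifP => // _; exact: lT.
Qed.
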